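(* In the random-column spiked model described in the context, in the limit $n\to\infty$ and $p/n\to0$ (i.e. $\gamma=0$), $$\lim_{n\to\infty}\frac1n\sum_{j=1}^n\|\widehat X_j^{\mathbf q^*}-\widehat X_j^{\mathrm{BLP}}\|^2=\lim_{n\to\infty}\|\widehat{\mathbf X}^{\mathbf q^*}-\widehat{\mathbf X}^{\mathrm{BLP}}\|_{\mathrm F}^2=0,$$ where the limit holds almost surely.
   Context: Model. Let $r\ge1$ and $t_1>\dots>t_r>0$ be fixed, independent of $n$ and $p$. Let $n\to\infty$ and $p=p(n)\to\infty$, with $p(n)/n\to\gamma=0$. For each $n$, $\mathbf u_1,\dots,\mathbf u_r$ are orthonormal vectors in $\mathbb R^p$ (depending on $n$, suppressed). The signal vectors are $X_j=\sum_{k=1}^r t_kz_{jk}\mathbf u_k$, $j=1,\dots,n$, where the $z_{jk}$ are mean zero, unit variance sub-Gaussian random variables (not depending on $n$); the vectors $(z_{j1},\dots,z_{jr})$, $j\ge1$, are iid, and for each $j$ the variables $z_{j1},\dots,z_{jr}$ are uncorrelated, so that the $\mathbf u_k$ are the principal components of $X_j$. Let $\mathbf X=[X_1,\dots,X_n]/\sqrt n$ (a $p\times n$ matrix), and let $\mathbf Y=\mathbf X+\mathbf G$ where $\mathbf G$ is a $p\times n$ matrix with iid $N(0,1/n)$ entries, independent of $\mathbf X$. Write $\mathbf Y=[Y_1,\dots,Y_n]/\sqrt n$, which defines $Y_j\in\mathbb R^p$. Optimal shrinker. Let $\hat{\mathbf u}_k,\hat{\mathbf v}_k$ ($1\le k\le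 r$) be the left and right singular vectors of $\mathbf Y$ for its top $r$ singular values, in decreasing order. The optimal shrinker for operator norm loss with $\gamma=0$ is $\widehat{\mathbf X}^{\mathbf q^*}=\sum_{k=1}^r q_k^*\hat{\mathbf u}_k\hat{\mathbf v}_k^T$ with $$q_k^*=t_k\sqrt{\frac{t_k^2+\min\{1,\gamma\}}{t_k^2+\max\{1,\gamma\}}}\Bigg|_{\gamma=0}=t_k\sqrt{\frac{t_k^2}{t_k^2+1}}.$$ Its columns are written as $\widehat{\mathbf X}^{\mathbf q^*}=[\widehat X_1^{\mathbf q^*},\dots,\widehat X_n^{\mathbf q^*}]/\sqrt n$. Best linear predictor. $\widehat X_j^{\mathrm{BLP}}=\sum_{k=1}^r\frac{t_k^2}{t_k^2+1}\langle Y_j,\mathbf u_k\rangle\mathbf u_k$, and $\widehat{\mathbf X}^{\mathrm{BLP}}=[\widehat X_1^{\mathrm{BLP}},\dots,\widehat X_n^{\mathrm{BLP}}]/\sqrt n$. $\|\cdot\|$ is the Euclidean norm and $\|\cdot\|_{\mathrm F}$ the Frobenius norm. *)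

(* Defs.v *)
From HB Require Import structures.
From mathcomp Require Import all_boot all_order all_algebra finmap.
From mathcomp Require Import all_classical all_reals all_analysis.

Set Implicit Arguments.
Unset Strict Implicit.
Unset Printing Implicit Defensive.

Import Order.TTheory GRing.Theory Num.Theory.
Import numFieldNormedType.Exports.

Local Open Scope classical_set_scope.
Local Open Scope ring_scope.

(* The library norm on matrices is the sup norm, hence the norms below. *)
Definition inner (R : realType) (m : nat) (x y : 'cV[R]_m) : R :=
  \sum_(i < m) x i 0 * y i 0.

Definition enorm (R : realType) (m : nat) (x : 'cV[R]_m) : R :=
  Num.sqrt (inner x x).

Definition fnorm (R : realType) (m n : nat) (A : 'M[R]_(m, n)) : R :=
  Num.sqrt (\sum_(i < m) \sum_(j < n) A i j ^+ 2).

(* [c_1, ..., c_n] / sqrt n, and the inverse operation A |-> c_j. *)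
Definition mx_of_columns (R : realType) (m n : nat) (c : 'I_n -> 'cV[R]_m) :
    'M[R]_(m, n) :=
  (Num.sqrt n%:R)^-1 *: \matrix_(i < m, j < n) c j i 0.

Definition column_of_mx (R : realType) (m n : nat) (A : 'M[R]_(m, n))
    (j : 'I_n) : 'cV[R]_m :=
  Num.sqrt n%:R *: col j A.

(* A = \sum_k s_k u_k v_k^T with s nonnegative and nonincreasing.  The
   families are indexed by nat, so that "the first r" makes sense for every r;
   only the indices k < min(m, n) are constrained. *)
Definition is_svd (R : realType) (m n : nat) (A : 'M[R]_(m, n))
    (s : nat -> R) (u : nat -> 'cV[R]_m) (v : nat -> 'cV[R]_n) : Prop :=
  [/\ forall k l, (k < minn m n)%N -> (l < minn m n)%N ->
        inner (u k) (u l) = (k == l)%:R,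
      forall k l, (k < minn m n)%N -> (l < minn m n)%N ->
        inner (v k) (v l) = (k == l)%:R,
      forall k, (k < minn m n)%N -> 0 <= s k,
      forall k l, (k <= l)%N -> (l < minn m n)%N -> s l <= s k &
      A = \sum_(k < minn m n) s k *: (u k *m (v k)^T)].

(* sigma(X_i : i in I) *)
Definition sigma_rv d (T : measurableType d) (R : realType) (I : Type)
    (X : I -> T -> R) : set (set T) :=
  <<s \bigcup_i preimage_set_system setT (X i) measurable >>.

Definition independent2 d (T : measurableType d) (R : realType)
    (P : probability T R) (F G : set (set T)) : Prop :=
  forall A B, F A -> G B -> P (A `&` B) = (P A * P B)%E.

(* Mutual independence. *)
Definition independent d (T : measurableType d) (R : realType)
    (P : probability T R) (I : choiceType) (F : I -> set (set T)) : Prop :=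
  forall (J : {fset I}) (A : I -> set T), (forall i, i \in J -> F i (A i)) ->
    P (\bigcap_(i in [set` J]) A i) = (\prod_(i <- J) P (A i))%E.

(* Finiteness of the sub-Gaussian (psi_2) norm. *)
Definition sub_gaussian d (T : measurableType d) (R : realType)
    (P : probability T R) (X : T -> R) : Prop :=
  exists K : R, 0 < K /\
    ('E_P[fun w => expR ((X w / K) ^+ 2)] <= 2%:E)%E.

Section Model.
Variables (R : realType) (r p n : nat).
Variables (t : 'I_r -> R) (u : 'I_r -> 'cV[R]_p).

Definition signal_mx (z : 'I_n -> 'I_r -> R) : 'M[R]_(p, n) :=
  mx_of_columns (fun j => \sum_(k < r) (t k * z j k) *: u k).

Definition opt_sv (gamma : R) (k : 'I_r) : R :=
  t k * Num.sqrt ((t k ^+ 2 + Num.min 1 gamma) / (t k ^+ 2 + Num.max 1 gamma)).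

Definition opt_shrinker (gamma : R) (uhat : nat -> 'cV[R]_p)
    (vhat : nat -> 'cV[R]_n) : 'M[R]_(p, n) :=
  \sum_(k < r) opt_sv gamma k *: (uhat k *m (vhat k)^T).

Definition blp_column (y : 'cV[R]_p) : 'cV[R]_p :=
  \sum_(k < r) (t k ^+ 2 / (t k ^+ 2 + 1) * inner y (u k)) *: u k.

Definition blp_mx (Y : 'M[R]_(p, n)) : 'M[R]_(p, n) :=
  mx_of_columns (fun j => blp_column (column_of_mx Y j)).

End Model.

(* Main.v *)
(* Write [Y = \sum_k t_k u_k zeta_k^T + N], with [N] the noise and
   [zeta_k = (z_1k, ..., z_nk) / sqrt n].  Almost surely, for large [n], the [zeta_k] are
   nearly orthonormal (Chernoff bounds and Borel-Cantelli), [|N^T x| <= (1 + e) |x|]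
   for all [x] (a union bound over at most [C ^ p] lattice directions, which is affordable
   because [p / n -> 0]), [|N^T u_k| -> 1], and [N zeta_k -> 0] (conditionally on the
   signal, [N zeta_k] is Gaussian).  Since [N N^T <= (1 + e)^2] as quadratic forms and
   [|N^T u_k|] is nearly 1, Cauchy-Schwarz for the form [(1 + e)^2 - N N^T] gives
   [N N^T u_k ~ u_k]; hence [Y Y^T u_k ~ (t_k^2 + 1) u_k], while [Y Y^T <= 1 + e] on the
   orthogonal complement of the [u_k].  As the values [t_k^2 + 1] are distinct and exceed 1,
   induction on [k] yields [s_k^2 -> t_k^2 + 1] and [<uhat_k, u_k>^2 -> 1].  The two
   predictors then agree in the limit, because the [k]-th term of their difference has
   squared Frobenius norm [q^2 - 2 q c s_k <uhat_k, u_k>^2 + c^2 |Y^T u_k|^2], with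
   [c = t_k^2 / (t_k^2 + 1)] and [q = t_k^2 / sqrt (t_k^2 + 1)]. *)

Require Import Defs.
From HB Require Import structures.
From mathcomp Require Import all_boot all_order all_algebra finmap.
From mathcomp Require Import all_classical all_reals all_analysis.
From mathcomp Require Import measurable_realfun ring lra.

Set Implicit Arguments.
Unset Strict Implicit.
Unset Printing Implicit Defensive.

Import Order.TTheory GRing.Theory Num.Theory.
Import numFieldNormedType.Exports.

Local Open Scope classical_set_scope.
Local Open Scope ring_scope.

(** Each random ingredient is reduced to a tail bound exponentially small in [n]. Such a bound
    outlasts a union over [C ^ p] directions, and the first Borel-Cantelli lemma then asks nothing
    about how the matrices for different [n] are related. After that the argument is deterministic:
    a point [w] is fixed outside a null set, so any choice of singular vectors is covered,
    measurable or not. Their signs are arbitrary as well, hence only the squares of [<uhat_k, u_k>]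
    are controlled; the ambiguity cancels in [uhat_k vhat_k^T], and [vhat_k] is eliminated through
    [<vhat_k, Y^T u_k> = s_k <uhat_k, u_k>]. Linear combinations of noise entries are never shown to
    be normal: only their moment generating function is computed, and the moments that matter are
    read off from it. *)

(** * Independence: from pi-systems to sigma-algebras *)

(** A list version of [independent], with the intersection as a big operator, so that proofs can go
    by induction on a list and reorder it with [perm_big]. Smaller subfamilies are recovered by
    [A i = setT] wherever [F i] contains [setT]. *)
Definition indep_on d (T : measurableType d) (R : realType)
    (P : probability T R) (I : eqType) (s : seq I) (F : I -> set (set T)) :=
  forall A : I -> set T, (forall i, i \in s -> F i (A i)) ->
    P (\big[setI/setT]_(i <- s) A i) = (\prod_(i <- s) P (A i))%E.

Lemma independent_indep_on d (T : measurableType d) (R : realType)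
    (P : probability T R) (I : choiceType) (F : I -> set (set T)) (s : seq I) :
  independent P F -> uniq s -> indep_on P s F.
Proof.
move=> indF us A FA.
have ps : perm_eq [fset x in s]%fset s.
  by apply: uniq_perm; rewrite ?fset_uniq// => x; rewrite !inE.
have H := indF [fset x in s]%fset A.
rewrite (perm_big _ ps) /= in H.
rewrite -H; last by move=> i; rewrite !inE; exact: FA.
congr (P _); rewrite -bigcap_seq; apply: eq_bigcapl.
by split => x /=; rewrite !inE.
Qed.

(** The pi-lambda argument, one index at a time: in [s1] the events already range over the generated
    sigma-algebra, in [s2] they are still in the pi-system. For the index being moved, the
    probability of the intersection of [X] with [B] and the product [P X * P B] are finite measures
    in [X] that agree on [C i]. *)
Lemma indep_on_sigma d (T : measurableType d) (R : realType)
    (P : probability T R) (I : eqType) (s : seq I) (C : I -> set (set T)) :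
  uniq s ->
  (forall i, C i `<=` measurable) -> (forall i, setI_closed (C i)) ->
  (forall i, C i setT) ->
  indep_on P s C -> indep_on P s (fun i => <<s C i>>).
Proof.
move=> us Cm CI CT indC.
have sm i : <<s C i>> `<=` measurable.
  by apply: smallest_sub (Cm i); exact: sigma_algebra_measurable.
suff claim s1 : forall s2, perm_eq (s1 ++ s2) s -> forall A : I -> set T,
    (forall i, i \in s1 -> <<s C i>> (A i)) ->
    (forall i, i \in s2 -> C i (A i)) ->
    P (\big[setI/setT]_(i <- s1 ++ s2) A i) =
    (\prod_(i <- s1 ++ s2) P (A i))%E.
  move=> A FA; have := claim s [::]; rewrite cats0; exact.
elim: s1 => [s2 ps A _ CA|i s1 IH s2 ps A FA CA].
  rewrite /= !(perm_big _ ps) /=; apply: indC => i; rewrite -(perm_mem ps).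
  exact: CA.
have us' : uniq (i :: s1 ++ s2) by rewrite (perm_uniq ps).
have pi : perm_eq (s1 ++ i :: s2) (i :: s1 ++ s2).
  by rewrite -cat1s perm_catCA.
have ps' : perm_eq (s1 ++ i :: s2) s := perm_trans pi ps.
have is12 j : j \in s1 ++ s2 -> j != i.
  by apply: contraTneq => ->; case/andP: us'.
pose B := \big[setI/setT]_(j <- s1 ++ s2) A j.
pose b := (\prod_(j <- s1 ++ s2) P (A j))%E.
have HX X : C i X -> P (X `&` B) = (P X * b)%E.
  move=> CX; pose A' j := if j == i then X else A j.
  have A'E j : j \in s1 ++ s2 -> A' j = A j.
    by move=> js; rewrite /A' (negbTE (is12 _ js)).
  have := IH (i :: s2) ps' A'; rewrite !(perm_big _ pi) /= !big_cons.
  have -> : A' i = X by rewrite /A' eqxx.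
  have -> : \big[setI/setT]_(j <- s1 ++ s2) A' j = B.
    by apply: eq_big_seq => j /A'E.
  have -> : (\prod_(j <- s1 ++ s2) P (A' j))%E = b.
    by apply: eq_big_seq => j /A'E ->.
  apply.
  - by move=> j js; rewrite A'E ?mem_cat ?js//; apply: FA; rewrite inE js orbT.
  - move=> j; rewrite inE; have [->|ji] := eqVneq j i; first by rewrite /A' eqxx.
    by move=> /= js; rewrite A'E ?mem_cat ?js ?orbT//; apply: CA.
have PB : P B = b by have := HX _ (CT i); rewrite setTI probability_setT mul1e.
have mB : measurable B.
  rewrite /B big_seq; apply: bigsetI_measurable => j.
  rewrite mem_cat => /orP[] js; last by apply: Cm; exact: CA.
  by apply: (sm j); apply: FA; rewrite inE js orbT.
rewrite /= !big_cons -/B -/b.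
pose m1 := mrestr P mB.
pose m2 := mscale (NngNum (fine_ge0 (measure_ge0 P B))) P.
have m2E X : m2 X = (P X * P B)%E.
  by rewrite /m2/= /mscale/= fineK ?fin_num_measure// muleC.
have := @g_sigma_algebra_measure_unique _ R T (C i) (Cm i) (fun=> setT)
  (fun=> CT i) _ m1 m2 (CI i).
rewrite -PB -m2E; apply.
- by rewrite bigcup_const//; exists 0%N.
- by move=> X CX; apply: etrans (esym (m2E X)); rewrite PB -HX.
- by move=> _; rewrite /m1/= /mrestr setTI -ge0_fin_numE// fin_num_measure.
- by apply: FA; rewrite inE eqxx.
Qed.

(** * Expectations determined by level sets *)

(** Tonelli on the subgraph of [f]. The weight [V] will be a density or a product of other factors;
    keeping it apart means that [f] enters the right-hand side only through preimages. *)
Lemma layer_cake d (T : measurableType d) (R : realType)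
    (mu : {sigma_finite_measure set T -> \bar R}) (V f : T -> R) :
  measurable_fun setT V -> measurable_fun setT f ->
  (forall w, 0 <= V w) -> (forall w, 0 <= f w) ->
  let level (s : R) := (\int[mu]_w (V w * \1_(f @^-1` [set y | (0 <= s < y)%R]) w)%:E)%E in
  [/\ measurable_fun setT level, forall s, (0 <= level s)%E &
    (\int[mu]_w (V w * f w)%:E = \int[lebesgue_measure]_s level s)%E].
Proof.
move=> mV mf V0 f0 level.
pose leb := @lebesgue_measure R; pose GR := measurableTypeR R.
pose S : set (T * GR) := [set y | 0 <= y.2 < f y.1].
have mS : measurable S.
  rewrite [S](_ : _ = (fun y : T * GR => 0 <= y.2) @^-1` [set true] `&`
                      (fun y : T * GR => y.2 < f y.1) @^-1` [set true]); last first.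
    by apply/seteqP; split => p /andP.
  apply: measurableI.
  - have : measurable_fun setT (fun y : T * GR => 0 <= y.2).
      by apply: measurable_fun_ler.
    by move=> /(_ measurableT [set true]); rewrite setTI; exact.
  - have : measurable_fun setT (fun y : T * GR => y.2 < f y.1).
      by apply: measurable_fun_ltr => //; exact: measurableT_comp.
    by move=> /(_ measurableT [set true]); rewrite setTI; exact.
have mSw w : measurable (fun s : GR => S (w, s)).
  have := measurable_xsection w mS.
  by rewrite /xsection; under eq_fun do rewrite in_setE.
have length w : (\int[leb]_s (\1_S (w, s))%:E = (f w)%:E)%E.
  transitivity (\int[leb]_s (\1_(`[0, f w[%classic : set R) s)%:E)%E.
    by apply: eq_integral => s _; congr EFin.
  rewrite /leb integral_indic//= setIT lebesgue_measure_itv/= lte_fin.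
  by case: ltgtP (f0 w) => // [|<-] _; rewrite -?EFinB ?subr0.
have mh : measurable_fun setT (fun x : T * GR => (V x.1 * \1_S x)%:E).
  apply/measurable_EFinP; apply: measurable_funM.
    by apply: measurableT_comp => //; exact: measurable_fst.
  exact: measurable_indic.
have h0 (x : T * GR) : (0 <= (V x.1 * \1_S x)%:E)%E by rewrite lee_fin mulr_ge0.
split.
- exact: (@measurable_fun_fubini_tonelli_G _ _ _ _ _ mu (fun x => (V x.1 * \1_S x)%:E)).
- by move=> s; apply: integral_ge0 => w _; rewrite lee_fin mulr_ge0.
rewrite -[RHS](@fubini_tonelli _ _ _ _ _ mu leb (fun x => (V x.1 * \1_S x)%:E))//=.
apply: eq_integral => w _ /=.
under eq_integral do rewrite EFinM.
rewrite ge0_integralZl_EFin// ?length ?EFinM//.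
apply/measurable_EFinP.
rewrite (_ : (fun s => _) = \1_(fun s => S (w, s))); first exact: measurable_indic.
by apply/funext => s; rewrite !indicE.
Qed.

(** By the layer cake formula, a weighted integral is determined by the weighted masses of
    preimages. This one comparison yields the factorization of expectations, the integral against a
    normal density and the invariance under equality in law. *)
Lemma eq_integral_levels d1 (T1 : measurableType d1) d2 (T2 : measurableType d2)
    (R : realType) (mu1 : {sigma_finite_measure set T1 -> \bar R})
    (mu2 : {sigma_finite_measure set T2 -> \bar R})
    (V1 f1 : T1 -> R) (V2 f2 : T2 -> R) (c : \bar R) :
  measurable_fun setT V1 -> measurable_fun setT f1 ->
  measurable_fun setT V2 -> measurable_fun setT f2 ->
  (forall w, 0 <= V1 w) -> (forall w, 0 <= f1 w) ->
  (forall w, 0 <= V2 w) -> (forall w, 0 <= f2 w) -> (0 <= c)%E ->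
  (forall B, measurable B ->
    (\int[mu1]_w (V1 w * \1_(f1 @^-1` B) w)%:E =
     c * \int[mu2]_w (V2 w * \1_(f2 @^-1` B) w)%:E)%E) ->
  (\int[mu1]_w (V1 w * f1 w)%:E = c * \int[mu2]_w (V2 w * f2 w)%:E)%E.
Proof.
move=> mV1 mf1 mV2 mf2 V10 f10 V20 f20 c0 H.
have [_ _ ->] := layer_cake mu1 mV1 mf1 V10 f10.
have [ml l0 ->] := layer_cake mu2 mV2 mf2 V20 f20.
rewrite -ge0_integralZl//.
apply: eq_integral => s _; apply: H.
have [s0|_] := boolP (0 <= s); last first.
  by rewrite (_ : [set _ | _] = set0)//; apply/seteqP; split.
rewrite (_ : [set _ | _] = `]s, +oo[%classic)//.
by apply/seteqP; split => y; rewrite /= in_itv/= andbT.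
Qed.

Lemma integral_mul_indep d (T : measurableType d) (R : realType)
    (P : probability T R) (W f : T -> R) :
  measurable_fun setT W -> measurable_fun setT f ->
  (forall w, 0 <= W w) -> (forall w, 0 <= f w) ->
  (forall B, measurable B ->
    (\int[P]_w (W w * \1_(f @^-1` B) w)%:E =
     (\int[P]_w (W w)%:E) * P (f @^-1` B))%E) ->
  (\int[P]_w (W w * f w)%:E = (\int[P]_w (W w)%:E) * \int[P]_w (f w)%:E)%E.
Proof.
move=> mW mf W0 f0 H.
rewrite (@eq_integral_levels _ _ _ _ _ P P W f (cst 1) f (\int[P]_w (W w)%:E)) //.
- by under [X in (_ * X)%E]eq_integral do rewrite mul1r.
- by apply: integral_ge0 => w _; rewrite lee_fin.
move=> B mB; rewrite H//; congr (_ * _)%E.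
under eq_integral do rewrite mul1r.
by rewrite integral_indic// ?setIT// -[X in measurable X]setTI; exact: mf.
Qed.

(** Indices pass one at a time from [s2], where they carry an event, to [s1], where they carry a
    function. The mixed statement, applied to preimages under [f i], is the premise of
    [integral_mul_indep]. *)
Lemma integral_prod_indep d (T : measurableType d) (R : realType)
    (P : probability T R) (I : eqType) (s : seq I) (F : I -> set (set T))
    (f : I -> T -> R) :
  uniq s -> indep_on P s F ->
  (forall i, F i `<=` measurable) ->
  (forall i B, measurable B -> F i (f i @^-1` B)) ->
  (forall i w, 0 <= f i w) ->
  (\int[P]_w (\prod_(i <- s) f i w)%:E = \prod_(i <- s) \int[P]_w (f i w)%:E)%E.
Proof.
move=> us indF Fm fF f0.
have mf i : measurable_fun setT (f i).
  by move=> _ B mB; rewrite setTI; exact/Fm/fF.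
suff claim s1 : forall s2, perm_eq (s1 ++ s2) s -> forall A : I -> set T,
    (forall i, i \in s2 -> F i (A i)) ->
    (\int[P]_w (\prod_(i <- s1) f i w * \1_(\big[setI/setT]_(i <- s2) A i) w)%:E =
    (\prod_(i <- s1) \int[P]_w (f i w)%:E) * \prod_(i <- s2) P (A i))%E.
  have := claim s [::]; rewrite cats0 => /(_ (perm_refl _) (fun=> setT)).
  rewrite !big_nil mule1 => <- //; apply: eq_integral => w _.
  by rewrite indicT mulr1.
elim: s1 => [s2 ps A FA|i s1 IH s2 ps A FA].
  rewrite /= in ps.
  have -> : (\prod_(i <- s2) P (A i) = P (\big[setI/setT]_(i <- s2) A i))%E.
    rewrite !(perm_big _ ps); apply/esym/indF => i.
    by rewrite -(perm_mem ps); exact: FA.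
  rewrite big_nil mul1e.
  under eq_integral do rewrite big_nil mul1r.
  rewrite integral_indic// ?setIT//.
  by rewrite big_seq; apply: bigsetI_measurable => i si; apply: (Fm i); exact: FA.
have us' : uniq (i :: s1 ++ s2) by rewrite (perm_uniq ps).
have pi : perm_eq (s1 ++ i :: s2) (i :: s1 ++ s2).
  by rewrite -cat1s perm_catCA.
have ps' : perm_eq (s1 ++ i :: s2) s := perm_trans pi ps.
have is2 j : j \in s2 -> j != i.
  move=> js; apply: contraTneq us' => <- /=.
  by rewrite mem_cat js orbT.
pose B := \big[setI/setT]_(j <- s2) A j.
pose W w := \prod_(j <- s1) f j w * \1_B w.
have mB : measurable B.
  by rewrite /B big_seq; apply: bigsetI_measurable => j js; apply: (Fm j); exact: FA.
have mW : measurable_fun setT W.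
  apply: measurable_funM; last exact: measurable_indic.
  exact: measurable_prod.
have W0 w : 0 <= W w by rewrite mulr_ge0// prodr_ge0.
have HW C : measurable C ->
  (\int[P]_w (W w * \1_(f i @^-1` C) w)%:E =
   (\prod_(j <- s1) \int[P]_w (f j w)%:E) *
   (P (f i @^-1` C) * \prod_(j <- s2) P (A j)))%E.
  move=> mC; pose A' j := if j == i then f i @^-1` C else A j.
  have A'i : A' i = f i @^-1` C by rewrite /A' eqxx.
  have A'E j : j \in s2 -> A' j = A j by move=> js; rewrite /A' (negbTE (is2 _ js)).
  have := IH (i :: s2) ps' A'; rewrite !big_cons A'i.
  have -> : \big[setI/setT]_(j <- s2) A' j = B by apply: eq_big_seq => j /A'E.
  have -> : (\prod_(j <- s2) P (A' j) = \prod_(j <- s2) P (A j))%E.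
    by apply: eq_big_seq => j /A'E ->.
  move=> <-.
    by apply: eq_integral => w _; rewrite /W -mulrA indicI/= [in LHS](mulrC (\1_B w)).
  by move=> j; rewrite inE; have [->|_]/= := eqVneq j i; [rewrite A'i => _; exact: fF
    |move=> js; rewrite A'E//; exact: FA].
have HWT : (\int[P]_w (W w)%:E = (\prod_(j <- s1) \int[P]_w (f j w)%:E) *
    \prod_(j <- s2) P (A j))%E.
  have := HW setT measurableT; rewrite preimage_setT probability_setT mul1e => <-.
  by apply: eq_integral => w _; rewrite indicT mulr1.
transitivity (\int[P]_w (W w * f i w)%:E)%E.
  by apply: eq_integral => w _; rewrite big_cons /W -mulrA mulrC.
rewrite integral_mul_indep// => [|C mC].
  by rewrite HWT big_cons muleAC; congr (_ * _)%E; exact: muleC.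
by rewrite HW// HWT -muleA; congr (_ * _)%E; rewrite muleC.
Qed.

(** * Grouping independent entries into independent columns *)

(** A pi-system for the sigma-algebra of column [j]. The plain union of the [F (i, j)] need not be
    closed under intersection, which [indep_on_sigma] requires. *)
Definition rectangles (T : Type) (I : finType) (J : Type)
    (F : I * J -> set (set T)) (j : J) : set (set T) :=
  [set B | exists2 A : I -> set T, (forall i, F (i, j) (A i)) &
    B = \big[setI/setT]_(i : I) A i].

Lemma indep_on_rectangles d (T : measurableType d) (R : realType)
    (P : probability T R) (I J : finType) (F : I * J -> set (set T)) :
  (forall ij, F ij setT) ->
  indep_on P (index_enum (I * J)%type) F ->
  indep_on P (index_enum J) (rectangles F).
Proof.
move=> FT indF B HB.
have {}HB j : exists A : I -> set T, (forall i, F (i, j) (A i)) /\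
    B j = \big[setI/setT]_(i : I) A i.
  by have [|A FA ->] := HB j; [rewrite mem_index_enum | exists A].
have /choice[A HA] := HB.
have swap U (x : U) (op : Monoid.com_law x) (D : pred J) (f : J -> I -> U) :
    \big[op/x]_(ij : I * J) (if D ij.2 then f ij.2 ij.1 else x) =
    \big[op/x]_(j | D j) \big[op/x]_i f j i.
  rewrite -(pair_bigA _ (fun i j => if D j then f j i else x)) exchange_big /=.
  rewrite [RHS]big_mkcond; apply: eq_bigr => j _.
  by case: (D j) => //; rewrite big1_eq.
(* Two instances are used: all columns, and the single column [pred1 j], whose probability must
   itself be split into entries. Columns outside [D] receive [setT]. *)
have indA (D : pred J) :
    (P (\big[setI/setT]_(j | D j) \big[setI/setT]_i A j i) =
     \prod_(j | D j) \prod_i P (A j i))%E.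
  pose A' (ij : I * J) := if D ij.2 then A ij.2 ij.1 else setT.
  rewrite -2!swap -[LHS]/(P (\big[setI/setT]_ij A' ij)) indF.
    by apply: eq_bigr => -[i j] _; rewrite /A' /=; case: (D j); rewrite ?probability_setT.
  by move=> [i j] _; rewrite /A' /=; case: (D j) => //; exact: (HA j).1.
under eq_bigr do rewrite (HA _).2.
rewrite indA; apply: eq_bigr => j _.
by have := indA (pred1 j); rewrite !big_pred1_eq (HA j).2.
Qed.

Lemma rectangles_setI_closed (T : Type) (I : finType) (J : Type)
    (F : I * J -> set (set T)) (j : J) :
  (forall i, setI_closed (F (i, j))) -> setI_closed (rectangles F j).
Proof.
move=> FI _ _ [A FA ->] [B FB ->]; exists (fun i => A i `&` B i).
  by move=> i; exact: FI.
by rewrite big_split.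
Qed.

Lemma rectangles_setT (T : Type) (I : finType) (J : Type)
    (F : I * J -> set (set T)) (j : J) :
  (forall i, F (i, j) setT) -> rectangles F j setT.
Proof. by move=> FT; exists (fun=> setT); rewrite ?big1_eq. Qed.

Lemma sub_rectangles (T : Type) (I : finType) (J : Type)
    (F : I * J -> set (set T)) (i : I) (j : J) :
  (forall i, F (i, j) setT) -> F (i, j) `<=` rectangles F j.
Proof.
move=> FT A FA; exists (fun k => if k == i then A else setT).
  by move=> k; case: eqVneq => [->|_].
by rewrite -big_mkcond big_pred1_eq.
Qed.

Lemma rectangles_measurable d (T : measurableType d) (I : finType) (J : Type)
    (F : I * J -> set (set T)) (j : J) :
  (forall i, F (i, j) `<=` measurable) -> rectangles F j `<=` measurable.
Proof.
move=> Fm _ [A FA ->]; apply: bigsetI_measurable => i _.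
by apply: (Fm i); exact: FA.
Qed.

(** * Chernoff bounds for sums of sub-exponential variables *)

Lemma integrable_mgf d (T : measurableType d) (R : realType)
    (P : probability T R) (xi : T -> R) (a : R) :
  measurable_fun setT xi -> 0 < a ->
  (\int[P]_w (expR (a * `|xi w|))%:E < +oo)%E ->
  P.-integrable setT (fun w => (expR (a * `|xi w|))%:E) /\
  P.-integrable setT (fun w => (xi w)%:E).
Proof.
move=> mxi a0 HM.
have inte : P.-integrable setT (fun w => (expR (a * `|xi w|))%:E).
  apply/integrableP; split.
    apply/measurable_EFinP; apply: measurableT_comp => //.
    by apply: measurable_funM => //; exact: measurableT_comp.
  by under eq_integral do rewrite gee0_abs ?lee_fin ?expR_ge0//.
split => //.
apply: (le_integrable measurableT _ _ (integrableZl measurableT a^-1 inte)).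
  exact/measurable_EFinP.
move=> w _; rewrite -EFinM !abse_EFin lee_fin.
rewrite [leRHS]ger0_norm ?mulr_ge0 ?invr_ge0 ?expR_ge0 ?(ltW a0)//.
rewrite ler_pdivlMl//; apply: le_trans (expR_ge1Dx _); lra.
Qed.

(** The linear term is kept exact, so that it disappears in expectation for a centred variable. *)
Lemma expR_le_quadratic (R : realType) (x : R) :
  expR x <= 1 + x + x ^+ 2 * expR `|x|.
Proof.
have H1 : expR x * (1 - x) <= 1.
  rewrite -[leRHS](mulfV (lt0r_neq0 (expR_gt0 x))) -expRN ler_wpM2l ?expR_ge0//.
  exact: expR_ge1Dx.
have [x0|x0] := leP 0 x.
  have H2 : x * (expR x * (1 - x)) <= x * 1 by rewrite ler_wpM2l.
  by rewrite ger0_norm//; nra.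
have H2 : - x * (1 + x) <= - x * expR x.
  by rewrite ler_wpM2l ?expR_ge1Dx// oppr_ge0 ltW.
have H3 : x ^+ 2 * 1 <= x ^+ 2 * expR `|x|.
  by rewrite ler_wpM2l ?sqr_ge0// -expR0 ler_expR.
nra.
Qed.

Lemma sqr_le_expR (R : realType) (x : R) : x ^+ 2 <= 2 * expR `|x|.
Proof.
have := @expR_ge1Dxn R `|x| 1 (normr_ge0 x).
by rewrite real_normK ?num_real// !factS fact0 muln1 => H; lra.
Qed.

Lemma measurable_ge d (T : measurableType d) (R : realType) (f : T -> R) a :
  measurable_fun setT f -> measurable [set w | a <= f w].
Proof.
move=> mf; rewrite [X in measurable X](_ : _ = f @^-1` `[a, +oo[).
  by rewrite -[X in measurable X]setTI; apply: mf => //; exact: measurable_itv.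
by apply/seteqP; split => w; rewrite /= in_itv/= andbT.
Qed.

Lemma probability_le_integral d (T : measurableType d) (R : realType)
    (P : probability T R) (A : set T) (h : T -> R) :
  measurable A -> measurable_fun setT h -> (forall w, 0 <= h w) ->
  (forall w, A w -> 1 <= h w) -> (P A <= \int[P]_w (h w)%:E)%E.
Proof.
move=> mA mh h0 h1.
rewrite -[A in leLHS]setIT -(integral_indic P measurableT mA).
apply: ge0_le_integral => //.
- by apply/measurable_EFinP; exact: measurable_indic.
- exact/measurable_EFinP.
move=> w _; rewrite lee_fin indicE.
by have [/set_mem/h1//|] := boolP (w \in A).
Qed.

(** In the quadratic remainder, half of [a] pays for [xi ^ 2] ([sqr_le_expR] at [a / 2 * xi], whence
    [8 / a ^ 2]) and the other half pays for [expR (l * |xi|)], whence the condition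
    [2 * l <= a]. *)
Lemma mgf_le d (T : measurableType d) (R : realType)
    (P : probability T R) (xi : T -> R) (a M l : R) :
  measurable_fun setT xi -> 0 < a -> 0 <= l -> 2 * l <= a ->
  (\int[P]_w (expR (a * `|xi w|))%:E <= M%:E)%E ->
  (\int[P]_w (xi w)%:E = 0)%E ->
  (\int[P]_w (expR (l * xi w))%:E <= (expR (8 * M / a ^+ 2 * l ^+ 2))%:E)%E.
Proof.
move=> mxi a0 l0 la HM Hxi.
have mexp (g : T -> R) : measurable_fun setT g -> measurable_fun setT (fun w => (expR (g w))%:E).
  by move=> mg; apply/measurable_EFinP; exact: measurableT_comp.
have [inte intxi] := integrable_mgf mxi a0 (le_lt_trans HM (ltry _)).
set k := 8 * l ^+ 2 / a ^+ 2.
have k0 : 0 <= k by rewrite /k divr_ge0// ?mulr_ge0// ?exprn_ge0// ltW.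
have pw w : expR (l * xi w) <= 1 + l * xi w + k * expR (a * `|xi w|).
  apply: le_trans (expR_le_quadratic _) _; rewrite lerD2l.
  have -> : k * expR (a * `|xi w|) =
    (l ^+ 2 * (4 / a ^+ 2 * (2 * expR `|a / 2 * xi w|))) * expR (a / 2 * `|xi w|).
    rewrite normrM gtr0_norm ?divr_gt0// /k.
    have -> : a * `|xi w| = a / 2 * `|xi w| + a / 2 * `|xi w| by lra.
    by rewrite expRD; ring.
  apply: ler_pM; rewrite ?sqr_ge0 ?expR_ge0//; last first.
    rewrite ler_expR normrM ger0_norm// ler_wpM2r//; lra.
  rewrite exprMn ler_wpM2l ?sqr_ge0//.
  rewrite -ler_pdivrMl ?divr_gt0 ?exprn_gt0//.
  apply: le_trans (sqr_le_expR _).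
  by rewrite le_eqVlt; apply/orP; left; apply/eqP; field; rewrite gt_eqF.
apply: (@le_trans _ _ (\int[P]_w (1%:E + (l%:E * (xi w)%:E + k%:E * (expR (a * `|xi w|))%:E)))%E).
  apply: ge0_le_integral => //.
  - by apply: mexp; exact: measurable_funM.
  - apply/measurable_EFinP; apply: measurable_funD => //; apply: measurable_funD.
      exact: measurable_funM.
    apply: measurable_funM => //; apply: measurableT_comp => //.
    by apply: measurable_funM => //; exact: measurableT_comp.
  - by move=> w _; rewrite -!EFinM -!EFinD lee_fin addrA.
have i2 := integrableZl measurableT l intxi.
have i3 := integrableZl measurableT k inte.
have i1 : P.-integrable setT (fun=> 1%:E) by exact: finite_measure_integrable_cst.
rewrite integralD//; last exact: integrableD.
rewrite integralD// !integralZl// Hxi mule0 add0e integral_cst// mul1e.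
rewrite [X in (X + _)%E](_ : _ = 1%E); last exact: probability_setT.
apply: (@le_trans _ _ (1%:E + k%:E * M%:E)%E).
  by rewrite leeD2l// lee_wpmul2l.
rewrite -EFinM -EFinD lee_fin.
apply: le_trans (expR_ge1Dx _).
by rewrite lerD2l /k le_eqVlt; apply/orP; left; apply/eqP; field; rewrite gt_eqF.
Qed.

(* [8 M / a^2] is the constant of [mgf_le]; [l] below balances the two terms of
   the exponent [8 M / a^2 * l^2 - l * e]. *)
Definition chernoff_rate (R : realType) (a M e : R) : R :=
  Num.min (a / 2) (e / (16 * M / a ^+ 2)) * e / 2.

Lemma chernoff_rate_gt0 (R : realType) (a M e : R) :
  0 < a -> 0 < M -> 0 < e -> 0 < chernoff_rate a M e.
Proof.
move=> a0 M0 e0; rewrite /chernoff_rate !mulr_gt0 ?invr_gt0// lt_min.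
by rewrite !divr_gt0// !mulr_gt0 ?invr_gt0 ?exprn_gt0.
Qed.

Lemma sum_tail_le d (T : measurableType d) (R : realType)
    (P : probability T R) (I : eqType) (s : seq I) (F : I -> set (set T))
    (xi : I -> T -> R) (a M e : R) :
  0 < a -> 0 < M -> 0 < e -> uniq s -> indep_on P s F ->
  (forall i, F i `<=` measurable) ->
  (forall i B, measurable B -> F i (xi i @^-1` B)) ->
  (forall i, \int[P]_w (expR (a * `|xi i w|))%:E <= M%:E)%E ->
  (forall i, \int[P]_w (xi i w)%:E = 0)%E ->
  (P [set w | ((size s)%:R * e <= \sum_(i <- s) xi i w)%R]
    <= (expR (- (chernoff_rate a M e * (size s)%:R)))%:E)%E.
Proof.
move=> a0 M0 e0 us indF Fm Fxi HM Hxi.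
have mxi i : measurable_fun setT (xi i).
  by move=> _ B mB; rewrite setTI; exact/Fm/Fxi.
set n := (size s)%:R; set C := 8 * M / a ^+ 2.
set l := Num.min (a / 2) (e / (16 * M / a ^+ 2)).
have C0 : 0 < C by rewrite !mulr_gt0 ?invr_gt0 ?exprn_gt0.
have l0 : 0 < l.
  by rewrite lt_min !divr_gt0// !mulr_gt0 ?invr_gt0 ?exprn_gt0.
have la : 2 * l <= a.
  have : l <= a / 2 by rewrite ge_min lexx.
  by lra.
(* The cap [l <= e / (2 * C)] makes the quadratic term at most half of [l * e]. *)
have lC : C * l ^+ 2 - l * e <= - (chernoff_rate a M e).
  have : l <= e / (16 * M / a ^+ 2) by rewrite ge_min lexx orbT.
  rewrite (_ : 16 * M / a ^+ 2 = 2 * C); last by rewrite /C; ring.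
  have C2 : 0 < 2 * C by lra.
  rewrite ler_pdivlMr// => H.
  rewrite /chernoff_rate -/l.
  have : l * (l * (2 * C)) <= l * e by rewrite ler_wpM2l// ltW.
  by lra.
have mS : measurable_fun setT (fun w => \sum_(i <- s) xi i w).
  exact: measurable_sum.
pose h w := expR (- (l * (n * e))) * \prod_(i <- s) expR (l * xi i w).
have hE w : h w = expR (l * (\sum_(i <- s) xi i w - n * e)).
  by rewrite /h -expR_sum -expRD -mulr_sumr; congr expR; ring.
have mexp i : measurable_fun setT (fun w => expR (l * xi i w)).
  by apply: measurableT_comp => //; exact: measurable_funM.
apply: le_trans (@probability_le_integral _ _ _ _ _ h _ _ _ _) _.
- exact: measurable_ge.
- by apply: measurable_funM => //; exact: measurable_prod.
- by move=> w; rewrite hE expR_ge0.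
- move=> w /= nS; rewrite hE -expR0 ler_expR mulr_ge0 ?subr_ge0// ltW//.
rewrite /h; under eq_integral do rewrite EFinM.
rewrite ge0_integralZl_EFin ?expR_ge0//; first last.
- by apply/measurable_EFinP; exact: measurable_prod.
- by move=> w _; rewrite lee_fin prodr_ge0// => i _; exact: expR_ge0.
rewrite (integral_prod_indep us indF)//; last first.
  move=> i B mB; rewrite -[_ @^-1` _]/(xi i @^-1` ((fun x => expR (l * x)) @^-1` B)).
  apply: Fxi; rewrite -[X in measurable X]setTI.
  have : measurable_fun setT (fun x : R => expR (l * x)).
    by apply: measurableT_comp => //; exact: measurable_funM.
  exact.
have prodle : (\prod_(i <- s) \int[P]_w (expR (l * xi i w))%:E <=
    (expR (C * l ^+ 2 * n))%:E)%E.
  have {lC} : forall i, (0 <= \int[P]_w (expR (l * xi i w))%:E <= (expR (C * l ^+ 2))%:E)%E.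
    move=> i; apply/andP; split; last exact: mgf_le (ltW l0) la (HM i) (Hxi i).
    by apply: integral_ge0 => w _; rewrite lee_fin expR_ge0.
  rewrite /n; elim: (s) => [|i s' IH] H; first by rewrite big_nil mulr0 expR0.
  rewrite big_cons /= -natr1 mulrDr mulr1 addrC expRD EFinM.
  apply: lee_pmul; [by case/andP: (H i) | | by case/andP: (H i) | exact: IH].
  by apply: prode_ge0 => j _; case/andP: (H j).
apply: le_trans (lee_wpmul2l _ prodle) _; first by rewrite lee_fin expR_ge0.
rewrite -EFinM lee_fin -expRD ler_expR.
have n0 : 0 <= n by exact: ler0n.
nra.
Qed.

Lemma abs_sum_tail_le d (T : measurableType d) (R : realType)
    (P : probability T R) (I : eqType) (s : seq I) (F : I -> set (set T))
    (xi : I -> T -> R) (a M e : R) :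
  0 < a -> 0 < M -> 0 < e -> uniq s -> indep_on P s F ->
  (forall i, F i `<=` measurable) ->
  (forall i B, measurable B -> F i (xi i @^-1` B)) ->
  (forall i, \int[P]_w (expR (a * `|xi i w|))%:E <= M%:E)%E ->
  (forall i, \int[P]_w (xi i w)%:E = 0)%E ->
  (P [set w | ((size s)%:R * e <= `|\sum_(i <- s) xi i w|)%R]
    <= (2 * expR (- (chernoff_rate a M e * (size s)%:R)))%:E)%E.
Proof.
move=> a0 M0 e0 us indF Fm Fxi HM Hxi.
have mxi i : measurable_fun setT (xi i).
  by move=> _ B mB; rewrite setTI; exact/Fm/Fxi.
have mS (f : I -> T -> R) : (forall i, measurable_fun setT (f i)) ->
    measurable [set w | (size s)%:R * e <= \sum_(i <- s) f i w].
  by move=> mf; apply: measurable_ge; exact: measurable_sum.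
have H1 := sum_tail_le a0 M0 e0 us indF Fm Fxi HM Hxi.
have H2 : (P [set w | ((size s)%:R * e <= \sum_(i <- s) - xi i w)%R]
    <= (expR (- (chernoff_rate a M e * (size s)%:R)))%:E)%E.
  apply: (sum_tail_le a0 M0 e0 us indF Fm).
  - move=> i B mB; rewrite -[_ @^-1` _]/(xi i @^-1` (-%R @^-1` B)).
    apply: Fxi; rewrite -[X in measurable X]setTI.
    by apply: oppr_measurable.
  - by move=> i; under eq_integral do rewrite normrN.
  - move=> i; under eq_integral do rewrite EFinN.
    have [_ intxi] := integrable_mgf (mxi i) a0 (le_lt_trans (HM i) (ltry _)).
    by under eq_integral do rewrite -mulN1e; rewrite integralZl// Hxi mule0.
rewrite (mulr_natl (expR _) 2) mulr2n EFinD.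
apply: le_trans (leeD H1 H2); apply: le_trans (measureU2 _ _ _).
- apply: le_measure; rewrite ?inE.
  + by apply: measurable_ge; exact: measurableT_comp (measurable_sum _ mxi).
  + by apply: measurableU; apply: mS => // i; exact: measurableT_comp.
  + by move=> w /=; rewrite sumrN ler_normr => /orP[]; [left|right].
- by apply: mS.
- by apply: mS => i; exact: measurableT_comp.
Qed.

(** * Moments of normal variables *)

Lemma integral_normal_law d (T : measurableType d) (R : realType)
    (P : probability T R) (g : T -> R) (m s : R) (h : R -> R) :
  measurable_fun setT g ->
  (forall B, measurable B -> P (g @^-1` B) = normal_prob m s B) ->
  measurable_fun setT h -> (forall x, 0 <= h x) ->
  (\int[P]_w (h (g w))%:E =
   \int[lebesgue_measure]_x (normal_pdf m s x * h x)%:E)%E.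
Proof.
move=> mg Hg mh h0.
have mhg : measurable_fun setT (h \o g) by exact: measurableT_comp.
transitivity (\int[P]_w (1 * (h \o g) w)%:E)%E.
  by apply: eq_integral => w _; rewrite mul1r.
rewrite -[RHS]mul1e.
apply: (@eq_integral_levels _ _ _ _ _ P (@lebesgue_measure R) (cst 1)) => //.
- exact: measurable_normal_pdf.
- by move=> w; exact: h0.
- by move=> x; exact: normal_pdf_ge0.
move=> B mB; rewrite mul1e.
have mhB : measurable (h @^-1` B) by rewrite -[X in measurable X]setTI; exact: mh.
under eq_integral do rewrite mul1r.
rewrite integral_indic//; last by rewrite -[X in measurable X]setTI; exact: mhg.
rewrite setIT; apply: etrans (Hg _ mhB) _; rewrite /normal_prob integral_mkcond.
apply: eq_integral => x _; rewrite patchE indicE.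
by case: ifP => _; rewrite ?mulr1 ?mulr0.
Qed.

Lemma normal_mgf (R : realType) (s b : R) : s != 0 ->
  (\int[lebesgue_measure]_x (normal_pdf 0 s x * expR (b * x))%:E =
   (expR ((b * s) ^+ 2 / 2))%:E)%E.
Proof.
move=> s0.
(* Completing the square: the exponential tilt recentres the density at [b * s ^ 2]. *)
transitivity (\int[lebesgue_measure]_x
   ((expR ((b * s) ^+ 2 / 2))%:E * (normal_pdf (b * s ^+ 2) s x)%:E))%E.
  apply: eq_integral => x _; rewrite -EFinM; congr EFin.
  rewrite !normal_pdfE// mulrCA -!mulrA; congr (_ * _).
  rewrite /normal_fun -!expRD; congr expR.
  by field.
rewrite ge0_integralZl_EFin ?expR_ge0// ?integral_normal_pdf ?mule1//.
  by move=> x _; rewrite lee_fin normal_pdf_ge0.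
by apply/measurable_EFinP; exact: measurable_normal_pdf.
Qed.

Lemma expR_ge_taylor2 (R : realType) (x : R) : 0 <= x ->
  1 + x + x ^+ 2 / 2 <= expR x.
Proof.
move=> x0; have -> : 1 + x + x ^+ 2 / 2 = series (exp_coeff x) 3.
  rewrite /series/= !big_nat_recr//= big_nil /exp_coeff/= expr0 expr1.
  by rewrite !factS fact0 !muln1 add0r !divr1.
apply: nondecreasing_cvgn_le; last exact: is_cvg_series_exp_coeff.
by apply: nondecreasing_series => n _ _; exact: exp_coeff_ge0.
Qed.

Lemma expR_sub1_le (R : realType) (x : R) : expR x - 1 <= x * expR x.
Proof.
have : expR x * (1 - x) <= 1.
  rewrite -[leRHS](mulfV (lt0r_neq0 (expR_gt0 x))) -expRN ler_wpM2l ?expR_ge0//.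
  exact: expR_ge1Dx.
nra.
Qed.

(** With [h = y / 2] and [E = expR h], [h >= 0], the claim reads [(2 h)^2 <= (E - E^-1)^2], that is
    [h <= sinh h]. The second-order Taylor bound on [E] also bounds [E^-1], because [(1 + h + h^2/2)
    (1 - h + h^2/2) = 1 + h^4/4 >= 1]. *)
Lemma sqr_le_expR_sym (R : realType) (y : R) : y ^+ 2 + 2 <= expR y + expR (- y).
Proof.
wlog y0 : y / 0 <= y.
  have [y0|y0] := leP 0 y; first exact.
  by move=> /(_ (- y)); rewrite sqrrN opprK (addrC (expR (- y))); apply; lra.
have -> : expR (- y) = (expR (y / 2)) ^- 2.
  by rewrite expRN; congr (_^-1); rewrite -expRM_natr; congr expR; lra.
have -> : expR y = expR (y / 2) ^+ 2 by rewrite -expRM_natr; congr expR; lra.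
have := @expR_ge_taylor2 R (y / 2) ltac:(lra).
set h := y / 2; have -> : y = 2 * h by rewrite /h; lra.
set E := expR h => H; have E0 : 0 < E by exact: expR_gt0.
have h0 : 0 <= h by rewrite /h; lra.
set E' := E^-1.
have EE : E * E' = 1 by rewrite mulfV// gt_eqF.
have E'0 : 0 < E' by rewrite invr_gt0.
rewrite -exprVn -/E'.
have H1 : E' <= 1 - h + h ^+ 2 / 2.
  have : 0 <= (E - (1 + h + h ^+ 2 / 2)) * (1 - h + h ^+ 2 / 2).
    by rewrite mulr_ge0 ?subr_ge0//; nra.
  have : (1 + h + h ^+ 2 / 2) * (1 - h + h ^+ 2 / 2) = 1 + h ^+ 4 / 4 by field.
  have : 0 <= h ^+ 4 by rewrite exprn_ge0.
  move=> h4 hE; rewrite mulrBl hE => K.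
  have {}K : 1 <= E * (1 - h + h ^+ 2 / 2) by lra.
  by rewrite -(ler_pM2l E0) EE.
have H2 : 0 <= 2 * h <= E - E' by apply/andP; split; lra.
have : (2 * h) ^+ 2 <= (E - E') ^+ 2.
  by case/andP: H2 => *; rewrite ler_sqr ?nnegrE//; lra.
by rewrite sqrrB EE; lra.
Qed.

(* [2 cosh y - 2 = (2 sinh (y / 2))^2] *)
Lemma expR_sym_le (R : realType) (y : R) :
  expR y + expR (- y) <= 2 + y ^+ 2 * expR `|y|.
Proof.
wlog y0 : y / 0 <= y.
  have [y0|y0] := leP 0 y; first exact.
  by move=> /(_ (- y)); rewrite sqrrN opprK normrN (addrC (expR (- y))); apply; lra.
rewrite ger0_norm//.
have -> : expR (- y) = (expR (y / 2)) ^- 2.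
  by rewrite expRN; congr (_^-1); rewrite -expRM_natr; congr expR; lra.
have -> : expR y = expR (y / 2) ^+ 2 by rewrite -expRM_natr; congr expR; lra.
have := expR_ge1Dx (- y).
have -> : expR (- y) = (expR (y / 2)) ^- 2.
  by rewrite expRN; congr (_^-1); rewrite -expRM_natr; congr expR; lra.
set E := expR _; have E0 : 0 < E by exact: expR_gt0.
have E1 : 1 <= E by rewrite -[leLHS]expR0 ler_expR; lra.
set E' := E^-1.
have EE : E * E' = 1 by rewrite mulfV// gt_eqF.
have E'0 : 0 < E' by rewrite invr_gt0.
rewrite -exprVn -/E' => H.
have H1 : E - E' <= y * E.
  have : E * (1 - y) <= E * E' ^+ 2 by rewrite ler_wpM2l// ltW//; lra.
  by rewrite expr2 mulrA EE; lra.
have E'1 : E' <= 1 by rewrite invf_le1.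
have : (E - E') ^+ 2 <= (y * E) ^+ 2 by rewrite ler_sqr ?nnegrE//; nra.
by rewrite sqrrB EE exprMn; lra.
Qed.

Section standard_mgf.
Context d (T : measurableType d) (R : realType) (P : probability T R).
Variable g : T -> R.
Hypothesis mg : measurable_fun setT g.
Hypothesis mgf : forall b : R,
  (\int[P]_w (expR (b * g w))%:E = (expR (b ^+ 2 / 2))%:E)%E.

Let mexp (b : R) : measurable_fun setT (fun w => expR (b * g w)).
Proof. by apply: measurableT_comp => //; exact: measurable_funM. Qed.

Let mexpE (b : R) : measurable_fun setT (fun w => (expR (b * g w))%:E).
Proof. exact/measurable_EFinP. Qed.

Let msym (b : R) : measurable_fun setT (fun w => expR (b * g w) + expR (- (b * g w))).
Proof.
by apply: measurable_funD => //; under eq_fun do rewrite -mulNr; exact: mexp.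
Qed.

Let msqr (k : R) : measurable_fun setT (fun w => k * g w ^+ 2).
Proof. by apply: measurable_funM => //; exact: measurable_funX. Qed.

Let integral_sym (b : R) :
  (\int[P]_w (expR (b * g w) + expR (- (b * g w)))%:E = (2 * expR (b ^+ 2 / 2))%:E)%E.
Proof.
under eq_integral do rewrite EFinD -mulNr.
rewrite ge0_integralD//.
by rewrite !mgf sqrrN -EFinD; congr EFin; ring.
Qed.

Let integral_1D (k : R) (h : T -> R) : 0 <= k ->
  measurable_fun setT h -> (forall w, 0 <= h w) ->
  (\int[P]_w (k + h w)%:E = k%:E + \int[P]_w (h w)%:E)%E.
Proof.
move=> k0 mh h0; under eq_integral do rewrite EFinD.
rewrite ge0_integralD//; last 2 first.
- by move=> w _; rewrite lee_fin.
- exact/measurable_EFinP.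
by rewrite integral_cst// [X in (_ * X)%E](_ : _ = 1%E) ?mule1//; exact: probability_setT.
Qed.

(** Integrating [y^2 + 2 <= 2 cosh y] at [y = b * g] and dividing by [b ^ 2] bounds the second
    moment by [expR (b^2 / 2)], which is at most [1 + b^2] for [b <= 1]. *)
Lemma standard_mgf_sqr_le (b : R) : 0 < b -> b <= 1 ->
  (\int[P]_w (g w ^+ 2)%:E <= (1 + b ^+ 2)%:E)%E.
Proof.
move=> b0 b1.
have H : ((b ^+ 2)%:E * \int[P]_w (g w ^+ 2)%:E + 2%:E <= (2 * expR (b ^+ 2 / 2))%:E)%E.
  rewrite -integral_sym -ge0_integralZl_EFin ?sqr_ge0//; last 2 first.
  - by move=> w _; rewrite lee_fin sqr_ge0.
  - by apply/measurable_EFinP; exact: measurable_funX.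
  under eq_integral do rewrite -EFinM.
  rewrite addeC -integral_1D//; last by move=> w; rewrite mulr_ge0 ?sqr_ge0.
  apply: ge0_le_integral => //.
  - by move=> w _; rewrite lee_fin addr_ge0// mulr_ge0 ?sqr_ge0.
  - by apply/measurable_EFinP; exact: measurable_funD.
  - exact/measurable_EFinP.
  - by move=> w _; rewrite lee_fin addrC -exprMn sqr_le_expR_sym.
have g0 : (0 <= \int[P]_w (g w ^+ 2)%:E)%E.
  by apply: integral_ge0 => w _; rewrite lee_fin sqr_ge0.
have := expR_sub1_le (b ^+ 2 / 2).
move: H g0; set E := expR _; case: (\int[P]_w _)%E => [m||]//.
  rewrite -EFinM -EFinD !lee_fin => H m0 H2.
  have E2 : E * (1 - b ^+ 2 / 2) <= 1 by lra.
  have b2 : 0 < b ^+ 2 by rewrite exprn_gt0.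
  have b21 : b ^+ 2 <= 1 by rewrite expr_le1// ltW.
  have {}H : m * b ^+ 2 <= E * b ^+ 2 by nra.
  have {H} : m <= E by rewrite -(ler_pM2r b2).
  nra.
by rewrite gt0_muley ?lte_fin ?exprn_gt0.
Qed.

(** Start from [2 cosh y <= 2 + y^2 expR |y|] at [y = b * g]. The excess over [b^2 g^2] is at most
    [b^3 |g|^3 expR |g|], and [|g|^3 <= 6 expR |g|] leaves [6 b^3 expR (2 |g|)]. The moment
    generating function at [2] and [-2] bounds the expectation of [expR (2 |g|)] by [2 expR 2],
    hence the constant 12. *)
Lemma standard_mgf_sqr_ge (b : R) : 0 < b -> b <= 1 ->
  (1%:E <= \int[P]_w (g w ^+ 2)%:E + (12 * expR 2 * b)%:E)%E.
Proof.
move=> b0 b1.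
have pw w : expR (b * g w) + expR (- (b * g w)) <=
    2 + (b ^+ 2 * g w ^+ 2 + 6 * b ^+ 3 * (expR (2 * g w) + expR (- (2 * g w)))).
  apply: le_trans (expR_sym_le _) _; rewrite lerD2l exprMn.
  have [x xE] : {x : R | x = `|g w|} by exists `|g w|.
  have x0 : 0 <= x by rewrite xE.
  have -> : g w ^+ 2 = x ^+ 2 by rewrite xE real_normK// num_real.
  have -> : `|b * g w| = b * x by rewrite normrM gtr0_norm// xE.
  have H1 : expR (b * x) <= 1 + b * x * expR x.
    rewrite addrC -lerBlDr (le_trans (expR_sub1_le _))//.
    by rewrite ler_wpM2l ?mulr_ge0 ?(ltW b0)// ler_expR ler_piMl.
  have H2 : x ^+ 3 <= 6 * expR x.
    by have := @expR_ge1Dxn R x 2 x0; rewrite !factS fact0 !muln1 => ?; lra.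
  have H3 : expR x ^+ 2 <= expR (2 * g w) + expR (- (2 * g w)).
    rewrite -expRM_natl xE; have [_|_] := ger0P (g w).
      by rewrite lerDl expR_ge0.
    by rewrite mulrN lerDr expR_ge0.
  apply: (@le_trans _ _ (b ^+ 2 * (x ^+ 2 * (1 + b * x * expR x)))).
    by rewrite -[leLHS]mulrA; do 2 (apply: ler_wpM2l; first exact: sqr_ge0).
  rewrite (_ : _ * (_ * _) = b ^+ 2 * x ^+ 2 + b ^+ 3 * (x ^+ 3 * expR x)); last by ring.
  rewrite lerD2l (mulrC 6) -[leRHS]mulrA; apply: ler_wpM2l.
    by rewrite exprn_ge0// ltW.
  apply: le_trans (_ : 6 * (expR x ^+ 2) <= _); last exact: ler_wpM2l.
  by rewrite expr2 mulrA ler_wpM2r ?expR_ge0.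
have H : ((2 * expR (b ^+ 2 / 2))%:E <=
    2%:E + ((b ^+ 2)%:E * \int[P]_w (g w ^+ 2)%:E + (12 * b ^+ 3 * expR 2)%:E))%E.
  rewrite -integral_sym.
  have -> : ((12 * b ^+ 3 * expR 2)%:E = (6 * b ^+ 3)%:E *
      \int[P]_w (expR (2 * g w) + expR (- (2 * g w)))%:E)%E.
    by rewrite integral_sym -EFinM; congr EFin; rewrite (_ : 2 ^+ 2 / 2 = 2); [ring | field].
  rewrite -!ge0_integralZl_EFin ?sqr_ge0 ?mulr_ge0 ?exprn_ge0 ?(ltW b0)//;
    [|exact/measurable_EFinP|by move=> w _; rewrite lee_fin sqr_ge0
    |by apply/measurable_EFinP; exact: measurable_funX].
  rewrite -ge0_integralD//; first last.
  - by apply/measurable_EFinP; exact: measurable_funM.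
  - by move=> w _; rewrite -EFinM lee_fin !mulr_ge0 ?addr_ge0 ?expR_ge0 ?exprn_ge0 ?(ltW b0).
  - exact/measurable_EFinP.
  - by move=> w _; rewrite -EFinM lee_fin mulr_ge0 ?sqr_ge0.
  under [in leRHS]eq_integral do rewrite -!EFinM -EFinD.
  rewrite -integral_1D//; last 2 first.
  - by apply: measurable_funD => //; exact: measurable_funM.
  - move=> w; apply: addr_ge0; apply: mulr_ge0; rewrite ?sqr_ge0 ?addr_ge0 ?expR_ge0//.
    by rewrite mulr_ge0// exprn_ge0// ltW.
  apply: ge0_le_integral => //.
  - exact/measurable_EFinP.
  - apply/measurable_EFinP; apply: measurable_funD => //.
    by apply: measurable_funD => //; exact: measurable_funM.
  - by move=> w _; rewrite lee_fin.
have g0 : (0 <= \int[P]_w (g w ^+ 2)%:E)%E.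
  by apply: integral_ge0 => w _; rewrite lee_fin sqr_ge0.
have := expR_ge1Dx (b ^+ 2 / 2).
move: H g0; case: (\int[P]_w _)%E => [m||]//.
  rewrite -!EFinM -!EFinD !lee_fin => H m0 H2.
  have b2 : 0 < b ^+ 2 by rewrite exprn_gt0.
  rewrite -(ler_pM2r b2); set e2 := expR 2 in H *.
  have -> : (m + 12 * e2 * b) * b ^+ 2 = m * b ^+ 2 + 12 * b ^+ 3 * e2 by ring.
  lra.
by move=> *; rewrite leey.
Qed.

(** The second derivative of the moment generating function at 0, obtained by squeezing symmetric
    second differences as [b -> 0] rather than by differentiating under the integral. *)
Lemma standard_mgf_sqr : (\int[P]_w (g w ^+ 2)%:E = 1)%E.
Proof.
have g0 : (0 <= \int[P]_w (g w ^+ 2)%:E)%E.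
  by apply: integral_ge0 => w _; rewrite lee_fin sqr_ge0.
have := standard_mgf_sqr_ge; have := standard_mgf_sqr_le.
move: g0; case: (\int[P]_w _)%E => [m||]//; last first.
  by move=> _ /(_ 1 ltr01 (lexx _)).
move=> m0 Hle Hge; congr EFin.
pose K : R := 12 * expR 2 + 1.
have K1 : 1 <= K by rewrite /K lerDr mulr_ge0// expR_ge0.
have H b : 0 < b -> b <= 1 -> `|m - 1| <= K * b.
  move=> b0 b1; have := Hle _ b0 b1; have := Hge _ b0 b1.
  rewrite -EFinD !lee_fin => h1 h2; rewrite ler_norml /K.
  have : b ^+ 2 <= b by rewrite expr2 ler_piMl// ltW.
  have : 0 <= expR 2 * b by rewrite mulr_ge0 ?expR_ge0// ltW.
  move=> h3 h4; apply/andP; split; nra.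
apply/eqP; rewrite -subr_eq0 -normr_le0 leNgt; apply/negP => m1.
move: H m1; have [D <-] : {D : R | D = `|m - 1|} by exists `|m - 1|.
clear Hle Hge m0 => H m1.
(* The choice [b = D / (2 K)] yields [D <= D / 2]. If it falls outside the admissible range,
   [b = 1 / (2 K)] yields [D <= 1 / 2], although [D >= 2 K]. *)
have [DK|DK] := leP 1 (D / (2 * K)).
  have := H (2 * K)^-1.
  have K2 : 0 < 2 * K by lra.
  rewrite invr_gt0 K2 invf_le1// => /(_ isT ltac:(lra)).
  rewrite ler_pdivlMr// in DK *.
  rewrite invfM mulrCA mulfV ?gt_eqF//; last by lra.
  by move=> ?; lra.
have := H (D / (2 * K)).
have K2 : 0 < 2 * K by lra.
rewrite divr_gt0// => /(_ isT (ltW DK)).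
rewrite (_ : K * _ = D / 2); last by field; rewrite gt_eqF//; lra.
lra.
Qed.

(* [expR (y^2 / 4)] is the moment generating function of a standard normal
   variable at [y / sqrt 2]. *)
Lemma standard_mgf_expR_sqr :
  (\int[P]_w (expR (4^-1 * g w ^+ 2))%:E <=
   (normal_peak 1 / normal_peak (Num.sqrt 2))%:E)%E.
Proof.
have r2 : Num.sqrt 2 ^+ 2 = 2 :> R by rewrite sqr_sqrtr.
have r20 : (Num.sqrt 2 : R) != 0 by rewrite gt_eqF// sqrtr_gt0.
pose GR := measurableTypeR R.
pose h (x : T * GR) : \bar R := (normal_pdf 0 1 x.2 * expR (x.2 / Num.sqrt 2 * g x.1))%:E.
have mh : measurable_fun setT h.
  apply/measurable_EFinP; apply: measurable_funM.
    by apply: measurableT_comp => //; exact: measurable_normal_pdf.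
  apply: measurableT_comp => //; apply: measurable_funM; last exact: measurableT_comp.
  exact: measurable_funM.
have h0 x : (0 <= h x)%E by rewrite lee_fin mulr_ge0 ?normal_pdf_ge0 ?expR_ge0.
have -> : (\int[P]_w (expR (4^-1 * g w ^+ 2))%:E =
           \int[P]_w \int[lebesgue_measure]_a h (w, a))%E.
  apply: eq_integral => w _; rewrite /h /=.
  transitivity (\int[lebesgue_measure]_x (normal_pdf 0 1 x * expR (g w / Num.sqrt 2 * x))%:E)%E.
    rewrite normal_mgf ?oner_eq0//; congr (expR _)%:E.
    by rewrite mulr1 expr_div_n r2; field.
  by apply: eq_integral => x _; congr (_ * expR _)%:E; field.
rewrite (@fubini_tonelli _ _ _ _ _ P (@lebesgue_measure R) h)//=.
(* The inner expectation is [expR (a^2 / 4)], which turns the standard density into a multiple of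
   the density of variance 2. *)
have -> : (\int[lebesgue_measure]_a \int[P]_w h (w, a) =
   \int[lebesgue_measure]_a ((normal_peak 1 / normal_peak (Num.sqrt 2))%:E *
      (normal_pdf 0 (Num.sqrt 2) a)%:E))%E.
  apply: eq_integral => a _; rewrite /h /=.
  under eq_integral do rewrite EFinM.
  rewrite ge0_integralZl_EFin ?normal_pdf_ge0//.
  rewrite mgf -!EFinM; congr EFin.
  rewrite !normal_pdfE ?oner_eq0// mulrA divfK; last first.
    by rewrite gt_eqF// normal_peak_gt0.
  rewrite -mulrA; congr (_ * _); rewrite /normal_fun -expRD; congr expR.
  by rewrite r2 expr_div_n r2; field.
rewrite ge0_integralZl_EFin ?integral_normal_pdf ?mule1//.
- by move=> x _; rewrite lee_fin normal_pdf_ge0.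
- by apply/measurable_EFinP; exact: measurable_normal_pdf.
- by rewrite divr_ge0 ?normal_peak_ge0.
Qed.

End standard_mgf.

(* The generator of [sigma_rv X], so that [sigma_rv X] is the sigma-algebra of
   [g_sigma_algebraType (sigma_gen X)] *)
Definition sigma_gen d (T : measurableType d) (R : realType) (I : Type)
    (X : I -> T -> R) : set (set T) :=
  \bigcup_i preimage_set_system setT (X i) measurable.

Lemma sigma_rv_measurable d (T : measurableType d) (R : realType) (I : Type)
    (X : I -> T -> R) :
  (forall i, measurable_fun setT (X i)) -> sigma_rv X `<=` measurable.
Proof.
move=> mX; apply: smallest_sub; first exact: sigma_algebra_measurable.
by move=> _ [i _ [B mB <-]]; exact: mX.
Qed.

Lemma measurable_sigma_gen d (T : measurableType d) (R : realType) (I : Type)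
    (X : I -> T -> R) (i : I) :
  measurable_fun setT (X i : g_sigma_algebraType (sigma_gen X) -> R).
Proof.
by move=> _ B mB; apply: sub_sigma_algebra; exists i => //; exists B.
Qed.

Lemma sigma_rv_preimage d (T : measurableType d) (R : realType) (I : Type)
    (X : I -> T -> R) (f : T -> R) (B : set R) :
  measurable_fun setT (f : g_sigma_algebraType (sigma_gen X) -> R) ->
  measurable B -> sigma_rv X (f @^-1` B).
Proof. by move=> mf mB; have := mf measurableT B mB; rewrite setTI. Qed.

(** * Tail bounds for a Gaussian matrix *)

Section gaussian_matrix.
Context d (T : measurableType d) (R : realType) (P : probability T R).
Variables (p n : nat) (G : 'I_p -> 'I_n -> {RV P >-> R}).
Hypothesis n0 : (0 < n)%N.
Hypothesis G_normal : forall i j B, measurable B ->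
  distribution P (G i j) B = normal_prob 0 (Num.sqrt n%:R^-1) B.
Hypothesis G_independent : independent P (fun ij : 'I_p * 'I_n =>
  sigma_rv (fun _ : unit => G ij.1 ij.2 : T -> R)).

Let F (ij : 'I_p * 'I_n) := sigma_rv (fun _ : unit => G ij.1 ij.2 : T -> R).

Let nR0 : 0 < n%:R :> R. Proof. by rewrite ltr0n. Qed.

Lemma gaussian_matrix_mgf (A : 'I_p -> 'I_n -> R) :
  (\int[P]_w (expR (\sum_i \sum_j A i j * G i j w))%:E =
   (expR ((\sum_i \sum_j A i j ^+ 2) / (2 * n%:R)))%:E)%E.
Proof.
have indG := independent_indep_on G_independent (index_enum_uniq _).
transitivity (\int[P]_w (\prod_(ij : 'I_p * 'I_n) expR (A ij.1 ij.2 * G ij.1 ij.2 w))%:E)%E.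
  apply: eq_integral => w _; congr EFin.
  by rewrite -expR_sum (pair_bigA _ (fun i j => A i j * G i j w)).
rewrite (integral_prod_indep (index_enum_uniq _) indG); last 3 first.
- by move=> ij; apply: sigma_rv_measurable => _; exact: measurable_funPT.
- move=> ij B mB; apply: sigma_rv_preimage => //.
  apply: measurableT_comp => //; apply: measurable_funM => //.
  exact: (@measurable_sigma_gen _ _ _ _ (fun _ : unit => G ij.1 ij.2 : T -> R) tt).
- by move=> ij w; exact: expR_ge0.
rewrite pair_bigA /= mulr_suml expR_sum -prodEFin; apply: eq_bigr => ij _.
rewrite (@integral_normal_law _ _ _ _ _ 0 (Num.sqrt n%:R^-1)
  (fun x => expR (A ij.1 ij.2 * x))).
- rewrite normal_mgf; last by rewrite gt_eqF// sqrtr_gt0 invr_gt0.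
  rewrite exprMn sqr_sqrtr ?invr_ge0 ?ltW//; congr (expR _)%:E.
  by field; rewrite gt_eqF.
- exact: measurable_funPT.
- by move=> B mB; exact: G_normal.
- by apply: measurableT_comp => //; exact: measurable_funM.
- by move=> x; exact: expR_ge0.
Qed.

Let g (x : 'I_p -> R) (j : 'I_n) (w : T) : R := Num.sqrt n%:R * \sum_i x i * G i j w.

Let g_mgf (x : 'I_p -> R) (j : 'I_n) (b : R) : \sum_i x i ^+ 2 = 1 ->
  (\int[P]_w (expR (b * g x j w))%:E = (expR (b ^+ 2 / 2))%:E)%E.
Proof.
move=> x1.
pose A i j' := if j' == j then b * Num.sqrt n%:R * x i else 0.
transitivity (\int[P]_w (expR (\sum_i \sum_k A i k * G i k w))%:E)%E.
  apply: eq_integral => w _; congr (expR _)%:E.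
  rewrite /g mulrA mulr_sumr; apply: eq_bigr => i _.
  rewrite (bigD1 j)//= big1 ?addr0 /A ?eqxx ?mulrA// => k kj.
  by rewrite (negbTE kj) mul0r.
rewrite gaussian_matrix_mgf; congr (expR _)%:E.
under eq_bigr => i _.
  rewrite (bigD1 j)//= big1 ?addr0 /A ?eqxx; last first.
    by move=> k kj; rewrite (negbTE kj) expr0n.
  rewrite exprMn; over.
rewrite -mulr_sumr x1 mulr1 exprMn sqr_sqrtr ?ltW//.
by field; rewrite gt_eqF.
Qed.

Let C := rectangles F.

Let mg (x : 'I_p -> R) (j : 'I_n) :
  measurable_fun setT (g x j : g_sigma_algebraType (C j) -> R).
Proof.
apply: measurable_funM => //; apply: measurable_sum => i.
apply: measurable_funM => // _ B mB; rewrite setTI; apply: sub_sigma_algebra.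
apply: (sub_rectangles (i := i)).
  by move=> k; rewrite -[setT](preimage_setT (G k j)); apply: sigma_rv_preimage;
    [exact: (@measurable_sigma_gen _ _ _ _ (fun _ : unit => G k j : T -> R) tt)|].
apply: sigma_rv_preimage => //.
exact: (@measurable_sigma_gen _ _ _ _ (fun _ : unit => G i j : T -> R) tt).
Qed.

(** The rate for [g^2 - 1] with [g] standard: since [|g^2 - 1| / 4 <= 1/4 + g^2 / 4],
    [standard_mgf_expR_sqr] supplies the exponential moment at [1/4], and the factor [expR 4^-1]
    pays for the centring. *)
Definition gaussian_rate (e : R) : R :=
  chernoff_rate 4^-1 (expR 4^-1 * (normal_peak 1 / normal_peak (Num.sqrt 2))) e.

Lemma gaussian_rate_gt0 (e : R) : 0 < e -> 0 < gaussian_rate e.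
Proof.
move=> e0; apply: chernoff_rate_gt0 => //.
by rewrite mulr_gt0 ?expR_gt0// divr_gt0 ?normal_peak_gt0 ?gt_eqF ?sqrtr_gt0.
Qed.

(** For a unit vector [x], the squared norm of [G^T x] is an average over the [n] columns of
    independent squares of mean 1. *)
Lemma gaussian_matrix_norm_tail (x : 'I_p -> R) (e : R) :
  \sum_i x i ^+ 2 = 1 -> 0 < e ->
  (P [set w | (e <= `|\sum_j (\sum_i x i * G i j w) ^+ 2 - 1|)%R] <=
   (2 * expR (- (gaussian_rate e * n%:R)))%:E)%E.
Proof.
move=> x1 e0.
have CI j : setI_closed (C j).
  by apply: rectangles_setI_closed => i; exact: (@measurableI _ (g_sigma_algebraType _)).
have FT ij : F ij setT by exact: (@measurableT _ (g_sigma_algebraType _)).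
have CT j : C j setT by exact: rectangles_setT.
have Fm ij : F ij `<=` measurable.
  by apply: sigma_rv_measurable => _; exact: measurable_funPT.
have Cm j : C j `<=` measurable by exact: rectangles_measurable.
have indC : indep_on P (index_enum 'I_n) (fun j => <<s C j>>).
  apply: indep_on_sigma => //; first exact: index_enum_uniq.
  apply: indep_on_rectangles => //.
  exact: independent_indep_on (index_enum_uniq _).
pose xi j w : R := g x j w ^+ 2 - 1.
have mgT j : measurable_fun setT (g x j).
  apply: measurable_funM => //; apply: measurable_sum => i.
  exact: measurable_funM.
have := @abs_sum_tail_le _ _ _ P _ (index_enum 'I_n) (fun j => <<s C j>>) xi
  4^-1 (expR 4^-1 * (normal_peak 1 / normal_peak (Num.sqrt 2))) e.
rewrite (_ : size (index_enum 'I_n) = n); last first.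
  by rewrite /index_enum -enumT size_enum_ord.
rewrite -/(gaussian_rate e) => H.
have sumxi w : \sum_(j <- index_enum 'I_n) xi j w =
    n%:R * (\sum_j (\sum_i x i * G i j w) ^+ 2 - 1).
  rewrite /xi sumrB sumr_const card_ord mulrBr mulr1; congr (_ - _).
  by rewrite mulr_sumr; apply: eq_bigr => j _; rewrite exprMn sqr_sqrtr// ltW.
have -> : [set w | e <= `|\sum_j (\sum_i x i * G i j w) ^+ 2 - 1|] =
    [set w | n%:R * e <= `|\sum_(j <- index_enum 'I_n) xi j w|].
  apply/funext => w; apply/propext.
  by rewrite /= sumxi normrM gtr0_norm// ler_pM2l.
apply: H => //.
- by rewrite mulr_gt0 ?expR_gt0// divr_gt0 ?normal_peak_gt0 ?gt_eqF ?sqrtr_gt0.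
- exact: index_enum_uniq.
- move=> j; apply: smallest_sub => //; exact: sigma_algebra_measurable.
- move=> j B mB; rewrite -[_ @^-1` _]setTI.
  have : measurable_fun setT (xi j : g_sigma_algebraType (C j) -> R).
    by apply: measurable_funB => //; apply: measurable_funX; exact: mg.
  by apply.
- move=> j; rewrite EFinM.
  apply: le_trans (lee_wpmul2l _ (standard_mgf_expR_sqr (mgT j) (fun b => g_mgf j b x1))); last first.
    by rewrite lee_fin expR_ge0.
  rewrite -ge0_integralZl_EFin ?expR_ge0//; last first.
    apply/measurable_EFinP; apply: measurableT_comp => //.
    by apply: measurable_funM => //; exact: measurable_funX.
  under [leRHS]eq_integral do rewrite -EFinM -expRD.
  apply: ge0_le_integral => //.
  - apply/measurable_EFinP; apply: measurableT_comp => //; apply: measurable_funM => //.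
    apply: measurableT_comp => //; apply: measurable_funB => //; exact: measurable_funX.
  - apply/measurable_EFinP; apply: measurableT_comp => //; apply: measurable_funD => //.
    by apply: measurable_funM => //; exact: measurable_funX.
  - move=> w _; rewrite lee_fin ler_expR.
    rewrite [leRHS](_ : _ = 4^-1 * (1 + g x j w ^+ 2)); last by ring.
    rewrite ler_wpM2l// (le_trans (ler_normB _ _))// normr1 addrC.
    by rewrite ger0_norm ?sqr_ge0.
- move=> j; rewrite /xi.
  have gsq : (\int[P]_w (g x j w ^+ 2)%:E = 1)%E.
    exact: standard_mgf_sqr (mgT j) (fun b => g_mgf j b x1).
  have intg : P.-integrable setT (fun w => (g x j w ^+ 2)%:E).
    apply/integrableP; split; first by apply/measurable_EFinP; exact: measurable_funX.
    by under eq_integral do rewrite gee0_abs ?lee_fin ?sqr_ge0//; rewrite gsq ltry.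
  under eq_integral do rewrite EFinB.
  rewrite integralB//; last exact: finite_measure_integrable_cst.
  rewrite gsq integral_cst// mul1e [X in (_ - X)%E](_ : _ = 1%E) ?subee//.
  exact: probability_setT.
Qed.

End gaussian_matrix.

(** * Tail bounds for the Gram matrix of the signal coefficients *)

Section signal.
Context d (T : measurableType d) (R : realType) (P : probability T R).
Variables (r : nat) (z : nat -> 'I_r -> {RV P >-> R}).
Hypothesis z_mean : forall j k, ('E_P[z j k] = 0)%E.
Hypothesis z_var : forall j k, ('V_P[z j k] = 1)%E.
Hypothesis z_subgauss : forall j k, sub_gaussian P (z j k).
Hypothesis z_uncorrelated : forall j k l, k != l -> covariance P (z j k) (z j l) = 0%E.
Hypothesis z_independent : independent P (fun j => sigma_rv (z j)).
Hypothesis z_identical : forall i j (B : set (r.-tuple R)), measurable B ->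
  P ((fun w => [tuple z i k w | k < r]) @^-1` B) =
  P ((fun w => [tuple z j k w | k < r]) @^-1` B).

(** Every [z j k] comes with its own sub-Gaussian constant. Equality in law transports the constant
    of [z 0 k] to all [j], which makes the Chernoff bound uniform in [j]. *)
Let integral_identical (h : R -> R) j k :
  measurable_fun setT h -> (forall x, 0 <= h x) ->
  (\int[P]_w (h (z j k w))%:E = \int[P]_w (h (z 0%N k w))%:E)%E.
Proof.
move=> mh h0.
have mhz i : measurable_fun setT (h \o z i k) by exact: measurableT_comp.
have unit_weight i : (\int[P]_w (h (z i k w))%:E = \int[P]_w (1 * (h \o z i k) w)%:E)%E.
  by apply: eq_integral => w _; rewrite mul1r.
rewrite !unit_weight -[RHS]mul1e.
apply: (@eq_integral_levels _ _ _ _ _ P P (cst 1) _ (cst 1)) => //.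
- by move=> w; exact: h0.
- by move=> w; exact: h0.
move=> B mB; rewrite mul1e.
have E i : (\int[P]_w (cst 1 w * \1_((h \o z i k) @^-1` B) w)%:E =
    P ((fun w => [tuple z i k w | k < r]) @^-1` [set t | (h (tnth t k)) \in B]))%E.
  under eq_integral do rewrite mul1r.
  rewrite integral_indic//; last by rewrite -[X in measurable X]setTI; exact: mhz.
  rewrite setIT; congr (P _); apply/funext => w; apply/propext.
  by rewrite /= tnth_mktuple inE.
rewrite !E; apply: z_identical.
rewrite [X in measurable X](_ : _ = (fun t : r.-tuple R => h (tnth t k)) @^-1` B).
  rewrite -[X in measurable X]setTI; apply: measurableT_comp => //.
  exact: measurable_tnth.
by apply/funext => t; apply/propext; rewrite /= inE.
Qed.

Let integral_prod j k l : (\int[P]_w (z j k w * z j l w)%:E = (k == l)%:R%:E)%E.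
Proof.
transitivity (covariance P (z j k) (z j l)).
  rewrite unlock !z_mean /= unlock; apply: eq_integral => w _ /=.
  by rewrite -[RHS]/((z j k w - 0) * (z j l w - 0))%:E !subr0.
have [->|kl] := eqVneq k l; first by rewrite [LHS]z_var.
exact: z_uncorrelated.
Qed.

(** A product of two sub-Gaussian variables is sub-exponential:
    [a * |x y| <= ((x / K)^2 + (y / L)^2) / 2], and the arithmetic-geometric mean inequality
    separates the two exponentials. *)
Lemma signal_tail k l (e : R) : 0 < e -> exists2 c : R, 0 < c &
  forall n, (0 < n)%N ->
  (P [set w | (e <= `|n%:R^-1 * (\sum_(j < n) z j k w * z j l w) - (k == l)%:R|)%R] <=
   (2 * expR (- (c * n%:R)))%:E)%E.
Proof.
move=> e0.
have [K [K0 HK]] := z_subgauss 0%N k; have [L [L0 HL]] := z_subgauss 0%N l.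
pose a : R := Num.min (K ^- 2) (L ^- 2).
have a0 : 0 < a by rewrite lt_min !invr_gt0 !exprn_gt0.
have mexp j m (C : R) : measurable_fun setT (fun w => expR ((z j m w / C) ^+ 2)).
  by apply: measurableT_comp => //; apply: measurable_funX; exact: measurable_funM.
have HE j : (\int[P]_w (expR (a * `|z j k w * z j l w|))%:E <= 2%:E)%E.
  apply: (@le_trans _ _ (\int[P]_w (2^-1%:E * ((expR ((z j k w / K) ^+ 2))%:E +
      (expR ((z j l w / L) ^+ 2))%:E)))%E).
    apply: ge0_le_integral => //.
    - apply/measurable_EFinP; apply: measurableT_comp => //.
      apply: measurable_funM => //; apply: measurableT_comp => //.
      exact: measurable_funM.
    - apply/measurable_EFinP; apply: measurable_funM => //; exact: measurable_funD.
    - move=> w _; rewrite -EFinD -EFinM lee_fin.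
      set x := z j k w; set y := z j l w.
      have aK : a <= K ^- 2 by rewrite ge_min lexx.
      have aL : a <= L ^- 2 by rewrite ge_min lexx orbT.
      have Hx : a * x ^+ 2 <= (x / K) ^+ 2.
        by rewrite exprMn exprVn mulrC ler_wpM2l ?sqr_ge0.
      have Hy : a * y ^+ 2 <= (y / L) ^+ 2.
        by rewrite exprMn exprVn mulrC ler_wpM2l ?sqr_ge0.
      have Hxy : `|x * y| <= (x ^+ 2 + y ^+ 2) / 2.
        rewrite ler_norml; have := sqr_ge0 (x + y); have := sqr_ge0 (x - y).
        by rewrite sqrrB sqrrD => ? ?; apply/andP; split; lra.
      set A := (x / K) ^+ 2 in Hx *; set B := (y / L) ^+ 2 in Hy *.
      apply: (@le_trans _ _ (expR (A / 2 + B / 2))).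
        rewrite ler_expR; apply: le_trans (_ : a * ((x ^+ 2 + y ^+ 2) / 2) <= _).
          by rewrite ler_wpM2l// ltW.
        by rewrite mulrA mulrDr; lra.
      have -> : expR A = expR (A / 2) ^+ 2 by rewrite -expRM_natr; congr expR; lra.
      have -> : expR B = expR (B / 2) ^+ 2 by rewrite -expRM_natr; congr expR; lra.
      by rewrite expRD; have := sqr_ge0 (expR (A / 2) - expR (B / 2)); rewrite sqrrB; lra.
  rewrite ge0_integralZl_EFin//; last 2 first.
  - by move=> w _; rewrite adde_ge0// lee_fin expR_ge0.
  - by apply: emeasurable_funD; exact/measurable_EFinP.
  rewrite ge0_integralD//; try exact/measurable_EFinP.
  have identical m (C : R) : (\int[P]_w (expR ((z j m w / C) ^+ 2))%:E =
      \int[P]_w (expR ((z 0%N m w / C) ^+ 2))%:E)%E.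
    apply: (@integral_identical (fun x => expR ((x / C) ^+ 2))) => [|x].
      by apply: measurableT_comp => //; apply: measurable_funX; exact: measurable_funM.
    exact: expR_ge0.
  rewrite (identical k K) (identical l L).
  rewrite unlock in HK HL.
  apply: le_trans (lee_wpmul2l _ (leeD HK HL)) _ => //.
  by rewrite -EFinD -EFinM lee_fin; lra.
(* The factor [expR a] absorbs the subtracted mean, which is 0 or 1. *)
pose M : R := expR a * 2.
have M0 : 0 < M by rewrite mulr_gt0// expR_gt0.
exists (chernoff_rate a M e); first exact: chernoff_rate_gt0.
move=> n n0.
pose xi j w : R := z j k w * z j l w - (k == l)%:R.
have mzz j : measurable_fun setT (fun w => z j k w * z j l w).
  exact: measurable_funM.
have := @abs_sum_tail_le _ _ _ P _ (iota 0 n) (fun j => sigma_rv (z j)) xi a M e.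
rewrite size_iota => H.
have nR0 : 0 < n%:R :> R by rewrite ltr0n.
have -> : [set w | e <= `|n%:R^-1 * (\sum_(j < n) z j k w * z j l w) - (k == l)%:R|] =
    [set w | n%:R * e <= `|\sum_(j <- iota 0 n) xi j w|].
  apply/funext => w; apply/propext; rewrite /=.
  have -> : \sum_(j <- iota 0 n) xi j w = n%:R *
      (n%:R^-1 * (\sum_(j < n) z j k w * z j l w) - (k == l)%:R).
    rewrite (_ : iota 0 n = index_iota 0 n) /xi; last by rewrite /index_iota subn0.
    rewrite big_mkord sumrB sumr_const card_ord.
    rewrite mulrBr mulVKf; last by rewrite gt_eqF.
    by rewrite [X in _ = _ - X]mulr_natl.
  by rewrite normrM gtr0_norm// ler_pM2l.
apply: H => //.
- exact: iota_uniq.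
- exact: independent_indep_on (iota_uniq _ _).
- by move=> j; apply: sigma_rv_measurable => m; exact: measurable_funPT.
- move=> j B mB; apply: sigma_rv_preimage => //.
  apply: measurable_funB => //; apply: measurable_funM.
    exact: (@measurable_sigma_gen _ _ _ _ (fun m => z j m : T -> R) k).
  exact: (@measurable_sigma_gen _ _ _ _ (fun m => z j m : T -> R) l).
- move=> j; rewrite EFinM.
  apply: le_trans (lee_wpmul2l _ (HE j)); last by rewrite lee_fin expR_ge0.
  rewrite -ge0_integralZl_EFin ?expR_ge0//; last first.
    apply/measurable_EFinP; apply: measurableT_comp => //.
    by apply: measurable_funM => //; exact: measurableT_comp.
  under [leRHS]eq_integral do rewrite -EFinM -expRD.
  apply: ge0_le_integral => //.
  - apply/measurable_EFinP; apply: measurableT_comp => //; apply: measurable_funM => //.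
    by apply: measurableT_comp => //; exact: measurable_funB.
  - apply/measurable_EFinP; apply: measurableT_comp => //; apply: measurable_funD => //.
    by apply: measurable_funM => //; exact: measurableT_comp.
  - move=> w _; rewrite lee_fin ler_expR.
    rewrite [leRHS](_ : _ = a * (1 + `|z j k w * z j l w|)); last by ring.
    rewrite ler_wpM2l ?(ltW a0)// (le_trans (ler_normB _ _))// addrC lerD2r.
    by rewrite normr_nat; case: (_ == _).
- move=> j; rewrite /xi.
  have [_ izz] := integrable_mgf (mzz j) a0 (le_lt_trans (HE j) (ltry _)).
  under eq_integral do rewrite EFinB.
  rewrite integralB//; last exact: finite_measure_integrable_cst.
  rewrite integral_prod integral_cst// [X in (_ * X)%E](_ : _ = 1%E).
    by rewrite mule1 subee.
  exact: probability_setT.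
Qed.

End signal.

(* Independence of [gF] and [gG] says that the diagonal map sends [P] to a
   product measure on [(T, gF) * (T, gG)]. *)
Lemma independent2_tonelli d (T : measurableType d) (R : realType)
    (P : probability T R) (gF gG : set (set T))
    (h : g_sigma_algebraType gF * g_sigma_algebraType gG -> \bar R) :
  gF `<=` measurable -> gG `<=` measurable ->
  independent2 P <<s gF>> <<s gG>> ->
  measurable_fun setT h -> (forall x, 0 <= h x)%E ->
  measurable_fun setT (fun w : T => \int[P]_w' h (w', w))%E /\
  (\int[P]_w h (w, w) = \int[P]_w \int[P]_w' h (w', w))%E.
Proof.
move=> mF mG ind mh h0.
pose TF := g_sigma_algebraType gF; pose TG := g_sigma_algebraType gG.
have idF : measurable_fun setT (id : T -> TF).
  move=> _ B mB; rewrite setTI.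
  by apply: smallest_sub mB => //; exact: sigma_algebra_measurable.
have idG : measurable_fun setT (id : T -> TG).
  move=> _ B mB; rewrite setTI.
  by apply: smallest_sub mB => //; exact: sigma_algebra_measurable.
have diag : measurable_fun setT (fun w : T => (w, w) : TF * TG).
  exact: measurable_fun_pair.
pose XF : {mfun T >-> TF} := mfun_Sub (mem_set idF).
pose XG : {mfun T >-> TG} := mfun_Sub (mem_set idG).
pose XD : {mfun T >-> (TF * TG)%type} := mfun_Sub (mem_set diag).
(* A product measure is determined by its values on rectangles, and there the identity is the
   independence hypothesis. *)
have prodE : forall X, measurable X ->
    (distribution P XF \x distribution P XG)%E X = distribution P XD X.
  apply: product_measure_unique => A B mA mB.
  exact: ind.
have inner (y : TG) : (\int[distribution P XF]_x h (x, y) = \int[P]_w' h (w', y))%E.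
  by rewrite ge0_integral_distribution//; exact: measurableT_comp.
have mG' : measurable_fun setT (fun y : TG => \int[distribution P XF]_x h (x, y))%E.
  exact: measurable_fun_fubini_tonelli_G.
split.
  have := measurableT_comp mG' idG; congr (measurable_fun _ _).
  by apply/funext => w; exact: inner.
transitivity (\int[distribution P XD]_x h x)%E.
  by rewrite ge0_integral_distribution.
transitivity (\int[(distribution P XF \x distribution P XG)%E]_x h x)%E.
  by apply: eq_measure_integral => A mA _; exact/esym/prodE.
rewrite fubini_tonelli1// -[LHS]/(\int[distribution P XF]_x
  \int[distribution P XG]_y h (x, y))%E fubini_tonelli//.
rewrite ge0_integral_distribution//=; last by move=> y; exact: integral_ge0.
by apply: eq_integral => w _; exact: inner.
Qed.

(** * Signal-noise cross terms, conditionally on the signal *)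

Section cross_term.
Context d (T : measurableType d) (R : realType) (P : probability T R).
Variables (p n : nat) (G : 'I_p -> 'I_n -> {RV P >-> R}).
Hypothesis n0 : (0 < n)%N.
Hypothesis G_normal : forall i j B, measurable B ->
  distribution P (G i j) B = normal_prob 0 (Num.sqrt n%:R^-1) B.
Hypothesis G_independent : independent P (fun ij : 'I_p * 'I_n =>
  sigma_rv (fun _ : unit => G ij.1 ij.2 : T -> R)).
Variables (I : Type) (X : I -> T -> R) (v : 'I_n -> T -> R).
Hypothesis mX : forall i, measurable_fun setT (X i).
Hypothesis GX_independent : independent2 P
  (sigma_rv (fun ij : 'I_p * 'I_n => G ij.1 ij.2 : T -> R)) (sigma_rv X).
Hypothesis mv : forall j,
  measurable_fun setT (v j : g_sigma_algebraType (sigma_gen X) -> R).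

Let nR0 : 0 < n%:R :> R. Proof. by rewrite ltr0n. Qed.

Let mvT j : measurable_fun setT (v j).
Proof.
move=> _ B mB; rewrite setTI.
by apply: (sigma_rv_measurable mX); apply: sigma_rv_preimage mB; exact: mv.
Qed.

Let mform (x : 'I_p -> R) :
  measurable_fun setT (fun w => \sum_i \sum_j x i * v j w * G i j w).
Proof.
apply: measurable_sum => i; apply: measurable_sum => j.
by apply: measurable_funM => //; exact: measurable_funM.
Qed.

Let msqr : measurable_fun setT (fun w => \sum_j v j w ^+ 2).
Proof. by apply: measurable_sum => j; exact: measurable_funX. Qed.

(** Integrating over the noise first, with the signal frozen, [x^T G v] has the moment generating
    function of a centred normal variable of variance [|v|^2 / n]. The indicator of [B] keeps this
    variance at most [2 / n] for every frozen value that contributes. *)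
Let cross_term_tail1 (x : 'I_p -> R) (e : R) : \sum_i x i ^+ 2 = 1 -> 0 < e ->
  (P [set w | (\sum_j v j w ^+ 2 <= 2)%R /\
      (e <= \sum_i \sum_j x i * v j w * G i j w)%R] <=
   (expR (- (e ^+ 2 / 4 * n%:R)))%:E)%E.
Proof.
move=> x1 e0.
pose gF := sigma_gen (fun ij : 'I_p * 'I_n => G ij.1 ij.2 : T -> R).
pose gG := sigma_gen X.
pose TF := g_sigma_algebraType gF; pose TG := g_sigma_algebraType gG.
pose B := [set w : T | \sum_j v j w ^+ 2 <= 2].
(* The minimizer of the exponent [- l * e + l^2 / n], with minimum [- e^2 n / 4]. *)
pose l := e * n%:R / 2.
pose h (y : TF * TG) : \bar R := (\1_B y.2 *
  expR (l * (\sum_i \sum_j x i * v j y.2 * G i j y.1) - l * e))%:E.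
have mBG : measurable (B : set TG).
  rewrite (_ : B = [set w | - 2 <= - \sum_j v j w ^+ 2]); last first.
    by apply/funext => w; rewrite /B /= lerN2.
  apply: (@measurable_ge _ TG); apply: measurableT_comp => //.
  by apply: measurable_sum => j; exact: measurable_funX.
have mB : measurable B.
  by have := sigma_rv_measurable mX; apply.
have mh : measurable_fun setT h.
  apply/measurable_EFinP; apply: measurable_funM.
    by apply: measurableT_comp; [exact: measurable_indic | exact: measurable_snd].
  apply: measurableT_comp => //; apply: measurable_funB => //; apply: measurable_funM => //.
  apply: measurable_sum => i; apply: measurable_sum => j; apply: measurable_funM.
    apply: measurable_funM => //; apply: measurableT_comp; last exact: measurable_snd.
    exact: mv.
  apply: (measurableT_comp (f := G i j : TF -> R)); last exact: measurable_fst.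
  exact: (@measurable_sigma_gen _ _ _ _ (fun ij : 'I_p * 'I_n => G ij.1 ij.2 : T -> R) (i, j)).
have h0 y : (0 <= h y)%E by rewrite lee_fin mulr_ge0// expR_ge0.
apply: le_trans (@probability_le_integral _ _ _ P _
  (fun w => \1_B w * expR (l * (\sum_i \sum_j x i * v j w * G i j w) - l * e)) _ _ _ _) _.
- rewrite (_ : [set w | _ /\ _] = B `&` [set w | e <= \sum_i \sum_j x i * v j w * G i j w])//.
  by apply: measurableI => //; exact: measurable_ge.
- apply: measurable_funM; first exact: measurable_indic.
  by apply: measurableT_comp => //; apply: measurable_funB => //; exact: measurable_funM.
- by move=> w; rewrite mulr_ge0// expR_ge0.
- move=> w [Bw ew]; rewrite indicE mem_set// mul1r -[leLHS]expR0 ler_expR -mulrBr.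
  by rewrite mulr_ge0 ?subr_ge0// /l !mulr_ge0// ltW.
have mF : gF `<=` measurable by move=> _ [ij _ [C mC <-]]; exact: measurable_funPT.
have mG : gG `<=` measurable by move=> _ [i _ [C mC <-]]; exact: mX.
have [minner ->] := independent2_tonelli mF mG GX_independent mh h0.
apply: (@le_trans _ _ (\int[P]_w (expR (- (e ^+ 2 / 4 * n%:R)))%:E)%E); last first.
  by rewrite integral_cst//= [X in (_ * X)%E](_ : _ = 1%E) ?mule1//; exact: probability_setT.
apply: ge0_le_integral => //.
  by move=> w _; exact: integral_ge0.
move=> w _.
have [wB|wB] := boolP (w \in B); last first.
  rewrite integral0_eq ?lee_fin ?expR_ge0// => w' _.
  by rewrite /h /= indicE (negbTE wB) mul0r.
have vB : \sum_j v j w ^+ 2 <= 2 by rewrite inE in wB.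
rewrite [leLHS](_ : _ = \int[P]_w' ((expR (- (l * e)))%:E *
    (expR (\sum_i \sum_j (l * (x i * v j w)) * G i j w'))%:E))%E; last first.
  apply: eq_integral => w' _; rewrite /h /= indicE wB mul1r -EFinM -expRD.
  congr (expR _)%:E; rewrite addrC mulr_sumr; congr (_ + _).
  by apply: eq_bigr => i _; rewrite mulr_sumr; apply: eq_bigr => j _; rewrite mulrA.
rewrite ge0_integralZl_EFin ?expR_ge0//; last first.
  apply/measurable_EFinP; apply: measurableT_comp => //.
  apply: measurable_sum => i; apply: measurable_sum => j; exact: measurable_funM.
rewrite (gaussian_matrix_mgf n0 G_normal G_independent (fun i j => l * (x i * v j w))).
rewrite -EFinM -expRD lee_fin ler_expR.
have -> : \sum_i \sum_j (l * (x i * v j w)) ^+ 2 = l ^+ 2 * \sum_j v j w ^+ 2.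
  transitivity (\sum_i l ^+ 2 * (x i ^+ 2 * \sum_j v j w ^+ 2)).
    apply: eq_bigr => i _; rewrite mulr_sumr mulr_sumr; apply: eq_bigr => j _.
    by rewrite !exprMn.
  by rewrite -mulr_sumr -mulr_suml x1 mul1r.
apply: (@le_trans _ _ (- (l * e) + l ^+ 2 * 2 / (2 * n%:R))).
  rewrite lerD2l ler_wpM2r ?invr_ge0 ?mulr_ge0 ?(ltW nR0)//.
  by rewrite ler_wpM2l ?sqr_ge0.
rewrite le_eqVlt; apply/orP; left; apply/eqP; rewrite /l.
by field; rewrite gt_eqF.
Qed.

Lemma cross_term_tail (x : 'I_p -> R) (e : R) : \sum_i x i ^+ 2 = 1 -> 0 < e ->
  (P [set w | (\sum_j v j w ^+ 2 <= 2)%R /\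
      (e <= `|\sum_i \sum_j x i * v j w * G i j w|)%R] <=
   (2 * expR (- (e ^+ 2 / 4 * n%:R)))%:E)%E.
Proof.
move=> x1 e0.
have x1' : \sum_i (- x i) ^+ 2 = 1 by under eq_bigr do rewrite sqrrN.
pose ev y := [set w | \sum_j v j w ^+ 2 <= 2 /\
    e <= \sum_i \sum_j y i * v j w * G i j w].
have mev y : measurable (ev y).
  apply: measurableI; last exact: measurable_ge.
  rewrite [X in measurable X](_ : _ = [set w | - 2 <= - \sum_j v j w ^+ 2]).
    by apply: measurable_ge; exact: measurableT_comp.
  by apply/funext => w; rewrite /= lerN2.
rewrite (mulr_natl (expR _) 2) mulr2n EFinD.
apply: le_trans (leeD (cross_term_tail1 x1 e0) (cross_term_tail1 x1' e0)).
apply: le_trans (measureU2 _ (mev _) (mev _)).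
apply: le_measure; rewrite ?inE.
- apply: measurableI; last by apply: measurable_ge; exact: measurableT_comp.
  rewrite [X in measurable X](_ : _ = [set w | - 2 <= - \sum_j v j w ^+ 2]).
    by apply: measurable_ge; exact: measurableT_comp.
  by apply/funext => w; rewrite /= lerN2.
- by apply: measurableU.
move=> w [v2]; rewrite ler_normr => /orP[?|H]; [left|right]; split => //.
apply: le_trans H _; rewrite le_eqVlt; apply/orP; left; apply/eqP.
rewrite -sumrN; apply: eq_bigr => i _; rewrite -sumrN; apply: eq_bigr => j _.
by rewrite !mulNr.
Qed.

End cross_term.

(** * Euclidean geometry *)

Section inner_product.
Variable R : realType.

(** Stated for the three entries of a Gram matrix, because it serves both the inner product and the
    form [M <x, y> - <A^T x, A^T y>] built from the noise. *)
Lemma psd_cauchy_schwarz (xx xy yy : R) :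
  (forall s t, 0 <= s ^+ 2 * xx + 2 * s * t * xy + t ^+ 2 * yy) ->
  xy ^+ 2 <= xx * yy.
Proof.
move=> H.
have xx0 : 0 <= xx by have := H 1 0; lra.
have [xx_eq0|xx_neq0] := eqVneq xx 0.
  (* In the degenerate case this test vector gives the form the value [- (yy + 2) * xy^4], which
     forces [xy = 0]. *)
  rewrite xx_eq0 mul0r; have := H (- (yy + 1) * xy) (xy ^+ 2).
  have yy0 : 0 <= yy by have := H 0 1; lra.
  rewrite xx_eq0 (_ : _ + _ = - (yy + 2) * (xy ^+ 2) ^+ 2); last by ring.
  rewrite mulNr oppr_ge0 pmulr_rle0; last by lra.
  by rewrite real_exprn_even_le0 ?num_real//= => /eqP ->.
have xx1 : 0 < xx by rewrite lt_neqAle eq_sym xx_neq0.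
rewrite -subr_ge0 -(pmulr_rge0 _ xx1).
by have := H (- xy) xx; rewrite (_ : _ + _ = xx * (xx * yy - xy ^+ 2)); last by ring.
Qed.

Variable m : nat.
Implicit Types x y : 'cV[R]_m.

Lemma innerC x y : inner x y = inner y x.
Proof. by apply: eq_bigr => i _; rewrite mulrC. Qed.

Lemma innerDl x1 x2 y : inner (x1 + x2) y = inner x1 y + inner x2 y.
Proof. by rewrite -big_split; apply: eq_bigr => i _; rewrite mxE mulrDl. Qed.

Lemma innerZl (a : R) x y : inner (a *: x) y = a * inner x y.
Proof. by rewrite mulr_sumr; apply: eq_bigr => i _; rewrite mxE mulrA. Qed.

Lemma innerNl x y : inner (- x) y = - inner x y.
Proof. by rewrite -scaleN1r innerZl mulN1r. Qed.

Lemma inner0l y : inner 0 y = 0.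
Proof. by rewrite -(scale0r 0) innerZl mul0r. Qed.

Lemma inner_suml (I : Type) (s : seq I) (Q : pred I) (F : I -> 'cV[R]_m) y :
  inner (\sum_(i <- s | Q i) F i) y = \sum_(i <- s | Q i) inner (F i) y.
Proof.
elim/big_rec2 : _ => [|i a b _ <-]; first exact: inner0l.
exact: innerDl.
Qed.

Lemma innerDr x y1 y2 : inner x (y1 + y2) = inner x y1 + inner x y2.
Proof. by rewrite innerC innerDl !(innerC x). Qed.

Lemma innerZr (a : R) x y : inner x (a *: y) = a * inner x y.
Proof. by rewrite innerC innerZl (innerC x). Qed.

Lemma innerNr x y : inner x (- y) = - inner x y.
Proof. by rewrite innerC innerNl (innerC x). Qed.

Lemma inner_sumr (I : Type) (s : seq I) (Q : pred I) (F : I -> 'cV[R]_m) x :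
  inner x (\sum_(i <- s | Q i) F i) = \sum_(i <- s | Q i) inner x (F i).
Proof. by rewrite innerC inner_suml; apply: eq_bigr => i _; rewrite innerC. Qed.

Lemma inner_ge0 x : 0 <= inner x x.
Proof. by apply: sumr_ge0 => i _; rewrite -expr2 sqr_ge0. Qed.

Lemma inner_eq0 x : (inner x x == 0) = (x == 0).
Proof.
apply/eqP/eqP => [x0|->]; last exact: inner0l.
have /psumr_eq0P H := x0.
apply/matrixP => i j; rewrite ord1 mxE; apply/eqP; rewrite -sqrf_eq0 expr2.
by rewrite H// => k _; rewrite -expr2 sqr_ge0.
Qed.

Lemma enorm_ge0 x : 0 <= enorm x. Proof. exact: sqrtr_ge0. Qed.

Lemma sqr_enorm x : enorm x ^+ 2 = inner x x.
Proof. by rewrite sqr_sqrtr ?inner_ge0. Qed.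

Lemma enormZ (a : R) x : enorm (a *: x) = `|a| * enorm x.
Proof. by rewrite /enorm innerZl innerZr mulrA -expr2 sqrtrM ?sqr_ge0// sqrtr_sqr. Qed.

Lemma cauchy_schwarz x y : `|inner x y| <= enorm x * enorm y.
Proof.
rewrite -ler_sqr ?nnegrE ?mulr_ge0 ?enorm_ge0// exprMn !sqr_enorm real_normK ?num_real//.
apply: psd_cauchy_schwarz => s t; have := inner_ge0 (s *: x + t *: y).
rewrite !(innerDl, innerDr, innerZl, innerZr) (innerC y x).
by move/le_trans; apply; rewrite le_eqVlt; apply/orP; left; apply/eqP; ring.
Qed.

Lemma enormD x y : enorm (x + y) <= enorm x + enorm y.
Proof.
rewrite -ler_sqr ?nnegrE ?addr_ge0 ?enorm_ge0// sqrrD !sqr_enorm.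
rewrite innerDl !innerDr (innerC y x).
have := ler_norm (inner x y); have := cauchy_schwarz x y.
by rewrite -mulr_natr; lra.
Qed.

End inner_product.

Lemma inner_trmx_mul (R : realType) (m n : nat) (A : 'M[R]_(m, n))
    (x : 'cV[R]_m) (y : 'cV[R]_n) : inner (A^T *m x) y = inner x (A *m y).
Proof.
rewrite /inner; under eq_bigr do rewrite mxE mulr_suml.
rewrite exchange_big; apply: eq_bigr => i _; rewrite mxE mulr_sumr.
by apply: eq_bigr => j _; rewrite mxE mulrCA mulrA.
Qed.

(** A crude bound; its purpose is to make the supremum over the unit sphere finite in
    [seminorm_lattice_bound]. *)
Lemma enorm_trmx_mul_le (R : realType) (m n : nat) (A : 'M[R]_(m, n)) (x : 'cV[R]_m) :
  enorm (A^T *m x) <= fnorm A * enorm x.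
Proof.
have S0 : 0 <= \sum_i \sum_j A i j ^+ 2.
  by apply: sumr_ge0 => i _; apply: sumr_ge0 => j _; exact: sqr_ge0.
rewrite -ler_sqr ?nnegrE ?mulr_ge0 ?enorm_ge0 ?sqrtr_ge0//.
rewrite exprMn !sqr_enorm sqr_sqrtr// exchange_big mulr_suml.
apply: ler_sum => j _.
have -> : (A^T *m x) j 0 = inner (col j A) x.
  by rewrite mxE; apply: eq_bigr => i _; rewrite !mxE.
have -> : \sum_i A i j ^+ 2 = inner (col j A) (col j A).
  by apply: eq_bigr => i _; rewrite !mxE expr2.
rewrite -expr2 -[leLHS]real_normK ?num_real// -!sqr_enorm -exprMn ler_sqr ?nnegrE//.
  exact: cauchy_schwarz.
by rewrite mulr_ge0 ?enorm_ge0.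
Qed.

(** * Lattice directions in place of a net of the sphere *)

(** A signed integer is coded by a sign bit and a magnitude, so that the index set is a finite type,
    ready for a union bound. Zero has two codes, which only enlarges the count. *)
Definition lattice_vec (R : realType) (p B : nat) (m : {ffun 'I_p -> bool * 'I_B}) :
    'cV[R]_p :=
  \col_i ((-1) ^+ (m i).1 * (val (m i).2)%:R).

Lemma inner_lattice_vec (R : realType) (p B : nat) (m : {ffun 'I_p -> bool * 'I_B}) :
  inner (lattice_vec R m) (lattice_vec R m) = (\sum_i (val (m i).2) ^ 2)%:R.
Proof.
rewrite natr_sum; apply: eq_bigr => i _.
by rewrite !mxE -expr2 exprMn sqrr_sign mul1r natrX.
Qed.

(* Each point counted satisfies [1 <= 2^K * \prod_i 2^-|m i|], and the sum of the
   right-hand sides over all [m] factorizes. *)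
Lemma lattice_card (p B K : nat) :
  (#|[pred m : {ffun 'I_p -> bool * 'I_B} | (\sum_i (val (m i).2) ^ 2 <= K)%N]| <=
   2 ^ K * 4 ^ p)%N.
Proof.
pose w (a : bool * 'I_B) : rat := 2^-1 ^+ (val a.2).
have half : (0 : rat) < 2^-1 by [].
have geo b : \sum_(a < b) (2^-1 : rat) ^+ a <= 2.
  suff -> : \sum_(a < b) (2^-1 : rat) ^+ a = 2 - 2 * 2^-1 ^+ b.
    by rewrite lerBlDr lerDl mulr_ge0// exprn_ge0.
  elim: b => [|b IH]; first by rewrite big_ord0 expr0 mulr1 subrr.
  by rewrite big_ord_recr /= IH exprS; field.
have w4 : \sum_a w a <= 4.
  rewrite -(pair_bigA _ (fun (b : bool) (a : 'I_B) => (2^-1 : rat) ^+ a)) /=.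
  by rewrite big_bool /=; have := geo B; lra.
have w0 a : 0 <= w a by rewrite exprn_ge0.
rewrite -(ler_nat rat) natrM !natrX -sum1_card natr_sum.
apply: (@le_trans _ _ (\sum_(m : {ffun 'I_p -> bool * 'I_B}) 2 ^+ K * \prod_i w (m i))).
  rewrite big_mkcond; apply: ler_sum => m _; rewrite inE.
  case: ifPn => [mK|_]; last by rewrite mulr_ge0 ?exprn_ge0// prodr_ge0.
  rewrite /w -expr_sum exprVn ler_pdivlMr ?exprn_gt0// mul1r ler_eXn2l//.
  apply: leq_trans mK; apply: leq_sum => i _.
  by case: (val _) => // a; rewrite -mulnn leq_pmulr.
rewrite -mulr_sumr ler_wpM2l ?exprn_ge0//.
rewrite -(bigA_distr_bigA (fun _ a => w a)) prodr_const card_ord.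
by rewrite lerXn2r ?nnegrE ?sumr_ge0.
Qed.

(** Each coordinate of [L sqrt(p) x] is rounded towards zero. This cannot increase the norm, which
    bounds the sum of squares and keeps the approximant in the unit ball. Each coordinate of [x]
    moves by at most [1 / (L sqrt(p))], hence [x] by at most [1 / L]. *)
Lemma lattice_approx (R : realType) (p L : nat) (x : 'cV[R]_p) :
  (0 < L)%N -> inner x x = 1 ->
  exists (m : {ffun 'I_p -> bool * 'I_(L * p).+1}) (c : R),
    [/\ 0 < c, (\sum_i (val (m i).2) ^ 2 <= L ^ 2 * p)%N,
        enorm (c *: lattice_vec R m) <= 1 &
        enorm (x - c *: lattice_vec R m) <= L%:R^-1].
Proof.
move=> L0 x1.
have p0 : (0 < p)%N.
  rewrite lt0n; apply/eqP => p0; move: x1; rewrite /inner big1 => [/eqP|i _].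
    by rewrite eq_sym oner_eq0.
  by have := ltn_ord i; rewrite [X in (_ < X)%N]p0.
pose s : R := L%:R * Num.sqrt p%:R.
have s0 : 0 < s by rewrite mulr_gt0 ?sqrtr_gt0 ?ltr0n.
have s2 : s ^+ 2 = (L ^ 2 * p)%:R.
  by rewrite exprMn sqr_sqrtr ?ler0n// natrM natrX.
have x_le1 i : `|x i 0| <= 1.
  rewrite -(@ler_pXn2r _ 2)// ?nnegrE// expr1n real_normK ?num_real// -x1 /inner.
  rewrite (bigD1 i)//= -expr2 lerDl sumr_ge0// => j _; rewrite -expr2; exact: sqr_ge0.
pose a i := Num.truncn (s * `|x i 0|).
have sx0 i : 0 <= s * `|x i 0| by rewrite mulr_ge0// ltW.
have a_le i : (a i)%:R <= s * `|x i 0| by rewrite truncn_le.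
(* The magnitudes are at most [L sqrt(p)], and [sqrt(p) <= p] for a positive integer [p]. *)
have aB i : (a i < (L * p).+1)%N.
  rewrite ltnS -(ler_nat R) (le_trans (a_le i))//.
  apply: (@le_trans _ _ (s * 1)); first by rewrite ler_wpM2l// ltW.
  rewrite mulr1 natrM /s ler_wpM2l ?ler0n//.
  rewrite -ler_sqr ?nnegrE ?sqrtr_ge0 ?ler0n// sqr_sqrtr ?ler0n//.
  by rewrite -natrX ler_nat -mulnn leq_pmulr.
pose m := [ffun i : 'I_p => (x i 0 < 0, Ordinal (aB i))].
have m2 i : val (m i).2 = a i by rewrite ffunE.
exists m, s^-1.
have mle : (\sum_i (val (m i).2) ^ 2)%N%:R <= s ^+ 2.
  rewrite natr_sum -[leRHS]mulr1 -[X in _ <= _ * X]x1 mulr_sumr; apply: ler_sum => i _.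
  rewrite m2 natrX -expr2 -[x i 0 ^+ 2]real_normK ?num_real// -exprMn.
  by rewrite lerXn2r ?nnegrE ?ler0n.
split.
- by rewrite invr_gt0.
- by move: mle; rewrite s2 ler_nat.
- rewrite -(@ler_pXn2r _ 2)// ?nnegrE ?enorm_ge0// expr1n sqr_enorm.
  rewrite innerZl innerZr inner_lattice_vec mulrA -expr2 exprVn mulrC.
  by rewrite ler_pdivrMr ?exprn_gt0// mul1r.
- rewrite -(@ler_pXn2r _ 2)// ?nnegrE ?enorm_ge0 ?invr_ge0 ?ler0n// sqr_enorm.
  apply: (@le_trans _ _ (\sum_(i < p) s ^- 2)).
    apply: ler_sum => i _; rewrite !mxE -expr2 -exprVn m2 ffunE /=.
    rewrite -[leLHS]real_normK ?num_real// lerXn2r ?nnegrE ?invr_ge0 ?(ltW s0)//.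
    have -> : x i 0 - s^-1 * ((-1) ^+ (x i 0 < 0)%R * (a i)%:R) =
        (-1) ^+ (x i 0 < 0)%R * (`|x i 0| - s^-1 * (a i)%:R).
      case: ltP => H; first by rewrite ltr0_norm// expr1; ring.
      by rewrite ger0_norm// expr0; ring.
    rewrite normrMsign ler_norml; apply/andP; split.
      have : s^-1 * (a i)%:R <= `|x i 0| by rewrite mulrC ler_pdivrMr// mulrC.
      have : 0 < s^-1 by rewrite invr_gt0.
      lra.
    rewrite lerBlDr -[X in _ <= X + _]mulr1 -mulrDr addrC natr1 mulrC.
    by rewrite ler_pdivlMr// mulrC ltW// truncnS_gt.
  rewrite sumr_const card_ord s2 natrM natrX -mulr_natr.
  rewrite le_eqVlt; apply/orP; left; apply/eqP; field.
  by rewrite !pnatr_eq0 -!lt0n L0.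
Qed.

(** A self-bounding argument: approximating unit vectors within [1 / L] gives [S <= k + S / L] for
    the supremum [S] of [N] over the sphere, hence [S <= k L / (L - 1)]. The bound by [C] guarantees
    that [S] is finite. *)
Lemma seminorm_lattice_bound (R : realType) (p L : nat) (N : 'cV[R]_p -> R) (C k : R) :
  (1 < L)%N -> 0 <= k -> (forall x, 0 <= N x) ->
  (forall x y, N (x + y) <= N x + N y) ->
  (forall a x, 0 <= a -> N (a *: x) = a * N x) ->
  (forall x, N x <= C * enorm x) ->
  (forall m : {ffun 'I_p -> bool * 'I_(L * p).+1},
    (\sum_i (val (m i).2) ^ 2 <= L ^ 2 * p)%N ->
    N (lattice_vec R m) <= k * enorm (lattice_vec R m)) ->
  forall x, N x <= k * (L%:R / (L%:R - 1)) * enorm x.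
Proof.
move=> L1 k0 N0 ND NZ NC Nk.
have LR1 : 1 < L%:R :> R by rewrite ltr1n.
pose E := [set N x | x in [set x | inner x x = 1]].
have unit_bound : forall x, inner x x = 1 -> N x <= k * (L%:R / (L%:R - 1)).
  move=> x0 x01.
  have Eub : has_ubound E.
    exists C => _ [x /= x1 <-]; apply: le_trans (NC x) _.
    by rewrite /enorm x1 sqrtr1 mulr1.
  have E0 : E !=set0 by exists (N x0), x0.
  have step x : inner x x = 1 -> N x <= k + L%:R^-1 * sup E.
    move=> x1; have [m [c [c0 mK mc xm]]] := lattice_approx (ltnW L1) x1.
    set y := c *: lattice_vec R m in mc xm.
    rewrite -(subrK y x) addrC; apply: le_trans (ND _ _) _; apply: lerD.
      rewrite NZ ?(ltW c0)//; apply: le_trans (ler_wpM2l (ltW c0) (Nk m mK)) _.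
      rewrite mulrCA -[leRHS]mulr1 ler_wpM2l//.
      by move: mc; rewrite /y enormZ gtr0_norm.
    have supE0 : 0 <= sup E.
      by apply: le_trans (N0 x) _; apply: ub_le_sup => //; exists x.
    have [->|xy] := eqVneq (x - y) 0.
      by rewrite -(scale0r x) NZ// mul0r mulr_ge0 ?invr_ge0 ?ler0n.
    have n0 : 0 < enorm (x - y).
      by rewrite sqrtr_gt0 lt_neqAle inner_ge0 eq_sym inner_eq0 xy.
    have -> : x - y = enorm (x - y) *: ((enorm (x - y))^-1 *: (x - y)).
      by rewrite scalerA mulfV ?gt_eqF// scale1r.
    rewrite NZ ?(ltW n0)//; apply: ler_pM => //; first exact: ltW.
    apply: ub_le_sup => //; exists ((enorm (x - y))^-1 *: (x - y)) => //=.
    rewrite innerZl innerZr -sqr_enorm mulrA -expr2 -exprMn mulVf ?gt_eqF//.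
    by rewrite expr1n.
  have supE : sup E <= k + L%:R^-1 * sup E.
    by apply: ge_sup => // _ [x x1 <-]; exact: step.
  apply: le_trans (step _ x01) _.
  have LN : L%:R != 0 :> R by rewrite gt_eqF// (lt_trans ltr01).
  have L10 : 0 < L%:R - 1 :> R by rewrite subr_gt0.
  have SE : sup E * (L%:R - 1) <= k * L%:R.
    rewrite mulrBr mulr1 lerBlDr.
    have := ler_wpM2r (ler0n R L) supE.
    by rewrite mulrDl mulrAC mulVf// mul1r.
  rewrite mulrA ler_pdivlMr// mulrDl mulrAC.
  have -> : L%:R^-1 * (L%:R - 1) * sup E = L%:R^-1 * (sup E * (L%:R - 1)) by ring.
  apply: (@le_trans _ _ (k * (L%:R - 1) + L%:R^-1 * (k * L%:R))).
    by rewrite lerD2l ler_wpM2l ?invr_ge0 ?ler0n.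
  by rewrite le_eqVlt; apply/orP; left; apply/eqP; field.
move=> x; have [->|x0] := eqVneq x 0.
  rewrite -(scale0r 0) NZ// mul0r enormZ normr0 mul0r mulr0//.
have n0 : 0 < enorm x.
  by rewrite sqrtr_gt0 lt_neqAle inner_ge0 eq_sym inner_eq0 x0.
have -> : N x = enorm x * N ((enorm x)^-1 *: x).
  by rewrite -NZ ?(ltW n0)// scalerA mulfV ?gt_eqF// scale1r.
rewrite mulrC ler_wpM2r ?(ltW n0)//; apply: unit_bound.
rewrite innerZl innerZr -sqr_enorm mulrA -expr2 -exprMn mulVf ?gt_eqF//.
by rewrite expr1n.
Qed.

(** * Borel-Cantelli and the union bound *)

(** The assumed bound holds only from some [N] on, so a geometric series is summed for the shifted
    events [B' n = B (n + N)]. A point outside their upper limit eventually avoids [B]. *)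
Lemma borel_cantelli_expR d (T : measurableType d) (R : realType)
    (P : probability T R) (B : nat -> set T) (K c : R) :
  0 < c -> (forall n, measurable (B n)) ->
  (\forall n \near \oo, (P (B n) <= (K * expR (- (c * n%:R)))%:E)%E) ->
  {ae P, forall w, \forall n \near \oo, ~ B n w}.
Proof.
move=> c0 mB [N _ HN].
pose q := expR (- c).
have q0 : 0 < q by exact: expR_gt0.
have q1 : q < 1 by rewrite expR_lt1 oppr_lt0.
have K0 : 0 <= K.
  have := HN N (leqnn N); move/(le_trans (measure_ge0 _ _)).
  by rewrite lee_fin pmulr_lge0// expR_gt0.
pose B' n := B (n + N)%N.
have Bq n : (P (B' n) <= (K * q ^+ n)%:E)%E.
  apply: le_trans (HN (n + N)%N (leq_addl _ _)) _.
  rewrite lee_fin ler_wpM2l// -expRM_natr ler_expR mulNr lerN2 ler_wpM2l ?(ltW c0)//.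
  by rewrite ler_nat leq_addr.
have sumB : (\sum_(n <oo) P (B' n) < +oo)%E.
  apply: (@le_lt_trans _ _ (K / (1 - q))%:E); last exact: ltry.
  apply: lime_le; first by apply: is_cvg_nneseries => n _ _; exact: measure_ge0.
  near=> n; apply: (@le_trans _ _ (\sum_(0 <= i < n) (K * q ^+ i)%:E)%E).
    by apply: lee_sum => i _; exact: Bq.
  rewrite sumEFin lee_fin -mulr_sumr ler_wpM2l//.
  have q1' : 0 < 1 - q by rewrite subr_gt0.
  rewrite -[leRHS]mul1r ler_pdivlMr// mulrC.
  have := subrX1 q n; rewrite big_mkord => E.
  have : 0 <= q ^+ n by rewrite exprn_ge0// ltW.
  nra.
exists (lim_sup_set B'); split.
- by apply: bigcap_measurable => // k _; apply: bigcup_measurable => j _; exact: mB.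
- by apply: lim_sup_set_cvg0 => // k; exact: mB.
move=> w /= Hw n _; apply: contrapT => Hn; apply: Hw.
exists (n + N)%N => // k /= nk Bk; apply: Hn; exists (k - N)%N.
  by rewrite /= leq_subRL ?(leq_trans (leq_addl _ _) nk)// addnC.
by rewrite /B' subnK// (leq_trans (leq_addl _ _) nk).
Unshelve. all: by end_near. Qed.

Lemma probability_bigsetU_le d (T : measurableType d) (R : realType)
    (P : probability T R) (I : finType) (Q : pred I) (A : I -> set T) (b : R) (N : nat) :
  (forall i, Q i -> measurable (A i)) -> 0 <= b ->
  (forall i, Q i -> (P (A i) <= b%:E)%E) -> (#|Q| <= N)%N ->
  measurable (\big[setU/set0]_(i | Q i) A i) /\
  (P (\big[setU/set0]_(i | Q i) A i) <= (N%:R * b)%:E)%E.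
Proof.
move=> mA b0 Ab QN; split; first exact: bigsetU_measurable.
apply: (@le_trans _ _ (\sum_(i | Q i) b%:E)%E); last first.
  by rewrite sumEFin lee_fin sumr_const -[leLHS]mulr_natl ler_wpM2r// ler_nat.
have [] // : measurable (\big[setU/set0]_(i | Q i) A i) /\
  (P (\big[setU/set0]_(i | Q i) A i) <= \sum_(i | Q i) b%:E)%E.
elim/big_ind2 : _ => [|A1 s1 A2 s2 [m1 H1] [m2 H2]|i Qi].
- by rewrite measure0.
- split; first exact: measurableU.
  by apply: le_trans (measureU2 _ m1 m2) _; exact: leeD.
- by split; [exact: mA|exact: Ab].
Qed.

(** This is where [p / n -> 0] enters: the [2 ^ ((K + 2) p)] directions cost at most
    [expR ((K + 2) p)], and half of the rate [c * n] pays for it as soon as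
    [p / n < c / (2 (K + 2))]. *)
Lemma lattice_union_rate (R : realType) (p : nat -> nat) (K : nat) (c : R) :
  0 < c -> ((p n)%:R / n%:R : R) @[n --> \oo] --> (0 : R) ->
  \forall n \near \oo, (2 ^ (K * p n) * 4 ^ p n)%N%:R * (2 * expR (- (c * n%:R))) <=
    2 * expR (- (c / 2 * n%:R)).
Proof.
move=> c0 p0.
have d0 : 0 < c / (2 * (K + 2)%:R) :> R by rewrite divr_gt0// mulr_gt0// ltr0n addn2.
move/cvgrPdist_lt : p0 => /(_ _ d0) p0.
near=> n.
have n0 : 0 < n%:R :> R by rewrite ltr0n; near: n; exact: nbhs_infty_gt.
have : `|0 - (p n)%:R / n%:R| < c / (2 * (K + 2)%:R) by near: n.
rewrite sub0r normrN ger0_norm ?divr_ge0 ?ler0n//.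
rewrite ltr_pdivrMr// => pn.
have -> : (2 ^ (K * p n) * 4 ^ p n)%N = (2 ^ ((K + 2) * p n))%N.
  by rewrite mulnDl expnD (expnM 2 2).
rewrite mulrCA ler_wpM2l// natrX.
have H2 : (2 : R) <= expR 1 by have := expR_ge1Dx (1 : R).
apply: (@le_trans _ _ (expR 1 ^+ ((K + 2) * p n) * expR (- (c * n%:R)))).
  by rewrite ler_wpM2r ?expR_ge0// lerXn2r// nnegrE// expR_ge0.
rewrite -expRM_natr mul1r -expRD ler_expR natrM.
have K2 : 0 < (K + 2)%:R :> R by rewrite ltr0n addn2.
have : (K + 2)%:R * (p n)%:R <= (K + 2)%:R * (c / (2 * (K + 2)%:R) * n%:R).
  by rewrite ler_wpM2l// ltW.
rewrite [X in _ <= X -> _](_ : _ = c / 2 * n%:R); last by field; rewrite gt_eqF.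
by move=> ?; lra.
Unshelve. all: by end_near. Qed.

(** * Almost sure bounds on the noise *)

Section noise.
Context d (T : measurableType d) (R : realType) (P : probability T R).
Variables (p : nat -> nat) (G : forall n : nat, 'I_(p n) -> 'I_n -> {RV P >-> R}).
Arguments G : clear implicits.
Hypothesis p_ratio : ((p n)%:R / n%:R : R) @[n --> \oo] --> (0 : R).
Hypothesis G_normal : forall n i j (B : set R), measurable B ->
  distribution P (G n i j) B = normal_prob 0 (Num.sqrt n%:R^-1) B.
Hypothesis G_independent : forall n, independent P (fun ij : 'I_(p n) * 'I_n =>
  sigma_rv (fun _ : unit => G n ij.1 ij.2 : T -> R)).

Definition noise_mx (n : nat) (w : T) : 'M[R]_(p n, n) :=
  \matrix_(i < p n, j < n) G n i j w.

Let lattice L n := {ffun 'I_(p n) -> bool * 'I_(L * p n).+1}.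

(** The origin is left out because the tail bounds concern unit vectors; at the origin the seminorm
    bounds are immediate. *)
Let nonzero_lattice L n : pred (lattice L n) := fun m =>
  (\sum_i (val (m i).2) ^ 2 <= L ^ 2 * p n)%N && (lattice_vec R m != 0).

Let card_nonzero_lattice L n :
  (#|@nonzero_lattice L n| <= 2 ^ (L ^ 2 * p n) * 4 ^ p n)%N.
Proof.
apply: leq_trans (lattice_card (p n) (L * p n).+1 (L ^ 2 * p n)).
by apply: subset_leq_card; apply/fintype.subsetP => m; rewrite !inE => /andP[].
Qed.

Let direction L n (m : lattice L n) : 'cV[R]_(p n) :=
  (enorm (lattice_vec R m))^-1 *: lattice_vec R m.

Let lattice_norm_gt0 L n (m : lattice L n) :
  nonzero_lattice m -> 0 < enorm (lattice_vec R m).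
Proof.
by move=> /andP[_ m0]; rewrite sqrtr_gt0 lt_neqAle inner_ge0 eq_sym inner_eq0 m0.
Qed.

Let direction_unit L n (m : lattice L n) :
  nonzero_lattice m -> \sum_i direction m i 0 ^+ 2 = 1.
Proof.
move=> /lattice_norm_gt0 m0.
transitivity (inner (direction m) (direction m)).
  by apply: eq_bigr => i _; rewrite expr2.
rewrite innerZl innerZr -sqr_enorm mulrA -expr2 -exprMn mulVf ?gt_eqF//.
by rewrite expr1n.
Qed.

Let lattice_vecE L n (m : lattice L n) :
  nonzero_lattice m -> lattice_vec R m = enorm (lattice_vec R m) *: direction m.
Proof.
by move=> /lattice_norm_gt0 m0; rewrite scalerA mulfV ?gt_eqF// scale1r.
Qed.

Let sqr_enorm_noise n w (x : 'cV[R]_(p n)) :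
  enorm ((noise_mx n w)^T *m x) ^+ 2 = \sum_j (\sum_i x i 0 * G n i j w) ^+ 2.
Proof.
rewrite sqr_enorm; apply: eq_bigr => j _; rewrite -expr2 mxE; congr (_ ^+ 2).
by apply: eq_bigr => i _; rewrite !mxE mulrC.
Qed.

Let measurable_sqr_noise n (x : 'I_(p n) -> R) (e : R) :
  measurable [set w | e <= `|\sum_j (\sum_i x i * G n i j w) ^+ 2 - 1|].
Proof.
apply: measurable_ge; apply: measurableT_comp => //; apply: measurable_funB => //.
apply: measurable_sum => j; apply: measurable_funX; apply: measurable_sum => i.
exact: measurable_funM.
Qed.

Lemma noise_norm (u : forall n, 'cV[R]_(p n)) (e : R) :
  (forall n, inner (u n) (u n) = 1) -> 0 < e ->
  {ae P, forall w, \forall n \near \oo,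
    `|enorm ((noise_mx n w)^T *m u n) ^+ 2 - 1| < e}.
Proof.
move=> u1 e0.
pose B n := [set w | e <= `|\sum_j (\sum_i u n i 0 * G n i j w) ^+ 2 - 1|].
have mB n : measurable (B n) by exact: measurable_sqr_noise.
have PB : \forall n \near \oo,
    (P (B n) <= (2 * expR (- (gaussian_rate e * n%:R)))%:E)%E.
  near=> n; apply: gaussian_matrix_norm_tail => //.
  - by near: n; exact: nbhs_infty_gt.
  - exact: G_normal.
  - rewrite -(u1 n); by apply: eq_bigr => i _; rewrite expr2.
have := borel_cantelli_expR (gaussian_rate_gt0 e0) mB PB.
apply: filterS => w; apply: filterS => n /negP.
by rewrite -ltNge sqr_enorm_noise.
Unshelve. all: by end_near. Qed.

Lemma noise_opnorm (e : R) : 0 < e ->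
  {ae P, forall w, \forall n \near \oo, forall x : 'cV[R]_(p n),
    enorm ((noise_mx n w)^T *m x) <= (1 + e) * enorm x}.
Proof.
(* With this [h], [(1 + h)^2 <= 1 + 3 h <= 1 + e]: one factor is the bound on the directions, the
   other the loss [L / (L - 1)] of the lattice. *)
move=> e0; pose h := Num.min 1 (e / 3).
have h0 : 0 < h by rewrite lt_min ltr01 divr_gt0.
have h1 : h <= 1 by rewrite ge_min lexx.
have he : h <= e / 3 by rewrite ge_min lexx orbT.
(* Then [L - 1 > 1 / h], whence [L / (L - 1) <= 1 + h]. *)
pose L := (Num.truncn h^-1).+2.
have LR : h^-1 < L%:R - 1 by rewrite -natr1 addrK truncnS_gt.
have L1 : (1 < L)%N by [].
pose Bad n (m : lattice L n) :=
  [set w | h <= `|\sum_j (\sum_i direction m i 0 * G n i j w) ^+ 2 - 1|].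
pose B n := \big[setU/set0]_(m | @nonzero_lattice L n m) Bad n m.
pose b n : R := 2 * expR (- (gaussian_rate h * n%:R)).
have b0 n : 0 <= b n by rewrite mulr_ge0// expR_ge0.
have mBad n m : measurable (Bad n m) by exact: measurable_sqr_noise.
have mB n : measurable (B n) by exact: bigsetU_measurable.
have c0 := gaussian_rate_gt0 h0.
have rate := lattice_union_rate (L ^ 2) c0 p_ratio.
have PB : \forall n \near \oo,
    (P (B n) <= (2 * expR (- (gaussian_rate h / 2 * n%:R)))%:E)%E.
  near=> n.
  have n0 : (0 < n)%N by near: n; exact: nbhs_infty_gt.
  have [|_ H] := @probability_bigsetU_le _ _ _ P _ (@nonzero_lattice L n) (Bad n) (b n) _
    (fun m _ => mBad n m) (b0 n) _ (card_nonzero_lattice L n).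
    move=> m Qm; apply: gaussian_matrix_norm_tail => //; first exact: G_normal.
    exact: direction_unit.
  by apply: le_trans H _; rewrite lee_fin; near: n.
have c20 : 0 < gaussian_rate h / 2 by rewrite divr_gt0.
have := borel_cantelli_expR c20 mB PB.
apply: filterS => w; apply: filterS => n nB x.
have k0 : 0 <= 1 + h by rewrite addr_ge0// ltW.
pose N (y : 'cV[R]_(p n)) := enorm ((noise_mx n w)^T *m y).
have ND y1 y2 : N (y1 + y2) <= N y1 + N y2 by rewrite /N mulmxDr; exact: enormD.
have NZ a y : 0 <= a -> N (a *: y) = a * N y.
  by move=> a0; rewrite /N -scalemxAr enormZ ger0_norm.
have := @seminorm_lattice_bound _ _ L N (fnorm (noise_mx n w)) (1 + h) L1 k0
  (fun y => enorm_ge0 _) ND NZ (fun y => enorm_trmx_mul_le _ _).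
move=> /(_ _ x) H; apply: le_trans (H _) _.
  move=> m mK; have [m0|m0] := eqVneq (lattice_vec R m) 0.
    by rewrite m0 -(scale0r 0) NZ// mul0r enormZ normr0 mul0r mulr0.
  have Qm : nonzero_lattice m by rewrite /nonzero_lattice mK.
  rewrite [X in N X](lattice_vecE Qm) NZ ?enorm_ge0// mulrC ler_wpM2r ?enorm_ge0//.
  rewrite -ler_sqr ?nnegrE ?enorm_ge0// sqr_enorm_noise.
  have nBad : ~ Bad n m w.
    by apply: contra_not nB => Bm; rewrite /B (bigD1 m)//=; left.
  move: nBad => /negP; rewrite -ltNge ltr_norml => /andP[_ H1].
  by have := sqr_ge0 h; rewrite sqrrD; lra.
rewrite ler_wpM2r ?enorm_ge0//.
have hL : L%:R / (L%:R - 1) <= 1 + h.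
  have L10 : 0 < L%:R - 1 :> R by rewrite (lt_trans _ LR)// invr_gt0.
  rewrite ler_pdivrMr//.
  have : h * h^-1 < h * (L%:R - 1) by rewrite ltr_pM2l.
  by rewrite mulfV ?gt_eqF//; lra.
apply: le_trans (ler_wpM2l k0 hL) _.
have : h * h <= h * 1 by rewrite ler_wpM2l// ltW.
by lra.
Unshelve. all: by end_near. Qed.

(** The lattice with [L = 2] suffices: a lost factor 2 is harmless for a quantity tending to 0, so
    the directions are tested at [e / 2]. The condition on [v] inside [Bad] is discharged at the end
    by its eventual validity. *)
Lemma noise_cross (I : nat -> Type) (X : forall n, I n -> T -> R)
    (v : forall n, 'I_n -> T -> R) (e : R) :
  (forall n i, measurable_fun setT (X n i)) ->
  (forall n, independent2 P
    (sigma_rv (fun ij : 'I_(p n) * 'I_n => G n ij.1 ij.2 : T -> R))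
    (sigma_rv (X n))) ->
  (forall n j, measurable_fun setT
    (v n j : g_sigma_algebraType (sigma_gen (X n)) -> R)) ->
  {ae P, forall w, \forall n \near \oo, \sum_j v n j w ^+ 2 <= 2} ->
  0 < e ->
  {ae P, forall w, \forall n \near \oo, forall x : 'cV[R]_(p n),
    `|inner x (noise_mx n w *m \col_j v n j w)| <= e * enorm x}.
Proof.
move=> mX indX mv v2 e0.
pose h := e / 2; have h0 : 0 < h by rewrite divr_gt0.
have mvT n j : measurable_fun setT (v n j).
  move=> _ B mB; rewrite setTI.
  by apply: (sigma_rv_measurable (mX n)); apply: sigma_rv_preimage mB; exact: mv.
pose Bad n (m : lattice 2 n) := [set w | \sum_j v n j w ^+ 2 <= 2 /\
  h <= `|\sum_i \sum_j direction m i 0 * v n j w * G n i j w|].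
pose B n := \big[setU/set0]_(m | @nonzero_lattice 2 n m) Bad n m.
pose c := h ^+ 2 / 4; have c0 : 0 < c by rewrite divr_gt0// exprn_gt0.
pose b n : R := 2 * expR (- (c * n%:R)).
have b0 n : 0 <= b n by rewrite mulr_ge0// expR_ge0.
have mBad n m : measurable (Bad n m).
  apply: measurableI.
    rewrite [X in measurable X](_ : _ = [set w | - 2 <= - \sum_j v n j w ^+ 2]).
      apply: measurable_ge; apply: measurableT_comp => //.
      by apply: measurable_sum => j; exact: measurable_funX.
    by apply/funext => w; rewrite /= lerN2.
  apply: measurable_ge; apply: measurableT_comp => //.
  apply: measurable_sum => i; apply: measurable_sum => j.
  by apply: measurable_funM => //; exact: measurable_funM.
have mB n : measurable (B n) by exact: bigsetU_measurable.
have rate := lattice_union_rate (2 ^ 2) c0 p_ratio.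
have PB : \forall n \near \oo, (P (B n) <= (2 * expR (- (c / 2 * n%:R)))%:E)%E.
  near=> n.
  have n0 : (0 < n)%N by near: n; exact: nbhs_infty_gt.
  have [|_ H] := @probability_bigsetU_le _ _ _ P _ (@nonzero_lattice 2 n) (Bad n) (b n) _
    (fun m _ => mBad n m) (b0 n) _ (card_nonzero_lattice 2 n).
    move=> m Qm; apply: (cross_term_tail n0 _ _ (mX n) (indX n) (mv n)) => //.
      exact: G_normal.
    exact: direction_unit.
  by apply: le_trans H _; rewrite lee_fin; near: n.
have c20 : 0 < c / 2 by rewrite divr_gt0.
have := borel_cantelli_expR c20 mB PB.
apply: filterS2 v2 => w; apply: filterS2 => n vn nB x.
pose N (y : 'cV[R]_(p n)) := `|inner y (noise_mx n w *m \col_j v n j w)|.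
have ND y1 y2 : N (y1 + y2) <= N y1 + N y2 by rewrite /N innerDl; exact: ler_normD.
have NZ a y : 0 <= a -> N (a *: y) = a * N y.
  by move=> a0; rewrite /N innerZl normrM ger0_norm.
have NC y : N y <= enorm (noise_mx n w *m \col_j v n j w) * enorm y.
  by rewrite mulrC; exact: cauchy_schwarz.
have := @seminorm_lattice_bound _ _ 2 N _ h isT (ltW h0) (fun y => normr_ge0 _) ND NZ NC.
rewrite (_ : 2 / (2 - 1) = 2 :> R); last by field; lra.
rewrite (_ : h * 2 = e); last by rewrite /h; field.
apply => m mK; have [m0|m0] := eqVneq (lattice_vec R m) 0.
  by rewrite m0 -(scale0r 0) NZ// mul0r enormZ normr0 mul0r mulr0.
have Qm : nonzero_lattice m by rewrite /nonzero_lattice mK.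
rewrite [X in N X](lattice_vecE Qm) NZ ?enorm_ge0// mulrC ler_wpM2r ?enorm_ge0//.
have -> : N (direction m) = `|\sum_i \sum_j direction m i 0 * v n j w * G n i j w|.
  congr (`|_|); apply: eq_bigr => i _; rewrite [X in _ * X]mxE mulr_sumr.
  by apply: eq_bigr => j _; rewrite !mxE; ring.
have nBad : ~ Bad n m w.
  by apply: contra_not nB => Bm; rewrite /B (bigD1 m)//=; left.
by rewrite leNgt; apply/negP => /ltW H; apply: nBad.
Unshelve. all: by end_near. Qed.

End noise.

(** * The Gram form of signal plus noise *)

Lemma near_isometry_inner (R : realType) (m n : nat) (A : 'M[R]_(m, n))
    (y : 'cV[R]_m) (a e : R) :
  0 < a -> 0 < e -> e <= 1 -> 16 * e <= a ^+ 2 -> 3 * e <= a ->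
  (forall x, enorm (A^T *m x) <= (1 + e) * enorm x) ->
  inner y y = 1 -> `|enorm (A^T *m y) ^+ 2 - 1| < e ->
  forall x, `|inner (A^T *m x) (A^T *m y) - inner x y| <= 2 * a * enorm x.
Proof.
move=> a0 e0 e1 ea2 ea HA y1 Hy x.
pose M := (1 + e) ^+ 2.
have M1 : M - 1 <= 3 * e by rewrite /M; nra.
have M1_ge0 : 0 <= M - 1 by rewrite /M; nra.
have HM z : inner (A^T *m z) (A^T *m z) <= M * inner z z.
  by rewrite -!sqr_enorm -exprMn ler_sqr ?nnegrE ?mulr_ge0 ?enorm_ge0//; lra.
(* The form [M <x, y> - <A^T x, A^T y>] is positive semidefinite and nearly
   vanishes at [y], so its Cauchy-Schwarz inequality makes it small on [(x, y)]. *)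
pose b z1 z2 := M * inner z1 z2 - inner (A^T *m z1) (A^T *m z2).
have bcs : b x y ^+ 2 <= b x x * b y y.
  apply: psd_cauchy_schwarz => s t.
  have := HM (s *: x + t *: y).
  rewrite mulmxDr -!scalemxAr !(innerDl, innerDr, innerZl, innerZr).
  rewrite (innerC y x) (innerC (A^T *m y) (A^T *m x)) /b => H.
  move: H; rewrite -subr_ge0 => /le_trans; apply.
  by rewrite le_eqVlt; apply/orP; left; apply/eqP; ring.
have bxx : 0 <= b x x <= M * inner x x.
  by rewrite /b subr_ge0 HM/= gerBl inner_ge0.
have byy : 0 <= b y y <= 4 * e.
  rewrite /b subr_ge0 HM/= y1 mulr1 -sqr_enorm.
  by move: Hy; rewrite ltr_norml => /andP[? _]; lra.
(* Here [b x x <= 4 |x|^2] and [b y y <= 4 e], hence the condition [16 * e <= a ^ 2]. The condition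
   [3 * e <= a] serves the remaining term [(M - 1) <x, y>]. *)
have bxy : `|b x y| <= a * enorm x.
  rewrite -ler_sqr ?nnegrE ?mulr_ge0 ?enorm_ge0 ?(ltW a0)// real_normK ?num_real//.
  apply: le_trans bcs _; rewrite exprMn sqr_enorm.
  case/andP: bxx => bxx0 bxx; case/andP: byy => byy0 byy.
  apply: (@le_trans _ _ (M * inner x x * (4 * e))); first exact: ler_pM.
  have M4 : M <= 4 by rewrite /M; nra.
  have xx0 := inner_ge0 x.
  have : M * (inner x x * (4 * e)) <= 4 * (inner x x * (4 * e)).
    by rewrite ler_wpM2r// !mulr_ge0// ltW.
  have : inner x x * (16 * e) <= inner x x * a ^+ 2 by rewrite ler_wpM2l.
  by nra.
have xy := cauchy_schwarz x y.
rewrite [enorm y]/enorm y1 sqrtr1 mulr1 in xy.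
have -> : inner (A^T *m x) (A^T *m y) - inner x y = (M - 1) * inner x y - b x y.
  by rewrite /b; ring.
apply: le_trans (ler_normB _ _) _; rewrite normrM (ger0_norm M1_ge0).
have : (M - 1) * `|inner x y| <= a * enorm x.
  by apply: ler_pM => //; lra.
by lra.
Qed.

Lemma sum_rank1_trmx_mul (R : realType) (m n : nat) (I : finType) (c : I -> R)
    (u : I -> 'cV[R]_m) (v : I -> 'cV[R]_n) (x : 'cV[R]_m) :
  (\sum_k c k *: (u k *m (v k)^T))^T *m x = \sum_k (c k * inner (u k) x) *: v k.
Proof.
rewrite linear_sum mulmx_suml; apply: eq_bigr => k _.
rewrite linearZ /= trmx_mul trmxK -scalemxAl -mulmxA.
rewrite (_ : (u k)^T *m x = (inner (u k) x)%:M); last first.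
  apply/matrixP => i j; rewrite !ord1 !mxE /= mulr1n.
  by apply: eq_bigr => h _; rewrite mxE.
by rewrite mul_mx_scalar scalerA.
Qed.

Section signal_plus_noise.
Variables (R : realType) (m n r : nat) (t : 'I_r -> R) (u : 'I_r -> 'cV[R]_m).
Variables (zeta : 'I_r -> 'cV[R]_n) (N : 'M[R]_(m, n)).
Hypothesis t_pos : forall k, 0 < t k.
Hypothesis u_orth : forall k l, inner (u k) (u l) = (k == l)%:R.

Definition signal_plus_noise : 'M[R]_(m, n) :=
  \sum_k t k *: (u k *m (zeta k)^T) + N.

Let Y := signal_plus_noise.

Lemma signal_plus_noise_trmx_mul x :
  Y^T *m x = \sum_k (t k * inner (u k) x) *: zeta k + N^T *m x.
Proof.
by rewrite /Y /signal_plus_noise linearD mulmxDl sum_rank1_trmx_mul.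
Qed.

(** Expanding both factors leaves the Gram error of the [zeta k], two cross terms and the error of
    the noise form. With [S] the sum of the [t k], the first three are at most [S^2 e], [S e] and
    [S e] times [enorm x], together at most [(S + 1)^2 e] times it. *)
Lemma signal_plus_noise_form (l : 'I_r) (e a : R) : 0 <= e ->
  (forall k x, `|inner x (N *m zeta k)| <= e * enorm x) ->
  (forall k l, `|inner (zeta k) (zeta l) - (k == l)%:R| <= e) ->
  (forall x, `|inner (N^T *m x) (N^T *m u l) - inner x (u l)| <= a * enorm x) ->
  forall x, `|inner (Y^T *m x) (Y^T *m u l) - (t l ^+ 2 + 1) * inner x (u l)| <=
    ((\sum_k t k + 1) ^+ 2 * e + a) * enorm x.
Proof.
move=> e0 Hc Hz Ha x.
have u1 k : enorm (u k) = 1 by rewrite /enorm u_orth eqxx sqrtr1.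
have ux k : `|inner (u k) x| <= enorm x.
  by have := cauchy_schwarz (u k) x; rewrite u1 mul1r.
have t0 k : 0 <= t k by exact: ltW.
have Yul : Y^T *m u l = t l *: zeta l + N^T *m u l.
  rewrite signal_plus_noise_trmx_mul; congr (_ + _).
  rewrite (bigD1 l)//= u_orth eqxx mulr1 big1 ?addr0// => k kl.
  by rewrite u_orth (negbTE kl) mulr0 scale0r.
have -> : inner (Y^T *m x) (Y^T *m u l) - (t l ^+ 2 + 1) * inner x (u l) =
    t l * (\sum_k t k * inner (u k) x * (inner (zeta k) (zeta l) - (k == l)%:R)) +
    t l * inner x (N *m zeta l) + \sum_k t k * inner (u k) x * inner (u l) (N *m zeta k) +
    (inner (N^T *m x) (N^T *m u l) - inner x (u l)).
  rewrite Yul signal_plus_noise_trmx_mul innerDr innerZr !innerDl !inner_suml.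
  rewrite inner_trmx_mul.
  have -> : \sum_k t k * inner (u k) x * (inner (zeta k) (zeta l) - (k == l)%:R) =
      \sum_k inner ((t k * inner (u k) x) *: zeta k) (zeta l) - t l * inner x (u l).
    under eq_bigr do rewrite mulrBr.
    rewrite sumrB; congr (_ - _); first by apply: eq_bigr => k _; rewrite innerZl.
    rewrite (bigD1 l)//= eqxx mulr1 big1 ?addr0 1?innerC// => k kl.
    by rewrite (negbTE kl) mulr0.
  have -> : \sum_k t k * inner (u k) x * inner (u l) (N *m zeta k) =
      \sum_k inner ((t k * inner (u k) x) *: zeta k) (N^T *m u l).
    by apply: eq_bigr => k _; rewrite innerZl (innerC (zeta k)) inner_trmx_mul.
  by ring.
set S := \sum_k t k.
have S0 : 0 <= S by apply: sumr_ge0.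
have tS : t l <= S by rewrite /S (bigD1 l)//= lerDl sumr_ge0.
have term k c : `|c| <= e -> `|t k * inner (u k) x * c| <= t k * (enorm x * e).
  move=> ce; rewrite !normrM (ger0_norm (t0 k)) -mulrA ler_wpM2l//.
  by rewrite ler_pM// normr_ge0.
have B1 : `|\sum_k t k * inner (u k) x * (inner (zeta k) (zeta l) - (k == l)%:R)| <=
    S * (enorm x * e).
  apply: le_trans (ler_norm_sum _ _ _) _; rewrite mulr_suml.
  by apply: ler_sum => k _; exact: term.
have B2 : `|\sum_k t k * inner (u k) x * inner (u l) (N *m zeta k)| <= S * (enorm x * e).
  apply: le_trans (ler_norm_sum _ _ _) _; rewrite mulr_suml.
  by apply: ler_sum => k _; apply: term; have := Hc k (u l); rewrite u1 mulr1.
have B3 := Hc l x; have B4 := Ha x.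
apply: le_trans (ler_normD _ _) _; rewrite mulrDl; apply: lerD B4.
apply: le_trans (ler_normD _ _) _.
apply: le_trans (lerD (ler_normD _ _) (lexx _)) _.
rewrite !normrM (ger0_norm (t0 l)).
have xe0 : 0 <= enorm x * e by rewrite mulr_ge0 ?enorm_ge0.
have C1 : t l * `|\sum_k t k * inner (u k) x * (inner (zeta k) (zeta l) - (k == l)%:R)| <=
    S * (S * (enorm x * e)) by apply: ler_pM.
have C2 : t l * `|inner x (N *m zeta l)| <= S * (e * enorm x) by apply: ler_pM.
by nra.
Qed.

Lemma signal_plus_noise_orth x : (forall l, inner (u l) x = 0) ->
  Y^T *m x = N^T *m x.
Proof.
move=> ux; rewrite signal_plus_noise_trmx_mul big1 ?add0r// => k _.
by rewrite ux mulr0 scale0r.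
Qed.

End signal_plus_noise.

(** * Orthonormal families and singular value decompositions *)

Section orthonormal_family.
Variables (R : realType) (m : nat) (I : finType) (f : I -> 'cV[R]_m).
Hypothesis f_orth : forall i j, inner (f i) (f j) = (i == j)%:R.

Let residual (x : 'cV[R]_m) := x - \sum_i inner (f i) x *: f i.

Lemma inner_orth_sum i (c : I -> R) : inner (f i) (\sum_j c j *: f j) = c i.
Proof.
rewrite inner_sumr (bigD1 i)//= innerZr f_orth eqxx mulr1 big1 ?addr0// => j ji.
by rewrite innerZr f_orth eq_sym (negbTE ji) mulr0.
Qed.

Lemma orth_residual i x : inner (f i) (residual x) = 0.
Proof. by rewrite innerDr innerNr inner_orth_sum subrr. Qed.

Lemma inner_residual x : inner (residual x) x = inner (residual x) (residual x).
Proof.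
rewrite [X in _ = inner _ X]/residual innerDr innerNr inner_sumr big1 ?subr0// => i _.
by rewrite innerZr (innerC (residual x)) orth_residual mulr0.
Qed.

Lemma sqr_residual x :
  inner (residual x) (residual x) = inner x x - \sum_i inner (f i) x ^+ 2.
Proof.
rewrite -inner_residual innerDl innerNl inner_suml; congr (_ - _).
by apply: eq_bigr => i _; rewrite innerZl.
Qed.

Lemma bessel x : \sum_i inner (f i) x ^+ 2 <= inner x x.
Proof. by rewrite -subr_ge0 -sqr_residual inner_ge0. Qed.

Lemma sqr_orth_sum (c : I -> R) :
  inner (\sum_i c i *: f i) (\sum_i c i *: f i) = \sum_i c i ^+ 2.
Proof.
rewrite inner_suml; apply: eq_bigr => i _.
by rewrite innerZl inner_orth_sum expr2.
Qed.

End orthonormal_family.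

Section svd.
Variables (R : realType) (m n : nat) (A : 'M[R]_(m, n)).
Variables (s : nat -> R) (u : nat -> 'cV[R]_m) (v : nat -> 'cV[R]_n).
Hypothesis A_svd : is_svd A s u v.
Let q := minn m n.

Let u_orth (a b : 'I_q) : inner (u a) (u b) = (a == b)%:R.
Proof. by case: A_svd => H _ _ _ _; rewrite H. Qed.

Let v_orth (a b : 'I_q) : inner (v a) (v b) = (a == b)%:R.
Proof. by case: A_svd => _ H _ _ _; rewrite H. Qed.

Let trmx_mulE x : A^T *m x = \sum_(b < q) (s b * inner (u b) x) *: v b.
Proof. by case: A_svd => _ _ _ _ ->; rewrite sum_rank1_trmx_mul. Qed.

Lemma svd_right (a : 'I_q) x : inner (v a) (A^T *m x) = s a * inner (u a) x.
Proof. by rewrite trmx_mulE (inner_orth_sum v_orth). Qed.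

Lemma svd_trmx_mul_left (a : 'I_q) : A^T *m u a = s a *: v a.
Proof.
rewrite trmx_mulE (bigD1 a)//= u_orth eqxx mulr1 big1 ?addr0// => b ba.
by rewrite u_orth (negbTE ba) mulr0 scale0r.
Qed.

(** The weak form of [A A^T u_a = s_a^2 u_a]. *)
Lemma svd_form (a : 'I_q) x :
  inner (A^T *m u a) (A^T *m x) = s a ^+ 2 * inner (u a) x.
Proof. by rewrite svd_trmx_mul_left innerZl svd_right mulrA -expr2. Qed.

Lemma svd_sqr x :
  inner (A^T *m x) (A^T *m x) = \sum_(b < q) s b ^+ 2 * inner (u b) x ^+ 2.
Proof.
rewrite trmx_mulE (sqr_orth_sum v_orth).
by apply: eq_bigr => b _; rewrite exprMn.
Qed.

Lemma svd_bessel_left x : \sum_(b < q) inner (u b) x ^+ 2 <= inner x x.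
Proof. exact: (bessel u_orth). Qed.

(* The singular values are nonincreasing, so beyond the first [k] of them the sum
   is at most [s k ^+ 2]. *)
Lemma svd_sqr_le (k : 'I_q) x : inner x x = 1 ->
  inner (A^T *m x) (A^T *m x) <=
    \sum_(b < q | (b < k)%N) s b ^+ 2 * inner (u b) x ^+ 2 + s k ^+ 2.
Proof.
move=> x1; rewrite svd_sqr (bigID (fun b : 'I_q => (b < k)%N)) /= lerD2l.
case: A_svd => _ _ s0 s_le _.
apply: (@le_trans _ _ (\sum_(b < q | ~~ (b < k)%N) s k ^+ 2 * inner (u b) x ^+ 2)).
  apply: ler_sum => b; rewrite -leqNgt => kb; rewrite ler_wpM2r ?sqr_ge0//.
  by rewrite ler_sqr ?nnegrE ?s0// s_le.
rewrite -mulr_sumr -[leRHS]mulr1 ler_wpM2l ?sqr_ge0// -x1.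
apply: le_trans (svd_bessel_left x).
rewrite [leRHS](bigID (fun b : 'I_q => (b < k)%N)) /= lerDr.
by apply: sumr_ge0 => b _; exact: sqr_ge0.
Qed.

End svd.

(** * Exact singular vectors against approximate ones *)

Section perturbation.
Variables (R : realType) (m n r : nat) (A : 'M[R]_(m, n)).
Variables (s : nat -> R) (uh : nat -> 'cV[R]_m) (vh : nat -> 'cV[R]_n).
Hypothesis A_svd : is_svd A s uh vh.
Variables (u : 'I_r -> 'cV[R]_m) (lam : 'I_r -> R) (d : R).
Hypothesis u_orth : forall k l, inner (u k) (u l) = (k == l)%:R.
Hypothesis d_ge0 : 0 <= d.
Hypothesis A_u : forall l x,
  `|inner (A^T *m x) (A^T *m u l) - lam l * inner x (u l)| <= d * enorm x.
Hypothesis A_orth : forall x, (forall l, inner (u l) x = 0) ->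
  inner (A^T *m x) (A^T *m x) <= (1 + d) * inner x x.
Let q := minn m n.

Let uh1 (a : 'I_q) : inner (uh a) (uh a) = 1.
Proof. by case: A_svd => H _ _ _ _; rewrite H ?eqxx. Qed.

(** The approximate eigenvector [u l] of [A A^T] is tested against the exact one [uh a]: they are
    nearly orthogonal unless their eigenvalues are close. *)
Lemma perturb_gap (a : 'I_q) l : `|inner (uh a) (u l)| * `|s a ^+ 2 - lam l| <= d.
Proof.
have := A_u l (uh a); rewrite (svd_form A_svd) -mulrBl normrM mulrC.
by rewrite /enorm uh1 sqrtr1 mulr1.
Qed.

(** Let [w] be the part of [uh a] orthogonal to all [u l]. In [s_a^2 |w|^2 = <A^T w, A^T uh_a>],
    each direction [u l] contributes at most [d] and the rest is [|A^T w|^2 <= (1 + d) |w|^2]. So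
    [w] is small once [s_a^2] exceeds 1 by a fixed amount. *)
Lemma perturb_residual (a : 'I_q) :
  (s a ^+ 2 - (1 + d)) * (1 - \sum_l inner (uh a) (u l) ^+ 2) <= r%:R * d.
Proof.
have [w wE] : {w | w = uh a - \sum_l inner (u l) (uh a) *: u l} by eexists.
have ww : inner w w = 1 - \sum_l inner (uh a) (u l) ^+ 2.
  rewrite wE (sqr_residual u_orth) uh1; congr (_ - _).
  by apply: eq_bigr => l _; rewrite innerC.
have uw l : inner (u l) w = 0 by rewrite wE orth_residual.
have w1 : enorm w <= 1.
  rewrite -(@ler_pXn2r _ 2)// ?nnegrE ?enorm_ge0// expr1n sqr_enorm ww gerBl.
  by apply: sumr_ge0 => l _; exact: sqr_ge0.
have Ew : s a ^+ 2 * inner w w =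
    \sum_l inner (u l) (uh a) * inner (A^T *m w) (A^T *m u l) + inner (A^T *m w) (A^T *m w).
  transitivity (inner (A^T *m w) (A^T *m uh a)).
    by rewrite (innerC (A^T *m w)) (svd_form A_svd) (innerC (uh a)) wE (inner_residual u_orth).
  rewrite [in X in inner _ (_ *m X) = _](_ : uh a = (\sum_l inner (u l) (uh a) *: u l) + w).
    rewrite mulmxDr innerDr mulmx_sumr inner_sumr; congr (_ + _).
    by apply: eq_bigr => l _; rewrite -scalemxAr innerZr.
  by rewrite wE addrC subrK.
have Hsum : \sum_l inner (u l) (uh a) * inner (A^T *m w) (A^T *m u l) <= r%:R * d.
  rewrite mulr_natl -[r in leRHS]card_ord -sumr_const; apply: ler_sum => l _.
  apply: le_trans (ler_norm _) _; rewrite normrM -[leRHS]mul1r.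
  apply: ler_pM => //.
    have := cauchy_schwarz (u l) (uh a).
    by rewrite {1}/enorm u_orth eqxx sqrtr1 mul1r /enorm uh1 sqrtr1.
  have := A_u l w; rewrite (innerC w) uw mulr0 subr0.
  by move=> /le_trans; apply; rewrite -[leRHS]mulr1 ler_wpM2l.
have := A_orth uw; rewrite -ww mulrBl Ew.
by lra.
Qed.

(** The Rayleigh quotient of [A A^T] at [u l], as in the Courant-Fischer principle: if [u l] has
    little weight on the first [k] singular vectors, then [s_k^2] cannot be much below [lam l]. *)
Lemma perturb_lower (k : 'I_q) (l : 'I_r) :
  lam l - d <= \sum_(b < q | (b < k)%N) s b ^+ 2 * inner (uh b) (u l) ^+ 2 + s k ^+ 2.
Proof.
apply: le_trans (svd_sqr_le A_svd k _); last by rewrite u_orth eqxx.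
have := A_u l (u l); rewrite u_orth eqxx mulr1 /enorm u_orth eqxx sqrtr1 mulr1.
by rewrite ler_norml => /andP[]; lra.
Qed.

End perturbation.

(** * Induction over the spikes *)

(** Here [al a l] stands for [<uhat_a, u_l>] and [mu a] for [s_a^2]; the row and column bounds are
    Bessel's inequality. The lower bound on [mu k] must come first: it separates [mu k] from 1 and
    from the later [lam l], which makes the residual and gap estimates effective. The upper bound
    comes last, from the gap estimate at [k] itself. *)
Lemma eigen_step (R : realType) (q r : nat) (al : nat -> 'I_r -> R) (mu : nat -> R)
    (lam : 'I_r -> R) (k : 'I_r) (d g L : R) :
  (r <= q)%N -> 0 < d -> d <= 1 -> 0 < g -> 0 <= L ->
  (forall a, 0 <= mu a) ->
  (forall l, lam l <= L) -> g <= lam k - 1 ->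
  (forall l : 'I_r, (k < l)%N -> g <= lam k - lam l) ->
  (forall l, `|al k l| * `|mu k - lam l| <= d) ->
  (mu k - (1 + d)) * (1 - \sum_l al k l ^+ 2) <= r%:R * d ->
  lam k - d <= \sum_(b < q | (b < k)%N) mu b * al b k ^+ 2 + mu k ->
  (forall a : 'I_q, \sum_l al a l ^+ 2 <= 1) ->
  (forall l, \sum_(b < q) al b l ^+ 2 <= 1) ->
  (forall a : 'I_r, (a < k)%N -> `|mu a - lam a| <= d /\ 1 - al a a ^+ 2 <= d) ->
  d * (2 + r%:R * (L + 1)) <= g / 2 ->
  r%:R * (2 / g + (1 + 4 / g ^+ 2)) * d <= 3 / 4 ->
  1 - al k k ^+ 2 <= r%:R * (2 / g + (1 + 4 / g ^+ 2)) * d /\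
  `|mu k - lam k| <= 2 * d.
Proof.
move=> rq d0 d1 g0 L0 mu0 lamL lamk lamkl gap res low row col IH small1 small2.
have two_terms (I : finType) (f : I -> R) i j : i != j -> \sum_i f i ^+ 2 <= 1 ->
    f i ^+ 2 + f j ^+ 2 <= 1.
  move=> ij; apply: le_trans.
  rewrite (bigD1 i)//= lerD2l (bigD1 j) 1?eq_sym//= lerDl.
  by apply: sumr_ge0 => h _; exact: sqr_ge0.
have rR0 : 0 <= r%:R :> R by exact: ler0n.
(* For [b < k] the induction hypothesis gives [al b b ^ 2 >= 1 - d], so the row bound leaves
   [al b k ^ 2 <= d]; each earlier vector contributes at most [(L + 1) * d]. *)
have mu_low : lam k - d * (1 + r%:R * (L + 1)) <= mu k.
  suff : \sum_(b < q | (b < k)%N) mu b * al b k ^+ 2 <= r%:R * ((L + 1) * d) by lra.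
  rewrite -(big_ord_widen q (fun b => mu b * al b k ^+ 2)); last first.
    by apply: leq_trans rq; exact: ltnW.
  apply: (@le_trans _ _ (\sum_(b < k) (L + 1) * d)).
    apply: ler_sum => b _.
    have br : (b < r)%N by apply: ltn_trans (ltn_ord b) (ltn_ord k).
    have bq : (b < q)%N by exact: leq_trans br rq.
    have [H1 H2] := IH (Ordinal br) (ltn_ord b).
    apply: ler_pM => //; first exact: sqr_ge0.
      move: H1; rewrite ler_norml /= => /andP[_].
      by have := lamL (Ordinal br); lra.
    have bk : Ordinal br != k by rewrite -val_eqE /= neq_ltn ltn_ord.
    by have := two_terms _ _ _ _ bk (row (Ordinal bq)); rewrite /= in H2 *; lra.
  rewrite sumr_const card_ord -[leLHS]mulr_natl ler_wpM2r ?mulr_ge0 ?addr_ge0 ?(ltW d0)//.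
  by rewrite ler_nat ltnW.
have mu_gap : lam k - g / 2 <= mu k - d.
  by apply: le_trans (_ : mu k - d >= lam k - d * (1 + r%:R * (L + 1)) - d); lra.
have res' : 1 - \sum_l al k l ^+ 2 <= r%:R * (2 / g) * d.
  have kq : (k < q)%N by exact: leq_trans (ltn_ord k) rq.
  have S0 : 0 <= 1 - \sum_l al k l ^+ 2 by rewrite subr_ge0 (row (Ordinal kq)).
  have : g / 2 * (1 - \sum_l al k l ^+ 2) <= r%:R * d.
    by apply: le_trans res; rewrite ler_wpM2r//; lra.
  rewrite (_ : r%:R * (2 / g) * d = (r%:R * d) / (g / 2)); last first.
    by field; rewrite gt_eqF.
  by rewrite ler_pdivlMr ?divr_gt0// mulrC.
(* For an earlier [l], [uhat_l] already takes almost all of [u_l] in the column bound. For a later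
   [l], the gap [g / 2] applies, and [d * d <= d]. *)
have off l : l != k -> al k l ^+ 2 <= (1 + 4 / g ^+ 2) * d.
  move=> lk; have g4 : 0 <= 4 / g ^+ 2 * d by rewrite mulr_ge0 ?divr_ge0 ?sqr_ge0 ?(ltW d0).
  have [lk'|kl] := ltnP l k.
    have [_ H] := IH l lk'.
    have lq : (l < q)%N by exact: leq_trans (ltn_ord l) rq.
    have kq : (k < q)%N by exact: leq_trans (ltn_ord k) rq.
    have lkq : Ordinal lq != Ordinal kq by rewrite -val_eqE.
    by have := two_terms _ (fun b : 'I_q => al b l) _ _ lkq (col l) => /=; lra.
  have {}kl : (k < l)%N by rewrite ltn_neqAle kl andbT eq_sym.
  have H1 : g / 2 <= `|mu k - lam l|.
    by apply: le_trans (ler_norm _); have := lamkl l kl; lra.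
  have H2 : `|al k l| * (g / 2) <= d.
    by apply: le_trans (gap l); rewrite ler_wpM2l.
  have {}H2 : `|al k l| <= d / (g / 2) by rewrite ler_pdivlMr// divr_gt0.
  have : `|al k l| ^+ 2 <= (d / (g / 2)) ^+ 2.
    by rewrite ler_sqr ?nnegrE// divr_ge0 ?divr_ge0 ?(ltW d0) ?(ltW g0).
  rewrite real_normK ?num_real// (_ : (d / (g / 2)) ^+ 2 = 4 / g ^+ 2 * (d * d)); last first.
    by field; rewrite gt_eqF.
  have : 4 / g ^+ 2 * (d * d) <= 4 / g ^+ 2 * (d * 1).
    by rewrite ler_wpM2l ?divr_ge0 ?sqr_ge0// ler_wpM2l// ltW.
  by lra.
have diag : 1 - al k k ^+ 2 <= r%:R * (2 / g + (1 + 4 / g ^+ 2)) * d.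
  have : \sum_l al k l ^+ 2 = al k k ^+ 2 + \sum_(l | l != k) al k l ^+ 2 by rewrite (bigD1 k).
  have : \sum_(l | l != k) al k l ^+ 2 <= r%:R * ((1 + 4 / g ^+ 2) * d).
    apply: (@le_trans _ _ (\sum_(l : 'I_r) (1 + 4 / g ^+ 2) * d)).
      rewrite [leLHS]big_mkcond; apply: ler_sum => l _; case: ifP => [|_]; first exact: off.
      by rewrite mulr_ge0 ?addr_ge0 ?divr_ge0 ?sqr_ge0 ?(ltW d0).
    by rewrite sumr_const card_ord -[leLHS]mulr_natl.
  by lra.
split => //.
(* The bound [3 / 4] in [small2] keeps [al k k] at least [1 / 2] in absolute value, so that it can
   be divided out of the gap estimate. *)
have a14 : 4^-1 <= al k k ^+ 2 by lra.
have a12 : 2^-1 <= `|al k k|.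
  rewrite -(@ler_pXn2r _ 2)// ?nnegrE// real_normK ?num_real//.
  by apply: le_trans a14; lra.
have := gap k; have : 2^-1 * `|mu k - lam k| <= `|al k k| * `|mu k - lam k|.
  by rewrite ler_wpM2r.
by lra.
Qed.

Lemma eigen_cvg (R : realType) (r : nat) (q : nat -> nat) (al : nat -> nat -> 'I_r -> R)
    (mu : nat -> nat -> R) (lam : 'I_r -> R) :
  (\forall n \near \oo, (r <= q n)%N) ->
  (forall k, 1 < lam k) -> (forall k l : 'I_r, (k < l)%N -> lam l < lam k) ->
  (forall n a, 0 <= mu n a) ->
  (forall n (a : 'I_(q n)), \sum_l al n a l ^+ 2 <= 1) ->
  (forall n l, \sum_(b < q n) al n b l ^+ 2 <= 1) ->
  (forall d : R, 0 < d -> \forall n \near \oo, forall k : 'I_r,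
    [/\ forall l, `|al n k l| * `|mu n k - lam l| <= d,
        (mu n k - (1 + d)) * (1 - \sum_l al n k l ^+ 2) <= r%:R * d &
        lam k - d <= \sum_(b < q n | (b < k)%N) mu n b * al n b k ^+ 2 + mu n k]) ->
  forall k : 'I_r, mu n k @[n --> \oo] --> lam k /\ al n k k ^+ 2 @[n --> \oo] --> (1 : R).
Proof.
move=> rq lam1 lam_decr mu0 row col near_eq.
suff claim (j : nat) : forall k : 'I_r, (k < j)%N -> forall e : R, 0 < e ->
    \forall n \near \oo, `|mu n k - lam k| <= e /\ 1 - al n k k ^+ 2 <= e.
  move=> k; have {}claim := claim k.+1 k (leqnn _).
  split; apply/cvgrPdist_le => e e0.
    by apply: filterS (claim e e0) => n [+ _]; rewrite distrC.
  apply: filterS2 rq (claim e e0) => n rq [_ H1].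
  have kq : (k < q n)%N by exact: leq_trans (ltn_ord k) rq.
  rewrite ger0_norm// subr_ge0; apply: le_trans (row n (Ordinal kq)).
  by rewrite (bigD1 k)//= lerDl sumr_ge0// => l _; exact: sqr_ge0.
elim: j => [//|j IH] k kj e e0.
have [L [L0 lamL]] : exists L : R, 0 <= L /\ forall l, lam l <= L.
  exists (\sum_l `|lam l|); split; first exact: sumr_ge0.
  by move=> l; apply: le_trans (ler_norm _) _; rewrite (bigD1 l)//= lerDl sumr_ge0.
have [g [g0 lamk lamkl]] : exists g : R, [/\ 0 < g, g <= lam k - 1 &
    forall l : 'I_r, (k < l)%N -> g <= lam k - lam l].
  exists (\big[Num.min/lam k - 1]_(l < r | (k < l)%N) (lam k - lam l)); split.
  - by apply: lt_bigmin => [|l kl]; rewrite subr_gt0 ?lam_decr.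
  - exact: bigmin_le_id.
  - by move=> l kl; apply: bigmin_le_cond.
have [C [C0 CE]] : exists C : R, 0 <= C /\ C = r%:R * (2 / g + (1 + 4 / g ^+ 2)).
  by eexists; split; last reflexivity;
    rewrite mulr_ge0// !addr_ge0// divr_ge0 ?sqr_ge0 ?(ltW g0).
have [D [D0 DE]] : exists D : R, 0 < D /\ D = 2 + r%:R * (L + 1).
  by eexists; split; last reflexivity; rewrite ltr_wpDr// mulr_ge0// addr_ge0.
have [d [d0 d1 d2 d3 [d4 d5]]] : exists d : R, [/\ 0 < d, d <= 1, d * D <= g / 2,
    C * d <= 3 / 4 & C * d <= e /\ 2 * d <= e].
  (* The divisor is [C + 1] because only [C >= 0] is recorded. *)
  exists (Num.min 1 (Num.min (g / 2 / D) (Num.min (3 / 4 / (C + 1))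
    (Num.min (e / (C + 1)) (e / 2))))).
  set d := Num.min _ _; have : d <= d by [].
  have C1 : 0 < C + 1 by lra.
  rewrite {2}/d !le_min !ler_pdivlMr// => /and5P[d1 d2 d3 d4 d5].
  have d0 : 0 < d by rewrite /d !lt_min ltr01 !divr_gt0.
  by split=> //; [lra | split; lra].
have IHd : \forall n \near \oo, forall a : 'I_r, (a < k)%N ->
    `|mu n a - lam a| <= d /\ 1 - al n a a ^+ 2 <= d.
  apply: filter_forall => a; have [ak|] := ltnP a k; last by move=> ?; exact: nearW.
  by apply: filterS (IH a _ d d0) => //; exact: leq_trans ak _.
apply: filterS3 rq IHd (near_eq d d0) => n rq {}IHd /(_ k)[H1 H2 H3].
have := eigen_step rq d0 d1 g0 L0 (mu0 n) lamL lamk lamkl H1 H2 H3 (row n) (col n) IHd.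
rewrite -DE -CE => /(_ d2 d3)[H4 H5].
by split; [exact: le_trans H5 d5 | exact: le_trans H4 d4].
Qed.

(** * Frobenius norms and the difference of the two predictors *)

Lemma sqr_fnorm (R : realType) (m n : nat) (A : 'M[R]_(m, n)) :
  fnorm A ^+ 2 = \sum_i \sum_j A i j ^+ 2.
Proof.
by rewrite /fnorm sqr_sqrtr// sumr_ge0// => i _; apply: sumr_ge0 => j _; exact: sqr_ge0.
Qed.

Lemma sqr_sum_le (R : realType) (r : nat) (a : 'I_r -> R) :
  (\sum_k a k) ^+ 2 <= r%:R * \sum_k a k ^+ 2.
Proof.
have := cauchy_schwarz (\col_k a k) (const_mx 1).
have -> : inner (\col_k a k) (const_mx 1) = \sum_k a k.
  by apply: eq_bigr => k _; rewrite !mxE mulr1.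
rewrite -ler_sqr ?nnegrE ?mulr_ge0 ?enorm_ge0// real_normK ?num_real//.
rewrite exprMn !sqr_enorm mulrC => /le_trans; apply.
rewrite le_eqVlt; apply/orP; left; apply/eqP; congr (_ * _).
  rewrite /inner (eq_bigr (fun=> 1)) ?sumr_const ?card_ord// => k _.
  by rewrite !mxE mulr1.
by apply: eq_bigr => k _; rewrite !mxE -expr2.
Qed.

Lemma sqr_fnorm_sum (R : realType) (m n r : nat) (A : 'I_r -> 'M[R]_(m, n)) :
  fnorm (\sum_k A k) ^+ 2 <= r%:R * \sum_k fnorm (A k) ^+ 2.
Proof.
under [X in _ <= _ * X]eq_bigr do rewrite sqr_fnorm.
rewrite sqr_fnorm [X in _ <= _ * X]exchange_big mulr_sumr; apply: ler_sum => i _.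
rewrite [X in _ <= _ * X]exchange_big mulr_sumr; apply: ler_sum => j _.
by rewrite summxE; exact: sqr_sum_le.
Qed.

(** The Frobenius inner product of [u v^T] and [x y^T] is [<u, x> <v, y>]. *)
Lemma sqr_fnorm_rank1_sub (R : realType) (m n : nat) (a b : R)
    (u x : 'cV[R]_m) (v y : 'cV[R]_n) :
  fnorm (a *: (u *m v^T) - b *: (x *m y^T)) ^+ 2 =
    a ^+ 2 * (inner u u * inner v v) - 2 * a * b * (inner u x * inner v y) +
    b ^+ 2 * (inner x x * inner y y).
Proof.
rewrite sqr_fnorm /inner !big_distrlr /= !mulr_sumr -sumrB -big_split.
apply: eq_bigr => i _; rewrite !mulr_sumr -sumrB -big_split.
apply: eq_bigr => j _; rewrite !mxE !big_ord1 !mxE /=.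
by ring.
Qed.

Section shrinker_limit.
Variables (R : realType) (r : nat) (t : 'I_r -> R) (p : nat -> nat).
Variables (u : forall n, 'I_r -> 'cV[R]_(p n)) (zeta : forall n, 'I_r -> 'cV[R]_n).
Variables (N : forall n, 'M[R]_(p n, n)).
Variables (s : nat -> nat -> R) (uh : forall n, nat -> 'cV[R]_(p n)).
Variables (vh : forall n, nat -> 'cV[R]_n).
Arguments u : clear implicits.
Arguments zeta : clear implicits.
Arguments N : clear implicits.
Arguments uh : clear implicits.
Arguments vh : clear implicits.
Hypothesis t_decr : forall k l : 'I_r, (k < l)%N -> t l < t k.
Hypothesis t_pos : forall k, 0 < t k.
Hypothesis u_orth : forall n k l, inner (u n k) (u n l) = (k == l)%:R.
Hypothesis r_le : \forall n \near \oo, (r <= minn (p n) n)%N.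
Let Y n := signal_plus_noise t (u n) (zeta n) (N n).
Hypothesis Y_svd : forall n, is_svd (Y n) (s n) (uh n) (vh n).
Hypothesis N_opnorm : forall e : R, 0 < e ->
  \forall n \near \oo, forall x, enorm ((N n)^T *m x) <= (1 + e) * enorm x.
Hypothesis N_u : forall k (e : R), 0 < e ->
  \forall n \near \oo, `|enorm ((N n)^T *m u n k) ^+ 2 - 1| < e.
Hypothesis N_zeta : forall k (e : R), 0 < e ->
  \forall n \near \oo, forall x, `|inner x (N n *m zeta n k)| <= e * enorm x.
Hypothesis zeta_orth : forall k l (e : R), 0 < e ->
  \forall n \near \oo, `|inner (zeta n k) (zeta n l) - (k == l)%:R| < e.

Let form_near (d : R) : 0 < d -> \forall n \near \oo,
  (forall l x, `|inner ((Y n)^T *m x) ((Y n)^T *m u n l) -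
     (t l ^+ 2 + 1) * inner x (u n l)| <= d * enorm x) /\
  (forall x, (forall l, inner (u n l) x = 0) ->
     inner ((Y n)^T *m x) ((Y n)^T *m x) <= (1 + d) * inner x x).
Proof.
move=> d0; have [C [C0 CE]] : exists C : R, 0 < C /\ C = (\sum_k t k + 1) ^+ 2.
  eexists; split; last reflexivity.
  by rewrite exprn_gt0// ltr_wpDl// sumr_ge0// => k _; exact: ltW.
(* The error [C * e + 2 * a] splits [d] into two halves. The condition [3 * e <= d] below serves the
   orthogonal complement, where [(1 + e)^2 <= 1 + 3 e]. *)
have [a [a0 aE]] : exists a : R, 0 < a /\ a * 4 = d by exists (d / 4); split; lra.
have [e [e0 e1 ea2 ea [eC ed]]] : exists e : R, [/\ 0 < e, e <= 1, 16 * e <= a ^+ 2,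
    3 * e <= a & C * e * 2 <= d /\ 3 * e <= d].
  exists (Num.min 1 (Num.min (a ^+ 2 / 16) (Num.min (a / 3) (Num.min (d / (C * 2)) (d / 3))))).
  set e := Num.min _ _; have : e <= e by [].
  have C2 : 0 < C * 2 by lra.
  have e0 : 0 < e by rewrite /e !lt_min ltr01 !divr_gt0// exprn_gt0.
  rewrite {2}/e !le_min => /and5P[d1 d2 d3]; rewrite ler_pdivlMr// => d4 d5.
  by split=> //; [lra | lra | split; lra].
near=> n.
have Nop : forall x, enorm ((N n)^T *m x) <= (1 + e) * enorm x.
  by near: n; exact: N_opnorm.
have Nu : forall l, `|enorm ((N n)^T *m u n l) ^+ 2 - 1| < e.
  by near: n; apply: filter_forall => l; exact: N_u.
split=> [l x|x ux]; last first.
  rewrite (signal_plus_noise_orth _ _ _ ux) -!sqr_enorm.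
  have := Nop x; rewrite -ler_sqr ?nnegrE ?mulr_ge0 ?enorm_ge0//; last by lra.
  move=> /le_trans; apply; rewrite exprMn ler_wpM2r ?sqr_ge0//.
  by nra.
apply: le_trans (_ : ((\sum_k t k + 1) ^+ 2 * e + 2 * a) * enorm x <= _).
  apply: signal_plus_noise_form => //; first exact: ltW.
  - by near: n; apply: filter_forall => k; exact: N_zeta.
  - near: n; apply: filter_forall => k; apply: filter_forall => k'.
    by apply: filterS (zeta_orth k k' e0) => n; exact: ltW.
  - apply: (@near_isometry_inner _ _ _ _ _ a e) => //; by rewrite u_orth eqxx.
by rewrite -CE ler_wpM2r ?enorm_ge0//; lra.
Unshelve. all: by end_near. Qed.

Let mu n a := s n a ^+ 2.
Let al n a l := inner (uh n a) (u n l).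
Let lam k := t k ^+ 2 + 1.

Let eigen_limit (k : 'I_r) :
  mu n k @[n --> \oo] --> lam k /\ al n k k ^+ 2 @[n --> \oo] --> (1 : R).
Proof.
have uh1 n (a : 'I_(minn (p n) n)) : inner (uh n a) (uh n a) = 1.
  by case: (Y_svd n) => H _ _ _ _; rewrite H ?eqxx.
apply: (eigen_cvg (q := fun n => minn (p n) n)) => //.
- by move=> l; rewrite /lam ltrDr exprn_gt0.
- by move=> i j ij; rewrite /lam ltrD2r ltr_sqr ?nnegrE ?ltW// t_decr.
- by move=> n a; exact: sqr_ge0.
- move=> n a; rewrite -(uh1 n a); apply: le_trans (bessel (u_orth n) (uh n a)).
  by apply: ler_sum => l _; rewrite /al innerC.
- by move=> n l; have := svd_bessel_left (Y_svd n) (u n l); rewrite u_orth eqxx.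
move=> d d0; apply: filterS2 r_le (form_near d0) => n rq [H1 H2] l.
have lq : (l < minn (p n) n)%N by exact: leq_trans (ltn_ord l) rq.
have d0' := ltW d0; split.
- by move=> l'; exact: (perturb_gap (Y_svd n) H1 (Ordinal lq)).
- exact: (perturb_residual (Y_svd n) (u_orth n) d0' H1 H2 (Ordinal lq)).
- exact: (perturb_lower (Y_svd n) (u_orth n) H1 (Ordinal lq)).
Qed.

Lemma sqr_fnorm_shrinker_sub :
  fnorm (\sum_(k < r) opt_sv t 0 k *: (uh n k *m (vh n k)^T) -
    \sum_k (t k ^+ 2 / (t k ^+ 2 + 1)) *: (u n k *m ((Y n)^T *m u n k)^T)) ^+ 2
  @[n --> \oo] --> (0 : R).
Proof.
pose c k := t k ^+ 2 / lam k.
(* Once [r <= minn (p n) n], this is the squared norm of the [k]-th term of the difference, [vh]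
   having been eliminated by [svd_right]. *)
pose f k n := opt_sv t 0 k ^+ 2 - 2 * opt_sv t 0 k * c k * (s n k * al n k k ^+ 2) +
  c k ^+ 2 * inner ((Y n)^T *m u n k) ((Y n)^T *m u n k).
have lam0 k : 0 < lam k by rewrite /lam ltr_wpDl ?sqr_ge0.
have f0 k : f k n @[n --> \oo] --> (0 : R).
  have [mu_lim al_lim] := eigen_limit k.
  have s_lim : s n k @[n --> \oo] --> Num.sqrt (lam k).
    apply: cvg_trans (continuous_cvg _ (@sqrt_continuous R (lam k)) mu_lim).
    apply: near_eq_cvg; apply: filterS r_le => n rq.
    have kq : (k < minn (p n) n)%N by exact: leq_trans (ltn_ord k) rq.
    by case: (Y_svd n) => _ _ s0 _ _; rewrite /= /mu sqrtr_sqr ger0_norm ?s0.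
  have Y_lim : inner ((Y n)^T *m u n k) ((Y n)^T *m u n k) @[n --> \oo] --> lam k.
    apply/cvgrPdist_le => e e0; apply: filterS (form_near e0) => n [/(_ k (u n k)) + _].
    by rewrite u_orth eqxx mulr1 /enorm u_orth eqxx sqrtr1 mulr1 distrC.
  (* The limit is the square of [opt_sv t 0 k - c k * sqrt (lam k)], which vanishes because
     [opt_sv t 0 k = t_k^2 / sqrt (lam k)]: the shrinker is tuned for this cancellation. *)
  have -> : 0 = opt_sv t 0 k ^+ 2 - 2 * opt_sv t 0 k * c k * (Num.sqrt (lam k) * 1) +
      c k ^+ 2 * lam k.
    have sl0 : Num.sqrt (lam k) != 0 by rewrite gt_eqF ?sqrtr_gt0.
    have slE : Num.sqrt (lam k) ^+ 2 = lam k by rewrite sqr_sqrtr ?ltW.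
    rewrite /opt_sv /Num.min /Num.max ltr10 addr0 -/(lam k) sqrtrM ?sqr_ge0//.
    rewrite sqrtr_sqr sqrtrV ?ltW// gtr0_norm// /c.
    by move: slE sl0; move: (Num.sqrt _) => x <- x0; field.
  apply: cvgD; first apply: cvgB.
  - exact: cvg_cst.
  - by apply: cvgMr; exact: cvgM.
  - exact: cvgMr.
apply: (@squeeze_cvgr _ _ _ _ (fun=> 0) (fun n => r%:R * \sum_k f k n)).
- apply: filterS r_le => n rq; rewrite sqr_ge0/= -sumrB.
  apply: le_trans (sqr_fnorm_sum _) _; rewrite ler_wpM2l//.
  apply: ler_sum => k _; rewrite sqr_fnorm_rank1_sub.
  have kq : (k < minn (p n) n)%N by exact: leq_trans (ltn_ord k) rq.
  have := svd_right (Y_svd n) (Ordinal kq) (u n k) => /= ->.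
  case: (Y_svd n) => uh1 vh1 _ _ _; rewrite uh1// vh1// eqxx u_orth eqxx !mulr1 mul1r.
  by rewrite /f /c /lam -/(al n k k) [al n k k * _]mulrCA -expr2.
- exact: cvg_cst.
- rewrite -[X in _ --> X](mulr0 r%:R); apply: cvgMr.
  rewrite -[X in _ --> X](@big1_eq _ 0 +%R 'I_r (index_enum 'I_r) xpredT).
  by apply: cvg_big => //; exact: add_continuous.
Qed.

End shrinker_limit.

(** * From the model to the deterministic limit *)

(** The null set may depend on [e]; monotonicity in [e] reduces all tolerances to the countably many
    [1 / (m + 1)]. *)
Lemma ae_forall_gt0 d (T : measurableType d) (R : realType) (P : probability T R)
    (Q : R -> nat -> T -> Prop) :
  (forall e e' n w, e <= e' -> Q e n w -> Q e' n w) ->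
  (forall e, 0 < e -> {ae P, forall w, \forall n \near \oo, Q e n w}) ->
  {ae P, forall w, forall e, 0 < e -> \forall n \near \oo, Q e n w}.
Proof.
move=> Q_le HQ.
have : {ae P, forall w, forall m : nat, \forall n \near \oo, Q m.+1%:R^-1 n w}.
  by apply: ae_foralln => m; apply: HQ; rewrite invr_gt0.
apply: filterS => w HQw e e0; apply: filterS (HQw (Num.truncn e^-1)) => n.
by apply: Q_le; rewrite invf_ple ?posrE// ltW// truncnS_gt.
Qed.

Lemma mean_sqr_column_diff (R : realType) (m n : nat) (A B : 'M[R]_(m, n)) :
  n%:R^-1 * (\sum_(j < n) enorm (column_of_mx A j - column_of_mx B j) ^+ 2) =
  fnorm (A - B) ^+ 2.
Proof.
rewrite sqr_fnorm exchange_big mulr_sumr; apply: eq_bigr => j _.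
rewrite sqr_enorm /inner mulr_sumr; apply: eq_bigr => i _.
rewrite !mxE -mulrBr mulrACA -!expr2 sqr_sqrtr//.
by rewrite mulKf// pnatr_eq0 -lt0n; apply: leq_ltn_trans (ltn_ord j).
Qed.

Section model_matrices.
Variables (R : realType) (r p n : nat) (t : 'I_r -> R) (u : 'I_r -> 'cV[R]_p).

Lemma signal_mxE (z : 'I_n -> 'I_r -> R) :
  signal_mx t u z =
  \sum_k t k *: (u k *m (\col_j ((Num.sqrt n%:R)^-1 * z j k))^T).
Proof.
apply/matrixP => i j; rewrite !mxE !summxE mulr_sumr.
apply: eq_bigr => k _; rewrite !mxE big_ord1 !mxE.
by ring.
Qed.

(** Brings the linear predictor to a sum of [r] rank-one terms, to be compared with the shrinker
    term by term. *)
Lemma blp_mxE (Y : 'M[R]_(p, n)) :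
  blp_mx t u Y = \sum_k (t k ^+ 2 / (t k ^+ 2 + 1)) *: (u k *m (Y^T *m u k)^T).
Proof.
apply/matrixP => i j; rewrite !mxE !summxE mulr_sumr.
apply: eq_bigr => k _; rewrite !mxE big_ord1 !mxE innerZl.
have -> : inner (col j Y) (u k) = \sum_h Y^T j h * u k h 0.
  by apply: eq_bigr => h _; rewrite !mxE.
have n0 : (0 < n)%N by exact: leq_ltn_trans (ltn_ord j).
have sn0 : Num.sqrt (n%:R : R) != 0 by rewrite gt_eqF// sqrtr_gt0 ltr0n.
by move: (t k ^+ 2 / _) => c; field.
Qed.

Hypothesis u_orth : forall k l, inner (u k) (u l) = (k == l)%:R.

(** Projecting the signal on [u k] recovers [z j k], which is therefore measurable for the
    sigma-algebra of [X]. This matters because the noise is assumed independent of [X] rather than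
    of [z]. *)
Lemma signal_mx_coordinate (z : 'I_n -> 'I_r -> R) j k :
  \sum_i u k i 0 * signal_mx t u z i j = t k * ((Num.sqrt n%:R)^-1 * z j k).
Proof.
have -> : \sum_i u k i 0 * signal_mx t u z i j =
    (Num.sqrt n%:R)^-1 * inner (u k) (\sum_(l < r) (t l * z j l) *: u l).
  by rewrite /inner mulr_sumr; apply: eq_bigr => i _; rewrite !mxE; ring.
by rewrite (inner_orth_sum u_orth); ring.
Qed.

End model_matrices.

Section signal_gram.
Context d (T : measurableType d) (R : realType) (P : probability T R).
Variables (r : nat) (z : nat -> 'I_r -> {RV P >-> R}).
Hypothesis z_mean : forall j k, ('E_P[z j k] = 0)%E.
Hypothesis z_var : forall j k, ('V_P[z j k] = 1)%E.
Hypothesis z_subgauss : forall j k, sub_gaussian P (z j k).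
Hypothesis z_uncorrelated : forall j k l, k != l -> covariance P (z j k) (z j l) = 0%E.
Hypothesis z_independent : independent P (fun j => sigma_rv (z j)).
Hypothesis z_identical : forall i j (B : set (r.-tuple R)), measurable B ->
  P ((fun w => [tuple z i k w | k < r]) @^-1` B) =
  P ((fun w => [tuple z j k w | k < r]) @^-1` B).

Lemma signal_gram k l (e : R) : 0 < e ->
  {ae P, forall w, \forall n \near \oo,
    `|n%:R^-1 * (\sum_(j < n) z j k w * z j l w) - (k == l)%:R| < e}.
Proof.
move=> e0; have [c c0 Hc] := signal_tail z_mean z_var z_subgauss z_uncorrelated
  z_independent z_identical k l e0.
pose B (n : nat) := [set w | e <= `|n%:R^-1 * (\sum_(j < n) z j k w * z j l w) - (k == l)%:R|].
have mB n : measurable (B n).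
  apply: measurable_ge; apply: measurableT_comp => //.
  apply: measurable_funB => //; apply: measurable_funM => //.
  by apply: measurable_sum => j; exact: measurable_funM.
have PB : \forall n \near \oo, (P (B n) <= (2 * expR (- (c * n%:R)))%:E)%E.
  by near=> n; apply: Hc; near: n; exact: nbhs_infty_gt.
apply: filterS (borel_cantelli_expR c0 mB PB) => w; apply: filterS => n /negP.
by rewrite -ltNge.
Unshelve. all: by end_near. Qed.

End signal_gram.

Theorem theorem4p1 (d : measure_display) (T : measurableType d) (R : realType)
  (P : probability T R)
  (r : nat) (r_ge1 : (1 <= r)%N)
  (t : 'I_r -> R)
  (t_decr : forall k l : 'I_r, (k < l)%N -> t l < t k)
  (t_pos : forall k : 'I_r, 0 < t k)
  (p : nat -> nat)
  (p_infty : p n @[n --> \oo] --> \oo)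
  (p_ratio : ((p n)%:R / n%:R : R) @[n --> \oo] --> (0 : R))
  (u : forall n : nat, 'I_r -> 'cV[R]_(p n))
  (u_orthonormal : forall (n : nat) (k l : 'I_r),
     inner (u n k) (u n l) = (k == l)%:R)
  (z : nat -> 'I_r -> {RV P >-> R})
  (z_mean : forall (j : nat) (k : 'I_r), ('E_P[z j k] = 0)%E)
  (z_var : forall (j : nat) (k : 'I_r), ('V_P[z j k] = 1)%E)
  (z_subgauss : forall (j : nat) (k : 'I_r), sub_gaussian P (z j k))
  (z_uncorrelated : forall (j : nat) (k l : 'I_r), k != l ->
     covariance P (z j k) (z j l) = 0%E)
  (z_independent : independent P (fun j : nat => sigma_rv (z j)))
  (z_identical : forall (i j : nat) (B : set (r.-tuple R)), measurable B ->
     P ((fun w => [tuple z i k w | k < r]) @^-1` B) =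
     P ((fun w => [tuple z j k w | k < r]) @^-1` B))
  (G : forall n : nat, 'I_(p n) -> 'I_n -> {RV P >-> R})
  (G_normal : forall (n : nat) (i : 'I_(p n)) (j : 'I_n) (B : set R),
     measurable B ->
     distribution P (G n i j) B = normal_prob 0 (Num.sqrt n%:R^-1) B)
  (G_independent : forall n : nat,
     independent P (fun ij : 'I_(p n) * 'I_n =>
       sigma_rv (fun _ : unit => G n ij.1 ij.2 : T -> R)))
  (X : forall n : nat, T -> 'M[R]_(p n, n))
  (X_def : forall (n : nat) (w : T),
     X n w = signal_mx t (u n) (fun j k => z j k w))
  (GX_independent : forall n : nat,
     independent2 P
       (sigma_rv (fun ij : 'I_(p n) * 'I_n => G n ij.1 ij.2 : T -> R))
       (sigma_rv (fun (ij : 'I_(p n) * 'I_n) w => X n w ij.1 ij.2)))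
  (Y : forall n : nat, T -> 'M[R]_(p n, n))
  (Y_def : forall (n : nat) (w : T),
     Y n w = X n w + \matrix_(i < p n, j < n) G n i j w)
  (shat : forall n : nat, T -> nat -> R)
  (uhat : forall n : nat, T -> nat -> 'cV[R]_(p n))
  (vhat : forall n : nat, T -> nat -> 'cV[R]_n)
  (Y_svd : forall (n : nat) (w : T),
     is_svd (Y n w) (shat n w) (uhat n w) (vhat n w))
  (Xq Xblp : forall n : nat, T -> 'M[R]_(p n, n))
  (Xq_def : forall (n : nat) (w : T),
     Xq n w = opt_shrinker t 0 (uhat n w) (vhat n w))
  (Xblp_def : forall (n : nat) (w : T), Xblp n w = blp_mx t (u n) (Y n w)) :
  {ae P, forall w : T,
    (n%:R^-1 * (\sum_(j < n)
        enorm (column_of_mx (Xq n w) j - column_of_mx (Xblp n w) j) ^+ 2) : R)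
      @[n --> \oo] --> (0 : R) /\
    (fnorm (Xq n w - Xblp n w) ^+ 2 : R) @[n --> \oo] --> (0 : R)}.
Proof.
pose zeta n k w : 'cV[R]_n := \col_j ((Num.sqrt n%:R)^-1 * z j k w).
have XE n w : X n w = \sum_k t k *: (u n k *m (zeta n k w)^T).
  by rewrite X_def signal_mxE.
have YE n w : Y n w = signal_plus_noise t (u n) (zeta n ^~ w) (noise_mx G n w).
  by rewrite Y_def XE.
have zeta_inner n k l w : inner (zeta n k w) (zeta n l w) =
    n%:R^-1 * (\sum_(j < n) z j k w * z j l w).
  rewrite /inner mulr_sumr; apply: eq_bigr => j _; rewrite !mxE mulrACA -invfM.
  by rewrite -expr2 sqr_sqrtr.
have gram k l (e : R) : 0 < e -> {ae P, forall w, \forall n \near \oo,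
    `|inner (zeta n k w) (zeta n l w) - (k == l)%:R| < e}.
  move=> e0; have := signal_gram z_mean z_var z_subgauss z_uncorrelated
    z_independent z_identical k l e0.
  by apply: filterS => w; apply: filterS => n; rewrite zeta_inner.
have cross k (e : R) : 0 < e -> {ae P, forall w, \forall n \near \oo,
    forall x, `|inner x (noise_mx G n w *m zeta n k w)| <= e * enorm x}.
  move=> e0; apply: (noise_cross p_ratio G_normal G_independent
    (I := fun n => ('I_(p n) * 'I_n)%type)
    (X := fun n ij w => X n w ij.1 ij.2)
    (v := fun n j w => (Num.sqrt n%:R)^-1 * z j k w)) => //.
  - move=> n [i j] /=.
    rewrite (_ : (fun w => X n w i j) = fun w =>
        \sum_l t l * (u n l i 0 * ((Num.sqrt n%:R)^-1 * z j l w))); last first.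
      apply/funext => w; rewrite XE summxE; apply: eq_bigr => l _.
      by rewrite !mxE big_ord1 !mxE.
    by apply: measurable_sum => l; do 3 apply: measurable_funM => //.
  - move=> n j; rewrite (_ : (fun w => (Num.sqrt n%:R)^-1 * z j k w) = fun w =>
        (t k)^-1 * \sum_i u n k i 0 * X n w i j); last first.
      apply/funext => w; rewrite X_def (signal_mx_coordinate t (u_orthonormal n)).
      by rewrite mulKf// gt_eqF.
    apply: measurable_funM; first exact: measurable_cst.
    apply: measurable_sum => i; apply: measurable_funM; first exact: measurable_cst.
    exact: (@measurable_sigma_gen _ _ _ _ _ (i, j)).
  (* The bound 2 on the squared norm of [zeta] is the Gram estimate with tolerance 1. *)
  - apply: filterS (gram k k 1 ltr01) => w; apply: filterS => n.
    rewrite eqxx ltr_norml => /andP[_]; rewrite ltrBlDr => /ltW.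
    by under [X in X <= _ -> _]eq_bigr do rewrite !mxE -expr2.
(* Ensures that the first [r] singular vectors are genuine: [is_svd] constrains only the indices
   below [minn (p n) n]. *)
have r_le : \forall n \near \oo, (r <= minn (p n) n)%N.
  near=> n; rewrite leq_min; apply/andP; split; near: n; last exact: nbhs_infty_ge.
  exact: (p_infty _ (nbhs_infty_ge r)).
have HN : {ae P, forall w, forall e : R, 0 < e -> \forall n \near \oo,
    forall x, enorm ((noise_mx G n w)^T *m x) <= (1 + e) * enorm x}.
  apply: ae_forall_gt0 => [e e' n w ee' H x|e e0].
    by apply: le_trans (H x) _; rewrite ler_wpM2r ?enorm_ge0 ?lerD2l.
  exact: (noise_opnorm p_ratio G_normal G_independent).
have Hu : {ae P, forall w, forall k (e : R), 0 < e -> \forall n \near \oo,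
    `|enorm ((noise_mx G n w)^T *m u n k) ^+ 2 - 1| < e}.
  apply: filter_forall => k; apply: ae_forall_gt0 => [e e' n w ee' H|e e0].
    exact: lt_le_trans H ee'.
  apply: (noise_norm G_normal G_independent) => // n.
  by rewrite u_orthonormal eqxx.
have Hz : {ae P, forall w, forall k (e : R), 0 < e -> \forall n \near \oo,
    forall x, `|inner x (noise_mx G n w *m zeta n k w)| <= e * enorm x}.
  apply: filter_forall => k; apply: ae_forall_gt0 => [e e' n w ee' H x|e e0].
    by apply: le_trans (H x) _; rewrite ler_wpM2r ?enorm_ge0.
  exact: cross.
have Hg : {ae P, forall w, forall k l (e : R), 0 < e -> \forall n \near \oo,
    `|inner (zeta n k w) (zeta n l w) - (k == l)%:R| < e}.
  apply: filter_forall => k; apply: filter_forall => l.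
  apply: ae_forall_gt0 => [e e' n w ee' H|e e0]; first exact: lt_le_trans H ee'.
  exact: gram.
(* From here on [w] lies outside four null sets, and the rest is deterministic. *)
near=> w.
suff H : fnorm (Xq n w - Xblp n w) ^+ 2 @[n --> \oo] --> (0 : R).
  by split=> //; under eq_cvg do rewrite mean_sqr_column_diff.
under eq_cvg do rewrite Xq_def Xblp_def blp_mxE YE.
apply: (sqr_fnorm_shrinker_sub (u := u) (zeta := fun n => (zeta n)^~ w)
  (N := fun n => noise_mx G n w) (s := shat ^~ w) (uh := uhat ^~ w)
  (vh := vhat ^~ w)) => //.
- by move=> n; rewrite -YE; exact: Y_svd.
- by near: w.
- by near: w.
- by near: w.
- by near: w.
Unshelve. all: by end_near. Qed.
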